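(* Let $N\ge1$, $T\in(0,\infty]$, $\Omega$ a domain in $\mathbb{R}^N$, $Q_{\Omega,T}=\Omega\times(0,T)$. Let $U\in C((0,T);L^1_{loc}(\Omega))$ be any nonnegative weak solution of $$U_t-\Delta U=\Phi\quad\text{in }Q_{\Omega,T},$$ with $\Phi\in L^1_{loc}(Q_{\Omega,T})$. (i) Assume that $\Phi\ge -F$, where $F\in L^1_{loc}(\Omega\times[0,T))$. Then $U(\cdot,t)$ converges weak$^*$ to some Radon measure $U_0$ on $\Omega$ as $t\to0$: $$\lim_{t\to0}\int_\Omega U(\cdot,t)\varphi\,dx=\int_\Omega\varphi\,dU_0\qquad\forall\varphi\in C_c(\Omega).$$ Furthermore, $\Phi\in L^1_{loc}([0,T);L^1_{loc}(\Omega))$, and for any $\varphi\in C_c^2(\Omega\times[0,T))$, $$-\int_0^T\int_\Omega(U\varphi_t+U\Delta\varphi+\Phi\varphi)\,dx\,dt=\int_\Omega\varphi(\cdot,0)\,dU_0 .$$ (ii) Assume that $\Phi$ has a constant sign. Then $$\Phi\in L^1_{loc}([0,T);L^1_{loc}(\Omega))\iff U\in L^\infty_{loc}([0,T);L^1_{loc}(\Omega)).$$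
   Context: For $\Phi\in L^1_{loc}(Q_{\Omega,T})$, $U$ is a weak solution of $U_t-\Delta U=\Phi$ in $Q_{\Omega,T}$ if $U\in L^1_{loc}(Q_{\Omega,T})$ and $\int_0^T\int_\Omega(U\varphi_t+U\Delta\varphi+\Phi\varphi)\,dx\,dt=0$ for every nonnegative $\varphi\in\mathcal{D}(Q_{\Omega,T})$ (equivalently every $\varphi\in\mathcal{D}(Q_{\Omega,T})$). The spaces $L^1_{loc}([0,T);L^1_{loc}(\Omega))$ and $L^\infty_{loc}([0,T);L^1_{loc}(\Omega))$ consist of functions which are in $L^1((0,\tau);L^1(\omega))$, resp. $L^\infty((0,\tau);L^1(\omega))$, for all $\tau\in(0,T)$ and $\omega\subset\subset\Omega$. *)

(* Defs.v *)
From HB Require Import structures.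
From mathcomp Require Import all_boot all_order all_algebra.
From mathcomp Require Import all_classical all_reals all_analysis.

Set Implicit Arguments.
Unset Strict Implicit.
Unset Printing Implicit Defensive.

Import Order.TTheory GRing.Theory Num.Theory.
Import numFieldNormedType.Exports.

Local Open Scope classical_set_scope.
Local Open Scope ring_scope.

(* The sigma-algebra on R^n generated by the coordinate functions, i.e. the
   n-fold product of the Borel sigma-algebra of R, which is the Borel
   sigma-algebra of R^n. *)
Section measurable_rV.
Context {R : realType} {n : nat}.

Definition rV_coord (i : 'I_n) (x : 'rV[R]_n) : R := x ord0 i.

Let rV_set0 : g_sigma_preimage rV_coord set0.
Proof. exact: sigma_algebra0. Qed.

Let rV_setC A : g_sigma_preimage rV_coord A -> g_sigma_preimage rV_coord (~` A).
Proof. exact: sigma_algebraC. Qed.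

Let rV_bigcup (F : (set 'rV[R]_n)^nat) :
  (forall i, g_sigma_preimage rV_coord (F i)) ->
  g_sigma_preimage rV_coord (\bigcup_i (F i)).
Proof. exact: sigma_algebra_bigcup. Qed.

HB.instance Definition _ := @isMeasurable.Build default_measure_display
  'rV[R]_n (g_sigma_preimage rV_coord) rV_set0 rV_setC rV_bigcup.

Lemma measurable_rV_coord (i : 'I_n) :
  measurable_fun [set: 'rV[R]_n] (rV_coord i).
Proof.
move=> _ B mB; rewrite setTI; apply: sub_sigma_algebra.
rewrite -bigcup_seq; exists i; first by rewrite /= mem_index_enum.
by exists B => //; rewrite setTI.
Qed.

Lemma measurable_fun_rV d (T : measurableType d) (f : T -> 'rV[R]_n) :
  (forall i, measurable_fun [set: T] (rV_coord i \o f)) ->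
  measurable_fun [set: T] f.
Proof.
move=> mf; move=> _ B mB; rewrite setTI.
suff : g_sigma_preimage rV_coord `<=` [set A | measurable (f @^-1` A)].
  exact.
apply: smallest_sub.
  split => [|A|F mF] /=; first by rewrite preimage_set0.
    by rewrite setTD => mA; rewrite preimage_setC; exact: measurableC.
  by rewrite preimage_bigcup; exact: bigcupT_measurable.
move=> A; rewrite -bigcup_seq => -[i _ [C mC <-]] /=.
by rewrite setTI -comp_preimage -[X in measurable X]setTI; exact: mf.
Qed.

End measurable_rV.

(* Lebesgue measure on R^n.+1 is the image of lambda_1 \x lambda_n under the
   identification of R * R^n with R^n.+1. *)
Section lebesgue_rV_step.
Context {R : realType} {n : nat}.
Variable m : {sigma_finite_measure set 'rV[R]_n -> \bar R}.

Definition rV_cons (p : measurableTypeR R * 'rV[R]_n) : 'rV[R]_n.+1 :=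
  row_mx (const_mx p.1 : 'rV[R]_1) p.2.

Lemma rV_consE (p : measurableTypeR R * 'rV[R]_n) (i : 'I_n.+1) :
  rV_cons p ord0 i = if unlift ord0 i is Some j then p.2 ord0 j else p.1.
Proof.
rewrite /rV_cons mxE; case: unliftP => [j|] ->; case: splitP => k /=.
- by rewrite ord1.
- by rewrite /bump /= add1n => -[/val_inj ->].
- by rewrite mxE.
- by [].
Qed.

Lemma measurable_rV_cons : measurable_fun setT rV_cons.
Proof.
apply: measurable_fun_rV => i; case E : (unlift ord0 i) => [j|].
  rewrite (_ : _ \o _ = rV_coord j \o snd); last first.
    by apply/funext => p /=; rewrite /rV_coord rV_consE E.
  by apply: measurableT_comp => //; exact: measurable_rV_coord.
rewrite (_ : _ \o _ = fst)//.
by apply/funext => p /=; rewrite /rV_coord rV_consE E.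
Qed.

Definition lebesgue_rV_step : set 'rV[R]_n.+1 -> \bar R :=
  pushforward (@lebesgue_measure R \x m)%E rV_cons.

HB.instance Definition _ := Measure.copy lebesgue_rV_step
  (measure_function_pushforward__canonical__measure_function_Measure
    (@lebesgue_measure R \x m)%E measurable_rV_cons).

Let rV_uncons (x : 'rV[R]_n.+1) : measurableTypeR R * 'rV[R]_n :=
  (x ord0 ord0, \row_j x ord0 (lift ord0 j)).

Let rV_consK : cancel rV_cons rV_uncons.
Proof.
move=> [a x]; congr pair; first by rewrite rV_consE unlift_none.
by apply/rowP => j; rewrite mxE rV_consE liftK.
Qed.

Let measurable_rV_uncons : measurable_fun setT rV_uncons.
Proof.
apply/measurable_fun_pairP; split; first exact: (@measurable_rV_coord R n.+1).
apply: measurable_fun_rV => j.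
rewrite (_ : _ \o _ = rV_coord (lift ord0 j)); first exact: measurable_rV_coord.
by apply/funext => x /=; rewrite /rV_coord mxE.
Qed.

Let lebesgue_rV_step_sigma_finite : sigma_finite setT lebesgue_rV_step.
Proof.
have /sigma_finiteP[F [FT ndF Foo]] := sigma_finiteT (@lebesgue_measure R).
have /sigma_finiteP[G [GT ndG Goo]] := sigma_finiteT m.
exists (fun k => rV_uncons @^-1` (F k `*` G k)).
  apply/esym; rewrite -subTset => x _.
  have [k _ Fk] : (\bigcup_k F k) (rV_uncons x).1 by rewrite -FT.
  have [l _ Gl] : (\bigcup_k G k) (rV_uncons x).2 by rewrite -GT.
  exists (maxn k l) => //; split.
    by move: Fk; exact/subsetPset/ndF/leq_maxl.
  by move: Gl; exact/subsetPset/ndG/leq_maxr.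
move=> k; have [mF Foo'] := Foo k; have [mG Goo'] := Goo k; split.
  rewrite -[X in measurable X]setTI; apply: measurable_rV_uncons => //.
  exact: measurableX.
rewrite /lebesgue_rV_step /pushforward -comp_preimage.
rewrite (_ : rV_uncons \o rV_cons = id); last exact/funext/rV_consK.
by rewrite preimage_id product_measure1E// lte_mul_pinfty// ge0_fin_numE.
Qed.

HB.instance Definition _ := Measure_isSigmaFinite.Build _ _ _
  lebesgue_rV_step lebesgue_rV_step_sigma_finite.

End lebesgue_rV_step.

Fixpoint lebesgue_rV {R : realType} (n : nat) :
    {sigma_finite_measure set 'rV[R]_n -> \bar R} :=
  if n is k.+1 then lebesgue_rV_step (lebesgue_rV k) else \d_(0 : 'rV[R]_0).

Lemma lebesgue_rV_box {R : realType} (n : nat) (A : 'I_n -> set R) :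
  (forall i, measurable (A i)) ->
  (lebesgue_rV n [set x : 'rV[R]_n | forall i, A i (x ord0 i)] =
   \prod_(i < n) lebesgue_measure (A i))%E.
Proof.
elim: n A => [|n IH] A mA /=.
  rewrite big_ord0 diracE (_ : 0 \in _)//.
  by rewrite inE /= => -[].
pose B := [set x : 'rV[R]_n | forall i, A (lift ord0 i) (x ord0 i)].
have mB : measurable B.
  rewrite (_ : B = \bigcap_(i in [set: 'I_n]) (rV_coord i @^-1` A (lift ord0 i))).
    apply: fin_bigcap_measurable => // i _; rewrite -[X in measurable X]setTI.
    exact: measurable_rV_coord.
  by apply/seteqP; split => [x h i _|x h i]; exact: h.
rewrite big_ord_recl -IH//= -product_measure1E//; last exact: mA.
rewrite /lebesgue_rV_step /pushforward.
rewrite (_ : _ @^-1` _ = A ord0 `*` B)//.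
apply/seteqP; split => -[a x] /=.
  move=> h; split => [|i].
    by have := h ord0; rewrite rV_consE unlift_none.
  by have := h (lift ord0 i); rewrite rV_consE liftK.
by case=> h1 h2 i; rewrite rV_consE; case: unliftP => [j|] ->.
Qed.

Section heat.
Context {R : realType} {N : nat}.

Local Notation space := 'rV[R]_N.
Local Notation spacetime := ('rV[R]_N * R)%type.

Definition lebesgue_x : {measure set space -> \bar R} := lebesgue_rV N.

Definition lebesgue_xt :
    {measure set (space * measurableTypeR R)%type -> \bar R} :=
  (lebesgue_rV N \x lebesgue_measure)%E.

Definition domain (Omega : set space) :=
  [/\ open Omega, connected Omega & Omega !=set0].

(* (0, T) and [0, T), where T may be +oo *)
Definition oo_time (T : \bar R) : set R := [set t | 0 < t /\ (t%:E < T)%E].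
Definition co_time (T : \bar R) : set R := [set t | 0 <= t /\ (t%:E < T)%E].

(* Omega * (0, T) and Omega * [0, T) *)
Definition cylinder (Omega : set space) (T : \bar R) : set spacetime :=
  Omega `*` oo_time T.
Definition cylinder0 (Omega : set space) (T : \bar R) : set spacetime :=
  Omega `*` co_time T.

Definition compactly_contained (omega Omega : set space) :=
  [/\ open omega, compact (closure omega) & closure omega `<=` Omega].

(* Functions are total and only their values on the indicated domain D matter;
   elements of the L^p spaces are represented by Borel functions. *)
Definition L1loc_x (D : set space) (f : space -> R) :=
  measurable_fun D f /\
  forall K, compact K -> K `<=` D -> lebesgue_x.-integrable K (EFin \o f).

Definition L1loc_xt (D : set spacetime) (f : spacetime -> R) :=
  measurable_fun D f /\
  forall K, compact K -> K `<=` D -> lebesgue_xt.-integrable K (EFin \o f).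

(* C((0, T); L^1_loc(Omega)) *)
Definition C_L1loc (Omega : set space) (T : \bar R) (f : spacetime -> R) :=
  (forall t, oo_time T t -> L1loc_x Omega (fun x => f (x, t))) /\
  (forall K, compact K -> K `<=` Omega -> forall s, oo_time T s ->
    (\int[lebesgue_x]_(x in K) `|f (x, t) - f (x, s)|%:E)%E @[t --> s]
      --> 0%E).

(* L^p_loc([0, T); L^1_loc(Omega)): the L^p norm on (0, tau) of
   t |-> ||f(., t)||_{L^1(omega)} is finite. *)
Definition Lploc_L1loc (p : \bar R) (Omega : set space) (T : \bar R)
    (f : spacetime -> R) :=
  measurable_fun (cylinder Omega T) f /\
  forall tau omega, oo_time T tau -> compactly_contained omega Omega ->
    ('N[lebesgue_measure]_p[(fun t => \int[lebesgue_x]_(x in omega)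
        `|f (x, t)|%:E) \_ `]0%R, tau[%classic] < +oo)%E.

(* C^k(D), for D contained in the closure of its interior: the derivatives of
   order <= k exist in the interior of D and extend continuously to D. For D
   open this is the usual C^k(D). *)
Fixpoint Ck (V : normedModType R) (D : set V) (k : nat) (f : V -> R) : Prop :=
  {within D, continuous f} /\
  if k is k'.+1 then
    forall v : V, (forall x, D° x -> derivable f x v) /\
      exists2 g : V -> R, (forall x, D° x -> g x = 'D_v f x) & Ck D k' g
  else True.

Definition compact_support (V : normedModType R) (D : set V) (f : V -> R) :=
  exists K, [/\ compact K, K `<=` D & forall x, D x -> ~ K x -> f x = 0].

Definition Ck_c (V : normedModType R) (D : set V) (k : nat) (f : V -> R) :=
  Ck D k f /\ compact_support D f.

Definition test_function (V : normedModType R) (D : set V) (f : V -> R) :=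
  (forall k, Ck D k f) /\ compact_support D f.

Definition dt (phi : spacetime -> R) (z : spacetime) : R :=
  'D_((0, 1) : spacetime) phi z.

Definition dx (i : 'I_N) (phi : spacetime -> R) (z : spacetime) : R :=
  'D_((delta_mx 0 i, 0) : spacetime) phi z.

Definition laplacian (phi : spacetime -> R) (z : spacetime) : R :=
  \sum_(i < N) dx i (dx i phi) z.

(* Integral over Omega * (0, T) for dx dt. It is extended-real valued, so that
   for a measurable integrand equality with a finite value entails
   integrability. *)
Definition heat_integral (Omega : set space) (T : \bar R)
    (U Phi phi : spacetime -> R) : \bar R :=
  (\int[lebesgue_xt]_(z in cylinder Omega T)
    (U z * dt phi z + U z * laplacian phi z + Phi z * phi z)%:E)%E.

Definition weak_solution (Omega : set space) (T : \bar R)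
    (U Phi : spacetime -> R) :=
  L1loc_xt (cylinder Omega T) U /\
  forall phi, test_function (cylinder Omega T) phi ->
    (forall z, cylinder Omega T z -> 0 <= phi z) ->
    heat_integral Omega T U Phi phi = 0%E.

(* A Radon measure on Omega is seen as a measure on R^N carried by Omega. *)
Definition radon_measure (Omega : set space)
    (mu : {measure set space -> \bar R}) :=
  mu (~` Omega) = 0%E /\
  forall K, compact K -> K `<=` Omega -> (mu K < +oo)%E.

End heat.

(* Main.v *)
Require Import Defs.
From HB Require Import structures.
From mathcomp Require Import all_boot all_order all_algebra.
From mathcomp Require Import all_classical all_reals all_analysis.
From mathcomp Require Import measurable_realfun ess_sup_inf ring lra.

Set Implicit Arguments.
Unset Strict Implicit.
Unset Printing Implicit Defensive.

Import Order.TTheory GRing.Theory Num.Theory.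
Import numFieldNormedType.Exports.

Local Open Scope classical_set_scope.
Local Open Scope ring_scope.

(* Mollification extends the weak formulation from smooth nonnegative tests to
   all compactly supported tests of class C^{2,1}. Cutting off in time near s
   turns it into the mass identity
     int U(s) g(s) dx + int_{t > s} (U g_t + U Lap g + Phi g) dx dt = 0
   for tests g supported in Omega * [0, T).
   Choosing for g a product of bumps in space times e^{Ct}, which satisfies
   g_t + Lap g >= 0, and using Phi >= - F and U >= 0, bounds the local mass of
   U(t) uniformly as t -> 0. Once the masses are bounded, the same identity
   with a cutoff bounds int (Phi + F) on {t > s} independently of s, so Phi is
   integrable up to t = 0 by monotone convergence. Then int U(t) g(t) dx
   converges as t -> 0 for every g; approximating phi in C_c(Omega) uniformly
   by such g, int U(t) phi dx converges to a positive linear functional of phi,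
   which is a Radon measure by the Riesz representation theorem. The identity
   of (i) is the limit s -> 0 of the mass identity. For (ii), F = |Phi| gives
   the bound on the masses when Phi is integrable, and conversely the bound on
   the masses yields the integrability of a Phi of constant sign. *)

(** * Borel sets and Lebesgue measure on space-time *)

(** The obstacle is that nothing is known about U near t = 0. In the mass identity the integral of U
    Lap g over {t > s} could diverge as s -> 0, and an ordinary cutoff g does not control it. A test
    with g_t + Lap g >= 0 gives this term a favourable sign, because U >= 0. Products of the bumps
    exp(- 2 / (1 - s^2)) allow this: near the edge of its support the bump is convex, and inside it
    is bounded away from zero, so its second derivative is at least - 64 times the bump. Scaling to
    radius r in dimension N gives C = 64 N / r^2. In (i) the order of the estimates is forced: the
    integral of Phi up to t = 0 is controlled only through the masses, and the masses only through
    the one-sided bound on Phi. Nonnegativity of U is given almost everywhere in space-time, whereas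
    masses are taken at every time. Continuity of t |-> U(t) in L^1 closes this gap, and it is also
    what turns the cutoff in time near s into the slice at s. *)

Section cover.
Context {R : realType} {T : pseudoMetricType R} {I : countType}.
Variables (c : I -> T) (M : set (set T)).
Hypothesis c_dense : forall x e, 0 < e -> exists i, ball x e (c i).
Hypothesis M_ball : forall i e, M (ball (c i) e).
Hypothesis M0 : M set0.
Hypothesis M_bigcup : forall F : I * rat -> set T, (forall k, M (F k)) -> M (\bigcup_k F k).

(** An open set is a countable union of balls with dense centres and rational radii. The class [M]
    stands for the measurable sets; keeping it abstract serves space and space-time alike. *)
Lemma open_countable_balls (A : set T) : open A -> M A.
Proof.
move=> oA.
pose F (k : I * rat) := if `[< ball (c k.1) (ratr k.2) `<=` A >] then ball (c k.1) (ratr k.2) else set0.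
rewrite (_ : A = \bigcup_k F k); last first.
  apply/seteqP; split => [x Ax|x [[i q] _]]; last first.
    by rewrite /F; case: ifPn => // /asboolP/= + h; apply.
  have /nbhs_ballP[e /= e0 xeA] : nbhs x A by exact: open_nbhs_nbhs.
  (* A radius below e / 2 keeps the ball around [c i] inside [ball x e]; the bound e / 4 keeps it
     positive. *)
  have [q] : exists q : rat, ratr q \in `](e / 4)%R, (e / 2)%R[.
    by apply: rat_in_itvoo; rewrite ltr_pM2l// ltf_pV2 ?posrE// ltr_nat.
  rewrite in_itv/= => /andP[q1 q2].
  have q0 : 0 < ratr q :> R by apply: lt_trans q1; rewrite divr_gt0.
  have [i xi] := c_dense x q0.
  exists (i, q) => //=; rewrite /F/= asboolT; first exact: ball_sym.
  move=> y ciy; apply: xeA; rewrite [e]splitr; apply: ball_triangle; last first.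
    by apply: le_ball ciy; exact: ltW.
  by apply: le_ball xi; exact: ltW.
by apply: M_bigcup => k; rewrite /F; case: ifPn.
Qed.
End cover.

Section open_measurable.
Context {R : realType} {N : nat}.
Local Notation space := 'rV[R]_N.
Local Notation spacetime := ('rV[R]_N * R)%type.

Let rat_point (q : 'rV[rat]_N) : space := map_mx ratr q.

Let rat_point_dense (x : space) (e : R) : 0 < e -> exists i, ball x e (rat_point i).
Proof.
move=> e0.
have /choice[q hq] : forall j : 'I_N, exists q : rat, ball (x ord0 j) e (ratr q).
  move=> j; have [q] : exists q : rat, ratr q \in `](x ord0 j - e)%R, (x ord0 j + e)%R[.
    by apply: rat_in_itvoo; rewrite ltrBlDr -addrA ltrDl addr_gt0.
  rewrite in_itv/= => /andP[q1 q2]; exists q.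
  by rewrite /ball/= ltr_distlC q1 q2.
by exists (\row_j q j); split=> // i j; rewrite ord1 !mxE; exact: hq.
Qed.

(** For the sup norm a ball is a box, hence a finite intersection of preimages under coordinates. *)
Lemma measurable_ball_rV (x : space) (e : R) : measurable (ball x e).
Proof.
have [e0|e0] := ltP 0 e; last first.
  rewrite (_ : ball x e = set0)//; apply/seteqP; split => // y [] /lt_le_trans/(_ e0).
  by rewrite ltxx.
rewrite (_ : ball x e = \bigcap_(i in [set: 'I_N]) (rV_coord i @^-1` ball (x ord0 i) e)).
  apply: fin_bigcap_measurable => // i _; rewrite -[X in measurable X]setTI.
  by apply: measurable_rV_coord => //; exact: measurable_ball.
apply/seteqP; split => y /= h; first by case: h => _ h i _; exact: h.
by split => // i j; rewrite ord1; exact: h.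
Qed.

Lemma open_measurable_rV (A : set space) : open A -> measurable A.
Proof.
move=> oA; apply: (@open_countable_balls R space 'rV[rat]_N rat_point measurable rat_point_dense) => //.
- by move=> i e; exact: measurable_ball_rV.
- by move=> F mF; exact: countable_bigcupT_measurable.
Qed.

Lemma open_measurable_xt (A : set spacetime) : open A -> measurable A.
Proof.
have d (z : spacetime) (e : R) : 0 < e -> exists i : 'rV[rat]_N * rat, ball z e (rat_point i.1, ratr i.2 : R).
  move=> e0; have [i zi] := rat_point_dense z.1 e0.
  have [q] : exists q : rat, ratr q \in `](z.2 - e)%R, (z.2 + e)%R[.
    by apply: rat_in_itvoo; rewrite ltrBlDr -addrA ltrDl addr_gt0.
  rewrite in_itv/= => /andP[q1 q2]; exists (i, q); split => //=.
  by rewrite /ball/= ltr_distlC q1 q2.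
move=> oA; apply: (@open_countable_balls R spacetime ('rV[rat]_N * rat)%type _ measurable d) => //.
- move=> i e; rewrite (_ : ball _ _ = ball (rat_point i.1) e `*` ball (ratr i.2 : R) e)//.
  by apply: measurableX; [exact: measurable_ball_rV|exact: measurable_ball].
- by move=> F mF; exact: countable_bigcupT_measurable.
Qed.

Lemma compact_measurable_rV (A : set space) : compact A -> measurable A.
Proof.
move=> /compact_closed cA; rewrite -[A]setCK; apply: measurableC.
by apply: open_measurable_rV; rewrite openC; apply: cA; exact: norm_hausdorff.
Qed.

Lemma compact_measurable_xt (A : set spacetime) : compact A -> measurable A.
Proof.
move=> /compact_closed cA; rewrite -[A]setCK; apply: measurableC.
by apply: open_measurable_xt; rewrite openC; apply: cA; exact: norm_hausdorff.
Qed.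

(** Open intervals generate the Borel sets of R, and their preimages are traces on D of open
    sets. *)
Lemma continuous_measurable_rV (D : set space) (f : space -> R) :
  measurable D -> {within D, continuous f} -> measurable_fun D f.
Proof.
move=> mD /continuousP cf; apply: (measurability _ (RGenOpens.measurableE R)).
move=> _ [_ [a [b ->] <-]].
have : open (f @^-1` `]a, b[ : set (subspace D)) by exact/cf/interval_open.
move=> /open_subspaceP[W oW WE].
by rewrite setIC -WE; apply: measurableI => //; exact: open_measurable_rV.
Qed.

Lemma continuous_measurable_xt (D : set spacetime) (f : spacetime -> R) :
  measurable D -> {within D, continuous f} -> measurable_fun D f.
Proof.
move=> mD /continuousP cf; apply: (measurability _ (RGenOpens.measurableE R)).
move=> _ [_ [a [b ->] <-]].
have : open (f @^-1` `]a, b[ : set (subspace D)) by exact/cf/interval_open.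
move=> /open_subspaceP[W oW WE].
by rewrite setIC -WE; apply: measurableI => //; exact: open_measurable_xt.
Qed.

Lemma bounded_rV_finite (K : set space) : measurable K -> bounded_set K -> (lebesgue_x K < +oo)%E.
Proof.
move=> mK [M [Mr hM]].
have hK : K `<=` [set x | forall i, `[- (M + 1), M + 1]%classic (x ord0 i)].
  move=> x /(hM (M + 1)) => /(_ _)/=; rewrite ltrDl ltr01 => /(_ isT).
  move=> h i; rewrite in_itv/= -ler_norml; apply: le_trans h.
  by rewrite [leRHS]/Num.norm/= mx_normrE; apply: (le_bigmax _ (fun i => `|x i.1 i.2|) (ord0, i)).
have mB : measurable [set x : space | forall i, `[- (M + 1), M + 1]%classic (x ord0 i)].
  rewrite (_ : mkset _ = \bigcap_(i in [set: 'I_N]) (rV_coord i @^-1` `[- (M + 1), M + 1]%classic)).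
    apply: fin_bigcap_measurable => // i _; rewrite -[X in measurable X]setTI.
    by apply: measurable_rV_coord => //; exact: measurable_itv.
  by apply/seteqP; split => y /= h => [i _|i]; exact: h.
pose I : set R := `[- (M + 1), M + 1]%classic.
have E : lebesgue_x [set x : space | forall i, I (x ord0 i)] = (\prod_(i < N) lebesgue_measure I)%E.
  by apply: (@lebesgue_rV_box R N (fun=> I)) => i; exact: measurable_itv.
apply: (@le_lt_trans _ _ (\prod_(i < N) lebesgue_measure I)%E).
  by rewrite -E; apply: le_measure; rewrite ?inE.
(* Finiteness is carried through the product together with nonnegativity, which the product of two
   finite factors requires. *)
apply: (@proj2 (0 <= \prod_(i < N) lebesgue_measure I)%E).
apply: (@big_ind _ (fun x : \bar R => 0 <= x /\ x < +oo)%E) => //=.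
- by split; [rewrite lee_fin|rewrite ltry].
- move=> x y [x0 xoo] [y0 yoo]; split; first exact: mule_ge0.
  by apply: lte_mul_pinfty => //; rewrite ge0_fin_numE.
- by move=> i _; split => //; rewrite /I lebesgue_measure_itv/=; case: ifP => // _; rewrite -EFinB ltry.
Qed.

Lemma compact_rV_finite (K : set space) : compact K -> (lebesgue_x K < +oo)%E.
Proof.
move=> cK; apply: bounded_rV_finite; first exact: compact_measurable_rV.
exact: compact_bounded.
Qed.

Lemma lebesgue_xtX (A : set space) (B : set R) : measurable A -> measurable B ->
  lebesgue_xt (A `*` B) = (lebesgue_x A * lebesgue_measure B)%E.
Proof. by move=> mA mB; exact: product_measure1E. Qed.

Lemma compact_xt_finite (K : set spacetime) : compact K -> (lebesgue_xt K < +oo)%E.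
Proof.
move=> cK.
have c1 : compact (fst @` K) by apply: continuous_compact => //; apply: continuous_subspaceT => x; exact: cvg_fst.
have c2 : compact (snd @` K) by apply: continuous_compact => //; apply: continuous_subspaceT => x; exact: cvg_snd.
have m1 := compact_measurable_rV c1.
have m2 : measurable (snd @` K) by exact: compact_measurable.
apply: (@le_lt_trans _ _ (lebesgue_xt (fst @` K `*` snd @` K))).
  apply: le_measure; rewrite ?inE; first exact: compact_measurable_xt.
    exact: measurableX.
  by move=> z Kz; split; exists z.
rewrite lebesgue_xtX//; apply: lte_mul_pinfty => //.
  by rewrite ge0_fin_numE//; exact: compact_rV_finite.
exact: compact_finite_measure.
Qed.
(** In [lebesgue_xt] the time axis carries the measurable structure [measurableTypeR R]; this form
    spells out that type. *)
Lemma compact_measurable_mu (K : set spacetime) : compact K ->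
  measurable (K : set (space * measurableTypeR R)%type).
Proof. exact: compact_measurable_xt. Qed.

Lemma open_measurable_mu (K : set spacetime) : open K ->
  measurable (K : set (space * measurableTypeR R)%type).
Proof. exact: open_measurable_xt. Qed.
End open_measurable.

(** * Calculus of C^k functions, bump functions *)

Section Ck_calculus.
Context {R : realType} {V : normedModType R}.
Implicit Types f g : V -> R.

Lemma Ck_continuous k f : Ck setT k f -> continuous f.
Proof. by move=> kf; apply/continuous_subspace_setT; case: k kf => [|k] []. Qed.

(** On the whole space the interior clause of [Ck] is automatic, and [is_derive] merges derivability
    with the formula for the derivative. [CkS_elim] is the converse. *)
Lemma CkS_intro k f : continuous f ->
  (forall v, exists2 g, (forall x, is_derive x v f (g x)) & Ck setT k g) -> Ck setT k.+1 f.
Proof.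
move=> cf df; split; first exact: continuous_subspaceT.
move=> v; have [g fg kg] := df v; split=> [x _|]; first by case: (fg x).
by exists g => // x _; case: (fg x).
Qed.

Lemma CkS_elim k f : Ck setT k.+1 f ->
  forall v, exists2 g, (forall x, is_derive x v f (g x)) & Ck setT k g.
Proof.
move=> [_ df] v; have [dfv [g gE kg]] := df v; exists g => // x.
by apply: DeriveDef; [apply: dfv|rewrite -gE//]; rewrite interiorT.
Qed.

Lemma CkW k f : Ck setT k.+1 f -> Ck setT k f.
Proof.
elim: k f => [|k IH] f kf.
  by split => //; apply: continuous_subspaceT; exact: Ck_continuous kf.
apply: CkS_intro; first exact: Ck_continuous kf.
by move=> v; have [g fg /IH kg] := CkS_elim kf v; exists g.
Qed.

Lemma Ck_cst k (c : R) : Ck setT k (cst c : V -> R).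
Proof.
elim: k c => [|k IH] c.
  by split=> //; apply: continuous_subspaceT; exact: cst_continuous.
apply: CkS_intro; first exact: cst_continuous.
by move=> v; exists (cst 0) => // x; exact: is_derive_cst.
Qed.

Lemma CkD k f g : Ck setT k f -> Ck setT k g -> Ck setT k (fun x => f x + g x).
Proof.
elim: k f g => [|k IH] f g kf kg.
  split => //; apply: continuous_subspaceT => x.
  by apply: cvgD; [apply: (Ck_continuous kf)|apply: (Ck_continuous kg)].
apply: CkS_intro.
  by move=> x; apply: cvgD; [apply: (Ck_continuous kf)|apply: (Ck_continuous kg)].
move=> v; have [f' ff' kf'] := CkS_elim kf v; have [g' gg' kg'] := CkS_elim kg v.
by exists (fun x => f' x + g' x); [move=> x; exact: is_deriveD|exact: IH].
Qed.

Lemma CkM k f g : Ck setT k f -> Ck setT k g -> Ck setT k (fun x => f x * g x).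
Proof.
elim: k f g => [|k IH] f g kf kg.
  split => //; apply: continuous_subspaceT => x.
  by apply: cvgM; [apply: (Ck_continuous kf)|apply: (Ck_continuous kg)].
apply: CkS_intro.
  by move=> x; apply: cvgM; [apply: (Ck_continuous kf)|apply: (Ck_continuous kg)].
move=> v; have [f' ff' kf'] := CkS_elim kf v; have [g' gg' kg'] := CkS_elim kg v.
exists (fun x => f x * g' x + g x * f' x); first by move=> x; exact: is_deriveM.
by apply: CkD; apply: IH => //; exact: CkW.
Qed.

Lemma CkZ k (c : R) f : Ck setT k f -> Ck setT k (fun x => c * f x).
Proof. by move=> kf; apply: CkM => //; exact: Ck_cst. Qed.

Lemma Ck_prod k (I : finType) (F : I -> V -> R) :
  (forall i, Ck setT k (F i)) -> Ck setT k (fun x => \prod_i F i x).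
Proof.
move=> kF; rewrite unlock; elim: (index_enum I) => [|i s IH] /=; first exact: Ck_cst.
exact: CkM.
Qed.

Lemma is_derive_local (W : normedModType R) (f g : V -> W) (x v : V) (d : W) :
  (\near x, f x = g x) -> is_derive x v f d -> is_derive x v g d.
Proof.
move=> fg [df <-]; apply: DeriveDef; first exact: near_eq_derivable df.
by apply/esym/near_eq_derive.
Qed.

End Ck_calculus.

Section Ck_comp.
Context {R : realType} {V W : normedModType R}.

(** An affine change of variables turns the difference quotient along v into exactly the difference
    quotient of f along c v, so a directional derivative of f is all that enters. *)
Lemma is_derive_affine (l : V -> W) (c : V -> W) (f : W -> R) (x v : V) (d : R) :
  (forall h : R, l (h *: v + x) = h *: c v + l x) ->
  is_derive (l x) (c v) f d -> is_derive x v (f \o l) d.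
Proof.
move=> lE [df fd].
have E : (fun h : R => h^-1 *: ((f \o l \o shift x) (h *: v) - (f \o l) x)) =
   (fun h : R => h^-1 *: ((f \o shift (l x)) (h *: c v) - f (l x))).
  by apply/funext => h /=; rewrite lE.
by apply: DeriveDef; [rewrite /derivable E|rewrite /derive E].
Qed.

Lemma Ck_affine k (l : V -> W) (c : V -> W) (f : W -> R) :
  continuous l ->
  (forall (v x : V) (h : R), l (h *: v + x) = h *: c v + l x) ->
  Ck setT k f -> Ck setT k (f \o l).
Proof.
move=> cl lE; elim: k f => [|k IH] f kf.
  split => //; apply: continuous_subspaceT => x.
  by apply: continuous_comp; [exact: cl|exact: (Ck_continuous kf)].
apply: CkS_intro.
  by move=> x; apply: continuous_comp; [exact: cl|exact: (Ck_continuous kf)].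
move=> v; have [g fg kg] := CkS_elim kf (c v).
exists (g \o l); last exact: IH.
by move=> x; apply: is_derive_affine.
Qed.
End Ck_comp.

(** * Smooth bump functions on the line *)

Section bump_function.
Context {R : realType}.
Implicit Types s t : R.

(** On R a derivative gives differentiability, hence linearity in the direction. This reaches the
    arbitrary directions over which [Ck] quantifies. *)
Lemma is_derive_dir (f : R -> R) (x v d : R) : is_derive x 1 f d -> is_derive x v f (v * d).
Proof.
move=> [fx <-]; have dfx : differentiable f x by exact/derivable1_diffP.
apply: DeriveDef; first exact: diff_derivable.
by rewrite !deriveE// -[v in LHS]mulr1 -[v * 1]/(v *: (1 : R)) linearZ.
Qed.

(** The functions s^(-n) exp(- 1 / s), extended by 0. The index n is carried because differentiation
    maps this family into its own linear combinations, so smoothness follows by induction for all n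
    at once. *)
Definition flat n s : R := if 0 < s then s^-1 ^+ n * expR (- s^-1) else 0.

Lemma flat_ge0 n s : 0 <= flat n s.
Proof.
by rewrite /flat; case: ifPn => // s0; rewrite mulr_ge0 ?expR_ge0// exprn_ge0// invr_ge0 ltW.
Qed.

Lemma flat0 n : flat n 0 = 0. Proof. by rewrite /flat ltxx. Qed.

(** From e^x >= x^(n+2) / (n+2)! at x = 1 / s. A quadratic bound is what makes the difference
    quotients at 0 vanish. *)
Lemma flat_le n s : flat n s <= (n.+2)`!%:R * s ^+ 2.
Proof.
rewrite /flat; case: ifPn => [s0|_]; last by rewrite mulr_ge0// sqr_ge0.
have si0 : 0 < s^-1 by rewrite invr_gt0.
have := @expR_ge1Dxn R _ n.+1 (ltW si0).
set e := expR _; set F := _`!%:R => H.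
have F0 : 0 < F :> R by rewrite ltr0n fact_gt0.
have e0 : 0 < e by exact: expR_gt0.
rewrite expRN -/e.
have : s^-1 ^+ n.+2 <= F * e.
  by rewrite mulrC -ler_pdivrMr//; apply: le_trans H; rewrite lerDr.
rewrite -(ler_pM2r (_ : 0 < s ^+ 2 * e^-1)); last by rewrite mulr_gt0 ?exprn_gt0// invr_gt0.
rewrite exprSr exprSr.
have -> : s^-1 ^+ n * s^-1 * s^-1 * (s ^+ 2 * e^-1) = s^-1 ^+ n * e^-1 by field; rewrite !gt_eqF.
by have -> : F * e * (s ^+ 2 * e^-1) = F * s ^+ 2 by field; rewrite gt_eqF.
Qed.

Lemma is_derive_flat n s : is_derive s 1 (flat n) (flat n.+2 s - n%:R * flat n.+1 s).
Proof.
have [s0|s0|->] := ltgtP s 0.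
- rewrite /flat ltNge ltW//= mulr0 subr0; apply: (is_derive_local (f := cst 0)).
    near=> t; rewrite /flat ifF//; apply/negbTE; rewrite -leNgt.
    by apply: ltW; near: t; exact: lt_nbhsl.
- apply: (is_derive_local (f := fun t => t^-1 ^+ n * expR (- t^-1))).
    near=> t; rewrite /flat ifT//.
    by near: t; exact: lt_nbhsr.
  rewrite /flat s0.
  have s_neq0 : s != 0 by rewrite gt_eqF.
  have dV : is_derive s 1 (fun t : R => t^-1) (- s ^- 2 *: 1).
    exact: (@is_deriveV R id s 1 1).
  have dE : is_derive s 1 (fun t : R => expR (- t^-1)) (expR (- s^-1) * - (- s ^- 2 *: 1)).
    exact: (@is_derive1_comp R expR (fun t => - t^-1)).
  have dX : is_derive s 1 (fun t : R => t^-1 ^+ n) ((n%:R * s^-1 ^+ n.-1) *: (- s ^- 2 *: 1)).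
    have -> : (fun t : R => t^-1 ^+ n) = (fun t : R => t^-1) ^+ n.
      by apply/funext => t; elim: n => [|m IH]; rewrite ?expr0// !exprS IH.
    exact: (@is_deriveX R R (fun t : R => t^-1) n s 1 _ dV).
  apply: (is_derive_eq (is_deriveM dX dE)).
  rewrite /GRing.scale/= !mulr1; case: n {dX} => [|n]/=; first by field.
  by rewrite !exprS !exprVn; field; rewrite s_neq0 expf_neq0.
(* At the junction point 0, [flat_le] bounds the quotient by a constant times |h|. *)
- rewrite !flat0 mulr0 subr0.
  have L : (fun h : R => h^-1 *: ((flat n \o shift 0) (h *: 1) - flat n 0)) @ 0^' --> (0 : R).
    apply/cvgr0Pnorm_le => e e0; near=> h => /=.
    have h0 : h != 0 by near: h; exact: nbhs_dnbhs_neq.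
    rewrite flat0 subr0 addr0 [_ *: 1]mulr1 normrM normfV ger0_norm ?flat_ge0//.
    rewrite mulrC ler_pdivrMr ?normr_gt0//; apply: le_trans (flat_le _ _) _.
    rewrite -(real_normK (num_real h)) expr2 mulrA ler_wpM2r//.
    rewrite -ler_pdivlMl ?ltr0n ?fact_gt0//.
    near: h; apply: dnbhs0_le; rewrite mulr_gt0// invr_gt0 ltr0n fact_gt0//.
  apply: DeriveDef; first by apply/cvg_ex; exists 0.
  exact/cvg_lim.
Unshelve. all: by end_near. Qed.

Lemma Ck_flat k n : Ck setT k (flat n).
Proof.
have cf m : continuous (flat m).
  by move=> x; apply/differentiable_continuous/derivable1_diffP; case: (is_derive_flat m x).
elim: k n => [|k IH] n; first by split => //; exact: continuous_subspaceT.
apply: CkS_intro => // v.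
exists (fun s => v * (flat n.+2 s + (- n%:R) * flat n.+1 s)).
  by move=> s; apply: is_derive_dir; rewrite mulNr; exact: is_derive_flat.
by apply/CkZ/CkD => //; exact: CkZ.
Qed.

(** Equals exp(- 2 / (1 - s^2)) on ]-1, 1[ and 0 elsewhere. *)
Definition bump1 s : R := flat 0 (1 + s) * flat 0 (1 - s).

Lemma Ck_bump1 k : Ck setT k bump1.
Proof.
apply: CkM.
  apply: (@Ck_affine R R R k (fun s => 1 + s) id (flat 0)); last exact: Ck_flat.
    by move=> x; apply: cvgD; [exact: cvg_cst|exact: cvg_id].
  by move=> v x h; rewrite addrCA.
apply: (@Ck_affine R R R k (fun s => 1 - s) -%R (flat 0)); last exact: Ck_flat.
  by move=> x; apply: cvgB; [exact: cvg_cst|exact: cvg_id].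
by move=> v x h; rewrite opprD addrCA scalerN.
Qed.

Lemma bump1_ge0 s : 0 <= bump1 s. Proof. by rewrite mulr_ge0// flat_ge0. Qed.

Lemma bump1_eq0 s : 1 <= `|s| -> bump1 s = 0.
Proof.
rewrite ler_normr => /orP[s1|s1]; rewrite /bump1 /flat.
  by rewrite [0 < 1 - s]ltNge subr_le0 s1 mulr0.
by rewrite [0 < 1 + s]ltNge -lerBrDl sub0r lerNr s1 mul0r.
Qed.

Definition bump1' s := flat 2 (1 + s) * flat 0 (1 - s) - flat 0 (1 + s) * flat 2 (1 - s).
Definition bump1'' s := (flat 4 (1 + s) - 2 * flat 3 (1 + s)) * flat 0 (1 - s)
  - 2 * (flat 2 (1 + s) * flat 2 (1 - s))
  + flat 0 (1 + s) * (flat 4 (1 - s) - 2 * flat 3 (1 - s)).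

Lemma is_derive_flatD n s : is_derive s 1 (fun t => flat n (1 + t)) (flat n.+2 (1 + s) - n%:R * flat n.+1 (1 + s)).
Proof.
apply: (@is_derive_affine R R R (fun s => 1 + s) id (flat n)); last exact: is_derive_flat.
by move=> h; rewrite addrCA.
Qed.

Lemma is_derive_flatB n s : is_derive s 1 (fun t => flat n (1 - t)) (- (flat n.+2 (1 - s) - n%:R * flat n.+1 (1 - s))).
Proof.
apply: (@is_derive_affine R R R (fun s => 1 - s) -%R (flat n)).
  by move=> h; rewrite opprD addrCA scalerN.
by have := is_derive_dir (-1) (is_derive_flat n (1 - s)); rewrite mulN1r.
Qed.

Lemma is_derive_bump1 s : is_derive s 1 bump1 (bump1' s).
Proof.
apply: is_derive_eq (is_deriveM (is_derive_flatD 0 s) (is_derive_flatB 0 s)) _.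
by rewrite /GRing.scale/= /bump1'; ring.
Qed.

Lemma is_derive_bump1' s : is_derive s 1 bump1' (bump1'' s).
Proof.
apply: is_derive_eq (is_deriveB (is_deriveM (is_derive_flatD 2 s) (is_derive_flatB 0 s))
  (is_deriveM (is_derive_flatD 0 s) (is_derive_flatB 2 s))) _.
by rewrite /GRing.scale/= /bump1''; ring.
Qed.

(* This is what makes a product of bumps times e^{Ct} a subsolution of the
   backward heat equation in [box_subsolution]. *)
Lemma bump1''_ge s : - 64 * bump1 s <= bump1'' s.
Proof.
have [|s1] := leP 1 `|s|.
  rewrite ler_normr => /orP[s1|s1]; rewrite /bump1'' /bump1 /flat.
    by rewrite [0 < 1 - s]ltNge subr_le0 s1 !(mulr0, subr0, addr0).
  by rewrite [0 < 1 + s]ltNge -lerBrDl sub0r lerNr s1 !(mulr0, mul0r, subr0, addr0).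
move: s1; rewrite ltr_norml => /andP[s1 s2].
have a0 : 0 < 1 + s by rewrite -ltrBlDl sub0r.
have b0 : 0 < 1 - s by rewrite subr_gt0.
rewrite /bump1'' /bump1 /flat a0 b0 !expr0 !mul1r.
set E := expR _; set E' := expR _.
have EE : 0 < E * E' by rewrite mulr_gt0 ?expR_gt0.
rewrite -subr_ge0.
have pE : 0 < (1 + s) * (1 - s) by rewrite mulr_gt0.
set X := (X in 0 <= X).
(* With p = (1 + s) (1 - s), and as the two factors add up to 2, the quotient bump1'' / bump1 is (16
   - 32 p + 12 p^2) / p^4; the term 64 p^4 comes from the constant to be justified. *)
have -> : X = E * E' * ((16 - 32 * ((1 + s) * (1 - s)) + 12 * ((1 + s) * (1 - s)) ^+ 2 + 64 * ((1 + s) * (1 - s)) ^+ 4) / ((1 + s) * (1 - s)) ^+ 4).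
  by rewrite /X; field; rewrite !gt_eqF.
apply: mulr_ge0; first exact: ltW.
apply: divr_ge0; last by rewrite exprn_ge0// ltW.
have : (1 + s) * (1 - s) <= 1 by rewrite -subr_ge0; have := sqr_ge0 s; lra.
move: pE; set p := _ * _ => p0 p1.
(* Origin of 64: for p <= 1/2 the term 16 - 32 p is already nonnegative, and for 1/2 <= p <= 1 the
   quadratic is at least - 4, its value at p = 1, while 64 p^4 >= 64 / 16 = 4. *)
have [|] := leP p (2^-1) => hp; first by nra.
have : 2^-1 ^+ 4 <= p ^+ 4 by rewrite lerXn2r// ?nnegrE ltW//.
nra.
Qed.
End bump_function.

(** * Compactly supported functions: uniform continuity and difference quotients *)

Section compact_support.
Context {R : realType} {V : normedModType R}.

Lemma supp_closed (K : set V) : compact K -> closed K.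
Proof. by move=> cK; apply: compact_closed => //; exact: norm_hausdorff. Qed.

Lemma nbhs0_ballP (P : set V) : nbhs (0 : V) P -> exists2 d : R, 0 < d & forall w, `|w| < d -> P w.
Proof.
move=> /nbhs_ballP[d /= d0 h]; exists d => // w wd; apply: h.
by rewrite -ball_normE /ball_/= sub0r normrN.
Qed.

Lemma supp_unif_continuous (f : V -> R) (K : set V) (e : R) : 0 < e ->
  continuous f -> compact K -> (forall z, ~ K z -> f z = 0) ->
  exists2 d, 0 < d & forall z w, `|w| < d -> `|f (w + z) - f z| < e.
Proof.
move=> e0 cf cK f0.
have /nbhs0_ballP[d d0 hd] : nbhs (0 : V) (fun w => K `<=` [set z | `|f (w + z) - f z| < e]).
  pose P (w z : V) := `|f (w + z) - f z| < e.
  apply: (proj1 (compact_near_coveringP K) cK V (nbhs (0 : V)) P) => x Kx.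
  have c : (fun p : V * V => `|f (p.2 + p.1) - f p.1|) @ (x, 0) --> `|f (0 + x) - f x|.
    apply: cvg_norm; apply: cvgB; last first.
      by apply: (@cvg_comp _ _ _ fst f (nbhs (x, 0 : V)) (nbhs x)); [exact: cvg_fst|exact: cf].
    apply: (@cvg_comp _ _ _ (fun p : V * V => p.2 + p.1) f (nbhs (x, 0 : V)) (nbhs (0 + x))); last exact: cf.
    by apply: cvgD; [exact: cvg_snd|exact: cvg_fst].
  have : nbhs (x, 0 : V) (fun p : V * V => `|f (p.2 + p.1) - f p.1| < e).
    by apply: (c (fun y => y < e)); apply: lt_nbhsl; rewrite add0r subrr normr0.
  by apply: filterS => -[a b].
exists d => // z w wd; have [Kz|nKz] := pselect (K z); first exact: hd.
have [Kwz|nKwz] := pselect (K (w + z)); last by rewrite !f0// subrr normr0.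
(* Here z lies outside K and w + z inside it: the uniform estimate is applied at w + z with
   increment - w. *)
have := hd (- w); rewrite normrN => /(_ wd _ Kwz) /=.
by rewrite addKr distrC.
Qed.

Lemma supp_bounded (f : V -> R) (K : set V) :
  continuous f -> compact K -> (forall z, ~ K z -> f z = 0) ->
  exists2 M, 0 < M & forall z, `|f z| <= M.
Proof.
move=> cf cK f0.
have /compact_bounded[M [Mr hM]] : compact (f @` K).
  by apply: continuous_compact => //; exact: continuous_subspaceT.
exists (`|M| + 1); first by rewrite ltr_wpDl.
move=> z; have [Kz|nKz] := pselect (K z); last by rewrite f0// normr0 addr_ge0.
apply: hM; last by exists z.
by rewrite (le_lt_trans (ler_norm _))// ltrDl.
Qed.

Lemma within_bounded (f : V -> R) (K : set V) : {within K, continuous f} -> compact K ->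
  exists2 M, 0 < M & forall z, K z -> `|f z| <= M.
Proof.
move=> cf cK.
have /compact_bounded[M [Mr hM]] : compact (f @` K) by exact: continuous_compact.
exists (`|M| + 1); first by rewrite ltr_wpDl.
move=> z Kz; apply: hM; last by exists z.
by rewrite (le_lt_trans (ler_norm _))// ltrDl.
Qed.

Lemma derive_off (f : V -> R) (K : set V) x v d : closed K -> (forall z, ~ K z -> f z = 0) ->
  ~ K x -> is_derive x v f d -> d = 0.
Proof.
move=> cK f0 nKx [_ <-]; rewrite -(@derive_cst R V R 0 v x); apply: near_eq_derive.
have : nbhs x (~` K) by apply: open_nbhs_nbhs; split => //; rewrite openC.
by apply: filterS => z /f0.
Qed.

(** The mean value theorem for the real function s |-> f (s v + y). *)
Lemma diffquot_pos (f f' : V -> R) v (y : V) (h : R) : (forall x, is_derive x v f (f' x)) ->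
  0 <= h -> exists2 c, 0 <= c <= h & f (h *: v + y) - f y = h * f' (c *: v + y).
Proof.
move=> ff' h0.
have D (s : R) : is_derive s 1 (fun s => f (s *: v + y)) (f' (s *: v + y)).
  apply: (@is_derive_affine R R V (fun s => s *: v + y) (fun c => c *: v)).
    by move=> k; rewrite scalerDl -scalerA addrA.
  by rewrite scale1r.
have [|c] := @MVT_segment R (fun s => f (s *: v + y)) (fun s => f' (s *: v + y)) 0 h h0 (fun s _ => D s).
  apply: continuous_subspaceT => s.
  by apply/differentiable_continuous/derivable1_diffP; case: (D s).
by rewrite in_itv/= scale0r add0r subr0 => hc ->; exists c => //; rewrite mulrC.
Qed.

Lemma diffquot (f f' : V -> R) v (y : V) (h : R) : (forall x, is_derive x v f (f' x)) ->
  exists2 c, `|c| <= `|h| & f (h *: v + y) - f y = h * f' (c *: v + y).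
Proof.
move=> ff'; have [h0|h0] := leP 0 h.
  have [c /andP[c0 ch] ->] := diffquot_pos y ff' h0; exists c => //.
  by rewrite !ger0_norm.
have h0' : 0 <= - h by rewrite oppr_ge0 ltW.
(* For h < 0 the segment is run backwards, from h v + y with step - h. *)
have [c /andP[c0 ch]] := diffquot_pos (h *: v + y) ff' h0'.
rewrite addrA -scalerDl addNr scale0r add0r addrA -scalerDl => H.
exists (c + h); last by apply: oppr_inj; rewrite opprB H mulNr.
rewrite [`|h|]ltr0_norm// ler_norml opprK lerDr c0/=.
by rewrite (@le_trans _ _ 0)// -lerBrDr sub0r.
Qed.

(** The quotient is a value of f' at distance at most |h| |v| from y, and f' is uniformly continuous
    since it vanishes off K. Uniformity in y is what allows differentiation under the integral in
    [convol_is_derive]. *)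
Lemma diffquot_unif (f f' : V -> R) v (K : set V) (e : R) : 0 < e ->
  (forall x, is_derive x v f (f' x)) ->
  continuous f' -> compact K -> (forall z, ~ K z -> f z = 0) ->
  exists2 d, 0 < d & forall h, h != 0 -> `|h| < d -> forall y,
    `|h^-1 * (f (h *: v + y) - f y) - f' y| < e.
Proof.
move=> e0 ff' cf' cK f0.
have f'0 z : ~ K z -> f' z = 0.
  by move=> nKz; apply: (derive_off (supp_closed cK) f0 nKz (ff' z)).
have [d d0 hd] := supp_unif_continuous e0 cf' cK f'0.
(* This makes |c v| <= |h| |v| < d; the added 1 covers v = 0. *)
exists (d / (`|v| + 1)); first by rewrite divr_gt0// ltr_wpDl.
move=> h h_neq0 hlt y; have [c ch ->] := diffquot y h ff'.
rewrite mulKf//; apply: hd; rewrite normrZ.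
apply: le_lt_trans (_ : `|h| * (`|v| + 1) < d).
  by apply: ler_pM => //; rewrite lerDl.
by rewrite -ltr_pdivlMr// ltr_wpDl.
Qed.
(** Compactness of closed balls is a hypothesis because V is a general normed space here; it is
    supplied for space and for space-time separately. *)
Lemma compact_thicken (K W : set V) : (forall d : R, compact [set w : V | `|w| <= d]) -> compact K -> open W -> K `<=` W ->
  exists2 d : R, 0 < d & exists K', [/\ compact K', K' `<=` W &
    forall z w, K z -> `|w| <= d -> K' (w + z)].
Proof.
move=> cB cK oW KW.
have /nbhs0_ballP[d d0 hd] : nbhs (0 : V) (fun w => K `<=` [set z | W (w + z)]).
  pose P (w z : V) := W (w + z).
  apply: (proj1 (compact_near_coveringP K) cK V (nbhs (0 : V)) P) => x Kx.
  have c : (fun p : V * V => p.2 + p.1) @ (x, 0) --> (0 + x).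
    by apply: cvgD; [exact: cvg_snd|exact: cvg_fst].
  have : nbhs (x, 0 : V) (fun p : V * V => W (p.2 + p.1)).
    by apply: (c W); apply: open_nbhs_nbhs; split => //; rewrite add0r; exact: KW.
  by apply: filterS => -[a b].
exists (d / 2); first by rewrite divr_gt0.
(* K' is the sum of K and the closed ball of radius d / 2, a continuous image of a compact
   product. *)
exists ((fun p : V * V => p.1 + p.2) @` ([set w | `|w| <= d / 2] `*` K)); split.
- apply: continuous_compact.
    by apply: continuous_subspaceT => p; apply: cvgD; [exact: cvg_fst|exact: cvg_snd].
  by apply: compact_setX => //; exact: cB.
- move=> _ [[w z] /= [wd Kz] <-]; apply: (hd w) => //.
  by apply: le_lt_trans wd _; rewrite ltr_pdivrMr// ltr_pMr// ltr1n.
- by move=> z w Kz wd; exists (w, z).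
Qed.
End compact_support.

Section spacetime_topology.
Context {R : realType} {N : nat}.
Local Notation space := 'rV[R]_N.
Local Notation spacetime := ('rV[R]_N * R)%type.

Lemma closed_ball_compact_xt (d : R) : compact [set w : spacetime | `|w| <= d].
Proof.
rewrite (_ : mkset _ = [set x : space | `|x| <= d] `*` `[- d, d]%classic); last first.
  apply/seteqP; split => -[x t] /=; rewrite prod_normE/= in_itv/= -ler_norml ge_max.
    by move=> /andP[].
  by move=> [-> ->].
apply: compact_setX; last exact: segment_compact.
apply: bounded_closed_compact.
  by exists d; split => //; [exact: num_real|move=> x dx y /= yd; exact: le_trans yd (ltW dx)].
apply: (@preimage_closed _ _ (fun x : space => `|x|) [set x : R | x <= d]); last exact: closed_le.
by move=> x _; exact: norm_continuous.
Qed.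

Lemma compact_thicken_xt (K W : set spacetime) : compact K -> open W -> K `<=` W ->
  exists2 d : R, 0 < d & exists K', [/\ compact K', K' `<=` W &
    forall z w, K z -> `|w| <= d -> K' (w + z)].
Proof. by move=> *; apply: compact_thicken => //; exact: closed_ball_compact_xt. Qed.
End spacetime_topology.

(** * Translations, convolution, mollification *)

Section measure_preserving.
Context d (T : measurableType d) (R : realType) (mu : {measure set T -> \bar R}).
Variable s : T -> T.
Hypothesis ms : measurable_fun setT s.
Hypothesis mu_s : forall A, measurable A -> mu (s @^-1` A) = mu A.

Let nu : {measure set T -> \bar R} :=
  measure_function_pushforward__canonical__measure_function_Measure mu ms.

Let nuE (f : T -> \bar R) : (\int[nu]_x f x = \int[mu]_x f x)%E.
Proof. by apply: eq_measure_integral => A mA _; exact: mu_s. Qed.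

Lemma measure_preserving_integrable (f : T -> \bar R) :
  mu.-integrable setT f -> mu.-integrable setT (f \o s).
Proof.
move=> /integrableP[mf foo]; apply/integrableP; split; first exact: measurableT_comp.
move: foo; rewrite -nuE; apply: le_lt_trans.
by rewrite (@ge0_integral_pushforward _ _ _ _ _ s ms mu setT)//; exact: measurableT_comp.
Qed.

Lemma measure_preserving_integral (f : T -> \bar R) :
  mu.-integrable setT f -> (\int[mu]_x f (s x) = \int[mu]_x f x)%E.
Proof.
move=> fi; rewrite -[RHS]nuE (@integral_pushforward _ _ _ _ _ s ms mu setT)//.
  exact: measurable_int fi.
exact: measure_preserving_integrable.
Qed.
End measure_preserving.

Section translation.
Context {R : realType}.

(** Lebesgue measure is determined by half-open intervals, and translations preserve their
    length. *)
Lemma lebesgue_measure_shift (a : R) (A : set R) : measurable A ->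
  lebesgue_measure ((fun x => x + a) @^-1` A) = lebesgue_measure A.
Proof.
have ms : measurable_fun setT (fun x : measurableTypeR R => x + a : measurableTypeR R).
  by apply: continuous_measurable_fun => x; apply: cvgD; [exact: cvg_id|exact: cvg_cst].
move=> mA; apply/esym.
apply: (@lebesgue_measure_unique R (measure_function_pushforward__canonical__measure_function_Measure (@lebesgue_measure R) ms)) => //.
move=> X [[x y] /= _ <-]; rewrite /pushforward.
have -> : (fun x => x + a) @^-1` `]x, y] = `](x - a)%R, (y - a)%R]%classic.
  by apply/seteqP; split => t /=; rewrite !in_itv/= ltrBlDr lerBrDr.
by rewrite !lebesgue_measure_itv/= !lte_fin ltrD2r -!EFinB opprB addrA subrK.
Qed.

(** The image of the product measure agrees with it on rectangles, which determine it. *)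
Lemma product_measure_invariant d1 d2 (T1 : measurableType d1) (T2 : measurableType d2)
    (m1 : {sigma_finite_measure set T1 -> \bar R}) (m2 : {sigma_finite_measure set T2 -> \bar R})
    (s1 : T1 -> T1) (s2 : T2 -> T2) :
  measurable_fun setT s1 -> measurable_fun setT s2 ->
  (forall A, measurable A -> m1 (s1 @^-1` A) = m1 A) ->
  (forall A, measurable A -> m2 (s2 @^-1` A) = m2 A) ->
  forall X, measurable X ->
  (m1 \x m2)%E ((fun p => (s1 p.1, s2 p.2)) @^-1` X) = (m1 \x m2)%E X.
Proof.
move=> ms1 ms2 i1 i2 X mX.
have ms : measurable_fun setT (fun p : T1 * T2 => (s1 p.1, s2 p.2)).
  by apply/measurable_fun_pairP; split; [exact: (measurableT_comp ms1)|exact: (measurableT_comp ms2)].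
apply/esym.
apply: (@product_measure_unique _ _ _ _ _ m1 m2 (measure_function_pushforward__canonical__measure_function_Measure (m1 \x m2)%E ms)) => //.
move=> A B mA mB; rewrite /= /pushforward.
rewrite (_ : _ @^-1` _ = (s1 @^-1` A) `*` (s2 @^-1` B))//.
have mA' : measurable (s1 @^-1` A) by rewrite -[X in measurable X]setTI; exact: ms1.
have mB' : measurable (s2 @^-1` B) by rewrite -[X in measurable X]setTI; exact: ms2.
by rewrite product_measure1E//; congr (_ * _)%E; [exact: i1|exact: i2].
Qed.

Lemma measurable_shift_rV n (a : 'rV[R]_n) : measurable_fun setT (fun x : 'rV[R]_n => x + a).
Proof.
apply: measurable_fun_rV => i; rewrite (_ : _ \o _ = (fun x => rV_coord i x + a ord0 i)).
  by apply: measurable_funD => //; exact: measurable_rV_coord.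
by apply/funext => x; rewrite /= /rV_coord mxE.
Qed.

(** Induction on the dimension: read through [rV_cons], a translation acts separately on the first
    coordinate and on the remaining ones. *)
Lemma lebesgue_rV_shift n (a : 'rV[R]_n) A : measurable A ->
  lebesgue_rV n ((fun x => x + a) @^-1` A) = lebesgue_rV n A.
Proof.
elim: n a A => [|n IH] a A mA.
  rewrite (_ : _ @^-1` _ = A)//; apply/seteqP.
  by split => x /=; rewrite (_ : x + a = x)//; apply/matrixP => i [].
rewrite /= /lebesgue_rV_step /pushforward.
have mA' : measurable (@rV_cons R n @^-1` A).
  by rewrite -[X in measurable X]setTI; exact: measurable_rV_cons.
rewrite -[RHS](@product_measure_invariant _ _ _ _ (@lebesgue_measure R) (lebesgue_rV n)
  (fun x => x + a ord0 ord0) (fun x => x + \row_j a ord0 (lift ord0 j)))//.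
- congr ((_ \x _)%E _); apply/funext => -[x y]; rewrite /preimage/=; congr (A _).
  apply/rowP => i; rewrite mxE !rV_consE.
  by case: unliftP => [j ->|->]; rewrite ?unlift_none// ?mxE.
- by apply: continuous_measurable_fun => x; apply: cvgD; [exact: cvg_id|exact: cvg_cst].
- exact: measurable_shift_rV.
- by move=> B mB; exact: lebesgue_measure_shift.
- by move=> B mB; exact: IH.
Qed.

Context {N : nat}.
Local Notation space := 'rV[R]_N.
Local Notation spacetime := ('rV[R]_N * R)%type.

Lemma measurable_shift_xt (a : spacetime) : measurable_fun setT (fun z : spacetime => z + a).
Proof.
apply/measurable_fun_pairP; split.
  rewrite (_ : _ \o _ = (fun x => x + a.1) \o fst)//.
  by apply: measurableT_comp => //; exact: measurable_shift_rV.
rewrite (_ : _ \o _ = (fun x => x + a.2) \o snd)//.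
by apply: measurableT_comp => //; exact: measurable_funD.
Qed.

Lemma lebesgue_xt_shift (a : spacetime) A : measurable A ->
  lebesgue_xt ((fun z => z + a) @^-1` A) = lebesgue_xt A.
Proof.
move=> mA; apply: (@product_measure_invariant _ _ _ _ (lebesgue_rV N) (@lebesgue_measure R)
  (fun x => x + a.1) (fun x => x + a.2)) => //.
- exact: measurable_shift_rV.
- by apply: measurable_funD.
- by move=> B mB; exact: lebesgue_rV_shift.
- by move=> B mB; exact: lebesgue_measure_shift.
Qed.

Lemma Rintegral_shift (a : spacetime) (f : spacetime -> R) :
  lebesgue_xt.-integrable setT (EFin \o f) ->
  \int[lebesgue_xt]_z f (z + a) = \int[lebesgue_xt]_z f z.
Proof.
move=> fi; congr fine.
exact: (@measure_preserving_integral _ _ R lebesgue_xt (fun z => z + a) (measurable_shift_xt a)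
  (@lebesgue_xt_shift a) (EFin \o f)).
Qed.
End translation.

Section bounded_mul.
Context d (T : measurableType d) (R : realType) (mu : {measure set T -> \bar R}).
Variables (D : set T) (mD : measurable D).
Implicit Types (g h : T -> R) (M : R).

Lemma integrable_bounded_mul g h M : mu.-integrable D (EFin \o g) -> measurable_fun D h ->
  (forall x, D x -> `|h x| <= M) -> mu.-integrable D (EFin \o (fun x => g x * h x)).
Proof.
move=> gi mh hM; have bh : [bounded h x | x in D].
  exists M; split; first exact: num_real.
  by move=> x Mx y Dy; apply: le_trans (hM _ Dy) (ltW Mx).
have := integrableMr mD mh bh gi; apply: eq_integrable => // x _.
by rewrite /= -EFinM mulrC.
Qed.

Lemma Rintegral_bounded_mul g h M : mu.-integrable D (EFin \o g) -> measurable_fun D h ->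
  (forall x, D x -> `|h x| <= M) ->
  `|\int[mu]_(x in D) (g x * h x)| <= M * \int[mu]_(x in D) `|g x|.
Proof.
move=> gi mh hM; have gni := integrable_norm gi.
apply: (le_trans (le_normr_Rintegral mD (integrable_bounded_mul gi mh hM))).
rewrite -RintegralZl//; apply: le_Rintegral => //.
- exact: (integrable_norm (integrable_bounded_mul gi mh hM)).
- by have := integrableZl mD M gni; apply: eq_integrable.
- by move=> x Dx; rewrite normrM mulrC ler_wpM2r// hM.
Qed.
Lemma ge0_subset_Rintegral (A : set T) g : measurable A -> A `<=` D ->
  mu.-integrable D (EFin \o g) -> (forall x, D x -> 0 <= g x) ->
  \int[mu]_(x in A) g x <= \int[mu]_(x in D) g x.
Proof.
move=> mA AD gi g0; have gA : mu.-integrable A (EFin \o g) by exact: integrableS gi.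
apply: fine_le; [exact: integrable_fin_num|exact: integrable_fin_num|].
apply: ge0_subset_integral => //; first exact: measurable_int gi.
Qed.
End bounded_mul.

Local Open Scope ring_scope.

(** * Convolution and mollifiers *)

Section convolution.
Context {R : realType} {N : nat}.
Local Notation space := 'rV[R]_N.
Local Notation spacetime := ('rV[R]_N * R)%type.
Local Notation mu := (@lebesgue_xt R N).
Implicit Types (a b f : spacetime -> R) (K : set spacetime).

(** A correlation rather than a convolution: with w + z in the argument of [a], derivatives in z
    fall on [a] and no reflection appears. *)
Definition convol a b (z : spacetime) : R := \int[mu]_w (b w * a (w + z)).

Lemma continuous_measurable_xtT a : continuous a -> measurable_fun setT a.
Proof. by move=> ca; apply: continuous_measurable_xt => //; exact: continuous_subspaceT. Qed.

Lemma continuous_shift_xt a (z : spacetime) : continuous a -> continuous (fun w : spacetime => a (w + z)).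
Proof.
move=> ca w; apply: (@continuous_comp _ _ _ (fun w : spacetime => w + z) a); last exact: ca.
by apply: cvgD; [exact: cvg_id|exact: cvg_cst].
Qed.

Lemma measurable_shifted a (z : spacetime) : continuous a -> measurable_fun setT (fun w : spacetime => a (w + z)).
Proof. by move=> ca; apply: continuous_measurable_xtT; exact: continuous_shift_xt. Qed.

Lemma convol_integrable a b K z : continuous a -> compact K -> (forall z, ~ K z -> a z = 0) ->
  mu.-integrable setT (EFin \o b) -> mu.-integrable setT (EFin \o (fun w => b w * a (w + z))).
Proof.
move=> ca cK a0 bi; have [M _ aM] := supp_bounded ca cK a0.
by apply: (@integrable_bounded_mul _ _ _ _ _ _ _ _ M) => //; exact: measurable_shifted.
Qed.

(** Uniform continuity of [a], integrated against |b|. The margin 1 in B + 1 covers the case B =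
    0. *)
Lemma convol_continuous a b K : continuous a -> compact K -> (forall z, ~ K z -> a z = 0) ->
  mu.-integrable setT (EFin \o b) -> continuous (convol a b).
Proof.
move=> ca cK a0 bi z; apply/cvgrPdist_lt => e e0.
set B := \int[mu]_w `|b w|.
have B0 : 0 <= B by exact: Rintegral_ge0.
have e'0 : 0 < e / (B + 1) by rewrite divr_gt0// ltr_wpDl.
have [d d0 hd] := supp_unif_continuous e'0 ca cK a0.
near=> y.
rewrite /convol -RintegralB//; [|exact: convol_integrable cK a0 bi|exact: convol_integrable cK a0 bi].
under eq_Rintegral do rewrite -mulrBr.
apply: (@le_lt_trans _ _ (e / (B + 1) * B)).
  apply: Rintegral_bounded_mul => //.
    by apply: measurable_funB; exact: measurable_shifted.
  move=> w _; apply: ltW; have := hd (w + y) (z - y).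
  rewrite (_ : z - y + (w + y) = w + z); last by rewrite addrC -addrA subrKC.
  apply; near: y; apply: cvgr_dist_lt => //.
by rewrite mulrAC ltr_pdivrMr ?ltr_wpDl// ltr_pM2l// ltrDl.
Unshelve. all: by end_near. Qed.

Lemma convol_is_derive a a' b K v : (forall x, is_derive x v a (a' x)) -> continuous a ->
  continuous a' -> compact K -> (forall z, ~ K z -> a z = 0) ->
  mu.-integrable setT (EFin \o b) -> forall z, is_derive z v (convol a b) (convol a' b z).
Proof.
move=> aa' ca ca' cK a0 bi z.
have a'0 y : ~ K y -> a' y = 0.
  by move=> nKy; apply: (derive_off (supp_closed cK) a0 nKy (aa' y)).
set B := \int[mu]_w `|b w|.
have B0 : 0 <= B by exact: Rintegral_ge0.
have ai y := convol_integrable y ca cK a0 bi.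
have a'i y := convol_integrable y ca' cK a'0 bi.
have L : (fun h : R => h^-1 *: ((convol a b \o shift z) (h *: v) - convol a b z)) @ 0^' --> convol a' b z.
  apply/cvgrPdist_lt => e e0.
  have e'0 : 0 < e / (B + 1) by rewrite divr_gt0// ltr_wpDl.
  have [d d0 hd] := diffquot_unif e'0 aa' ca' cK a0.
  near=> h.
  have h0 : h != 0 by near: h; exact: nbhs_dnbhs_neq.
  rewrite distrC /= /convol -RintegralB// -[_ *: _]/(_ * _) -RintegralZl//; last first.
    by have := integrableB measurableT (ai (h *: v + z)) (ai z); apply: eq_integrable.
  rewrite -RintegralB//; last first.
    have := integrableZl measurableT h^-1 (integrableB measurableT (ai (h *: v + z)) (ai z)).
    by apply: eq_integrable.
  under eq_Rintegral do rewrite -mulrBr mulrCA -mulrBr.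
  apply: (@le_lt_trans _ _ (e / (B + 1) * B)).
    apply: Rintegral_bounded_mul => //.
      apply: measurable_funB; last exact: measurable_shifted.
      by apply: measurable_funM => //; apply: measurable_funB; exact: measurable_shifted.
    move=> w _; apply: ltW; rewrite addrCA; apply: hd => //.
    by near: h; exact: dnbhs0_lt.
  by rewrite mulrAC ltr_pdivrMr ?ltr_wpDl// ltr_pM2l// ltrDl.
apply: DeriveDef; first by apply/cvg_ex; eexists; exact: L.
exact/cvg_lim.
Unshelve. all: by end_near. Qed.

Lemma Ck_convol k a b K : (forall k, Ck setT k a) -> compact K -> (forall z, ~ K z -> a z = 0) ->
  mu.-integrable setT (EFin \o b) -> Ck setT k (convol a b).
Proof.
move=> + cK + bi; elim: k a => [|k IH] a ka a0.
  split => //; apply: continuous_subspaceT; apply: (convol_continuous _ cK a0 bi).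
  exact: (Ck_continuous (ka 0)).
apply: CkS_intro; first by apply: (convol_continuous _ cK a0 bi); exact: (Ck_continuous (ka 0)).
move=> v; have [a' aa' ka'] := CkS_elim (ka 1) v.
(* The derivative provided at order j could be another function; uniqueness of derivatives
   identifies it with a'. *)
have ka'k j : Ck setT j a'.
  have [a'' aa'' ka''] := CkS_elim (ka j.+1) v.
  rewrite (_ : a' = a'')//; apply/funext => x.
  by rewrite -(@derive_val _ _ _ _ _ _ _ (aa' x)) -(@derive_val _ _ _ _ _ _ _ (aa'' x)).
exists (convol a' b).
  by apply: (convol_is_derive aa' _ _ cK a0 bi); [exact: (Ck_continuous (ka 0))|exact: (Ck_continuous ka')].
apply: IH => // y nKy; exact: (derive_off (supp_closed cK) a0 nKy (aa' y)).
Qed.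

(** The translation by z exchanges the roles of the two functions, at the price of a reflection;
    derivatives can then fall on whichever of them is smooth. *)
Lemma convol_sym a b K : continuous a -> compact K -> (forall z, ~ K z -> a z = 0) ->
  mu.-integrable setT (EFin \o b) -> convol b a = convol a b \o -%R.
Proof.
move=> ca cK a0 bi; apply/funext => z /=; rewrite /convol.
rewrite -[RHS](@Rintegral_shift _ _ z); last exact: convol_integrable cK a0 bi.
by apply: eq_Rintegral => w _; rewrite mulrC addrK.
Qed.

Definition mollifier (e : R) (rho : spacetime -> R) :=
  [/\ forall w, 0 <= rho w, forall k, Ck setT k rho, forall w, e <= `|w| -> rho w = 0,
   mu.-integrable setT (EFin \o rho) & \int[mu]_w rho w = 1].

Lemma compact_integrable f K : measurable_fun setT f -> compact K -> (forall z, ~ K z -> f z = 0) ->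
  (exists M, forall z, `|f z| <= M) ->
  mu.-integrable setT (EFin \o f).
Proof.
move=> mf cK f0 [M fM].
have Kf : mu.-integrable K (EFin \o f).
  apply: measurable_bounded_integrable.
  - exact: compact_measurable_xt.
  - exact: compact_xt_finite.
  - exact: measurable_funTS.
  - exists M; split; first exact: num_real.
    by move=> x Mx y Dy; apply: le_trans (fM _) (ltW Mx).
have := proj1 (integrable_mkcond _ (compact_measurable_mu cK)) Kf.
apply: eq_integrable => // z _; rewrite patchE; case: ifPn => // /negP.
by rewrite inE => /f0 /= ->.
Qed.

Lemma mollifier_exists (e : R) : 0 < e -> exists rho, mollifier e rho.
Proof.
move=> e0.
pose m (w : spacetime) : R := (\prod_(i < N) bump1 (w.1 ord0 i / e)) * bump1 (w.2 / e).
have m_ge0 w : 0 <= m w by rewrite mulr_ge0 ?bump1_ge0// prodr_ge0// => i _; exact: bump1_ge0.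
have km k : Ck setT k m.
  apply: CkM.
    apply: Ck_prod => i.
    apply: (@Ck_affine R _ R k (fun w : spacetime => w.1 ord0 i / e) (fun w => w.1 ord0 i / e) bump1); last exact: Ck_bump1.
      move=> w; apply: cvgMl.
      apply: (@continuous_comp _ _ _ fst (fun x : space => x ord0 i)); first exact: cvg_fst.
      exact: coord_continuous.
    by move=> v x h; rewrite /= !mxE mulrDl -mulrA.
  apply: (@Ck_affine R _ R k (fun w : spacetime => w.2 / e) (fun w => w.2 / e) bump1); last exact: Ck_bump1.
    by move=> w; apply: cvgMl; exact: cvg_snd.
  by move=> v x h; rewrite /= mulrDl -mulrA.
have norm_ge (w : spacetime) : e <= `|w| -> m w = 0.
  rewrite prod_normE/= le_max => /orP[ew|ew].
    have [i wi] : exists i, e <= `|w.1 ord0 i|.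
      move: ew; rewrite [`|w.1|]/Num.norm/= => ew.
      have := @mx_norm_neq0 _ _ _ w.1.
      have -> : mx_norm w.1 != 0 by rewrite gt_eqF// (lt_le_trans e0).
      by move=> /(_ isT)[[j i]/=]; rewrite ord1 => we; exists i; rewrite -we.
    rewrite /m (bigD1 i)//= bump1_eq0 ?mul0r//.
    by rewrite normrM normfV (gtr0_norm e0) ler_pdivlMr// mul1r.
  by rewrite /m [X in _ * X]bump1_eq0 ?mulr0// normrM normfV (gtr0_norm e0) ler_pdivlMr// mul1r.
pose K : set spacetime := [set w | `|w| <= e].
have cK : compact K by exact: closed_ball_compact_xt.
have m0 w : ~ K w -> m w = 0 by move=> /negP; rewrite -ltNge => /ltW/norm_ge.
have cm : continuous m by exact: (Ck_continuous (km 0)).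
have mi : mu.-integrable setT (EFin \o m).
  apply: (compact_integrable _ cK m0); first exact: continuous_measurable_xtT.
  by have [M _ hM] := supp_bounded cm cK m0; exists M.
set c := \int[mu]_w m w.
(* The mass is positive because m >= k^(N+1) on a cube of side e centred at 0: for |s| <= e / 2 both
   1 + s / e and 1 - s / e are at least 1/2, so each exponential factor of the bump is at least
   e^(-2). *)
have c0 : 0 < c.
  pose I : set R := `[- (e / 2), e / 2]%classic.
  pose A : set space := [set x | forall i, I (x ord0 i)].
  have mI : measurable I by exact: measurable_itv.
  have mA : measurable A.
    rewrite (_ : A = \bigcap_(i in [set: 'I_N]) (rV_coord i @^-1` I)).
      apply: fin_bigcap_measurable => // i _; rewrite -[X in measurable X]setTI.
      exact: measurable_rV_coord.
    by apply/seteqP; split => y /= h => [i _|i]; exact: h.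
  have muI : lebesgue_measure I = e%:E.
    rewrite /I lebesgue_measure_itv/= lte_fin gt0_cp// ?divr_gt0// -EFinB opprK.
    by rewrite -splitr.
  have muAI : mu (A `*` I) = (e ^+ N.+1)%:E.
    rewrite lebesgue_xtX// (_ : lebesgue_x A = (e ^+ N)%:E); last first.
      rewrite /lebesgue_x [LHS](@lebesgue_rV_box R N (fun=> I))//.
      have -> : e ^+ N = \prod_(i < N) e by rewrite prodr_const card_ord.
      by rewrite -prodEFin; apply: eq_bigr => i _; exact: muI.
    by rewrite muI -EFinM exprSr.
  set k := expR (-2) * expR (-2) : R.
  have k0 : 0 < k by rewrite mulr_gt0// expR_gt0.
  have kbump s : `|s| <= e / 2 -> k <= bump1 (s / e).
    move=> se; have : `|s / e| <= 2^-1.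
      by rewrite normrM normfV (gtr0_norm e0) ler_pdivrMr// mulrC.
    rewrite ler_norml => /andP[s1 s2].
    rewrite /bump1 /flat !expr0 !mul1r !ifT; [|lra|lra].
    apply: ler_pM; rewrite ?expR_ge0// ler_expR lerN2 invf_ple ?posrE//; lra.
  apply: (@lt_le_trans _ _ (k ^+ N.+1 * e ^+ N.+1)); first by rewrite mulr_gt0// exprn_gt0.
  have -> : k ^+ N.+1 * e ^+ N.+1 = \int[mu]_(w in A `*` I) (k ^+ N.+1).
    rewrite Rintegral_cst; last exact: measurableX.
    by rewrite muAI.
  apply: (@le_trans _ _ (\int[mu]_(w in A `*` I) m w)).
    apply: le_Rintegral; first exact: measurableX.
    - apply: measurable_bounded_integrable => //; first exact: measurableX.
        by rewrite muAI ltry.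
      exists (k ^+ N.+1); split; first exact: num_real.
      by move=> x Mx y Dy; rewrite ger0_norm ?exprn_ge0 ?ltW//.
    - by apply: integrableS mi => //; exact: measurableX.
    - move=> w [Aw Iw]; rewrite exprSr; apply: ler_pM; [exact/exprn_ge0/ltW|exact: ltW| | ].
        rewrite -[X in _ ^+ X](card_ord N) -prodr_const; apply: ler_prod => i _.
        by rewrite ltW//= kbump//; have := Aw i; rewrite /I/= in_itv/= -ler_norml.
      by apply: kbump; move: Iw; rewrite /I/= in_itv/= -ler_norml.
  by apply: ge0_subset_Rintegral => //; exact: measurableX.
exists (fun w => c^-1 * m w); split.
- by move=> w; rewrite mulr_ge0// invr_ge0 ltW.
- by move=> k; exact: CkZ.
- by move=> w /norm_ge ->; rewrite mulr0.
- by have := integrableZl measurableT c^-1 mi; apply: eq_integrable.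
- by rewrite RintegralZl// mulVf// gt_eqF.
Qed.
End convolution.

Section supported_mul.
Context d (T : measurableType d) (R : realType) (mu : {measure set T -> \bar R}).
Variables (A D : set T) (mA : measurable A) (mD : measurable D) (AD : A `<=` D).
Variables (g h : T -> R) (M : R).
Hypotheses (gi : mu.-integrable A (EFin \o g)) (mh : measurable_fun A h).
Hypotheses (hM : forall x, A x -> `|h x| <= M) (h0 : forall x, D x -> ~ A x -> h x = 0).

Let ghE x : D x -> (EFin \o (fun x => g x * h x)) x = ((EFin \o (fun x => g x * h x)) \_ A) x.
Proof.
by move=> Dx; rewrite patchE; case: ifPn => // /negP; rewrite inE => nAx /=; rewrite h0// mulr0.
Qed.

Lemma integrable_supported_mul : mu.-integrable D (EFin \o (fun x => g x * h x)).
Proof.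
apply: (eq_integrable mD ((EFin \o (fun x => g x * h x)) \_ A)).
  by move=> x; rewrite inE => /ghE.
by apply/integrable_restrict => //; rewrite setIidr//; exact: integrable_bounded_mul hM.
Qed.

Lemma Rintegral_supported_mul :
  \int[mu]_(x in D) (g x * h x) = \int[mu]_(x in A) (g x * h x).
Proof.
rewrite -[in RHS](setIidr AD) Rintegral_mkcondr; apply: eq_Rintegral => x; rewrite inE => Dx.
by rewrite patchE; case: ifPn => // /negP; rewrite inE => nAx /=; rewrite h0// mulr0.
Qed.

Lemma Rintegral_supported_mul_le :
  `|\int[mu]_(x in D) (g x * h x)| <= M * \int[mu]_(x in A) `|g x|.
Proof. by rewrite Rintegral_supported_mul; exact: Rintegral_bounded_mul. Qed.
End supported_mul.

(** * The weak formulation for tests of class C^{2,1} *)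

Section weak_C21.
Context {R : realType} {N : nat}.
Local Notation space := 'rV[R]_N.
Local Notation spacetime := ('rV[R]_N * R)%type.
Local Notation mu := (@lebesgue_xt R N).
Local Notation mxt := (@measurable _ (space * measurableTypeR R)%type).

Lemma open_oo_time (T : \bar R) : open (oo_time T).
Proof.
case: T => [r||].
- rewrite (_ : oo_time _ = `]0, r[%classic); first exact: interval_open.
  by apply/seteqP; split => t; rewrite /oo_time/= in_itv/= lte_fin => /andP.
- rewrite (_ : oo_time _ = [set t | 0 < t]); first exact: open_gt.
  by apply/seteqP; split => t; rewrite /oo_time/= ltry => // -[].
- rewrite (_ : oo_time _ = set0); first exact: open0.
  by apply/seteqP; split => t //= [].
Qed.

Lemma open_cylinder (Omega : set space) (T : \bar R) : open Omega -> open (cylinder Omega T).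
Proof. move=> oO; rewrite openE => -[x t] [/= Ox Tt].
exists (Omega, oo_time T) => //=; split; apply: open_nbhs_nbhs; split => //.
exact: open_oo_time. Qed.

Implicit Types (f g rho : spacetime -> R) (K : set spacetime).

(* [f] is of class C^{2,1} on the whole space-time, with [ft], [fi i], [fii i]
   its time derivative and pure space derivatives of order one and two. *)
Record C21 (f ft : spacetime -> R) (fi fii : 'I_N -> spacetime -> R) : Prop := MkC21 {
  C21_f : continuous f;
  C21_ft : continuous ft;
  C21_fi : forall i, continuous (fi i);
  C21_fii : forall i, continuous (fii i);
  C21_dt : forall z, is_derive z ((0, 1) : spacetime) f (ft z);
  C21_dx : forall i z, is_derive z ((delta_mx 0 i, 0) : spacetime) f (fi i z);
  C21_dxx : forall i z, is_derive z ((delta_mx 0 i, 0) : spacetime) (fi i) (fii i z) }.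

Lemma smooth_C21 f : (forall k, Ck setT k f) -> exists ft fi fii, C21 f ft fi fii.
Proof.
move=> kf; have [ft fft kft] := CkS_elim (kf 1) ((0, 1) : spacetime).
have /choice[g hg] i : exists g : (spacetime -> R) * (spacetime -> R),
    [/\ continuous g.1, continuous g.2,
     forall z, is_derive z ((delta_mx 0 i, 0) : spacetime) f (g.1 z) &
     forall z, is_derive z ((delta_mx 0 i, 0) : spacetime) g.1 (g.2 z)].
  have [g1 fg1 kg1] := CkS_elim (kf 2) ((delta_mx 0 i, 0) : spacetime).
  have [g2 fg2 kg2] := CkS_elim kg1 ((delta_mx 0 i, 0) : spacetime).
  by exists (g1, g2); split => //=; [exact: Ck_continuous kg1|exact: Ck_continuous kg2].
exists ft, (fun i => (g i).1), (fun i => (g i).2); split=> //.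
- exact: Ck_continuous (kf 0).
- exact: Ck_continuous kft.
- by move=> i; have [] := hg i.
- by move=> i; have [] := hg i.
- by move=> i; have [] := hg i.
- by move=> i; have [] := hg i.
Qed.

Lemma C21_lin f ft fi fii g gt gi gii (c : R) : C21 f ft fi fii -> C21 g gt gi gii ->
  C21 (fun z => f z + c * g z) (fun z => ft z + c * gt z) (fun i z => fi i z + c * gi i z)
    (fun i z => fii i z + c * gii i z).
Proof.
have clin (a b : spacetime -> R) : continuous a -> continuous b -> continuous (fun z => a z + c * b z).
  by move=> ca cb z; apply: cvgD; [exact: ca|apply: cvgMr; exact: cb].
have dlin v (a a' b b' : spacetime -> R) z : is_derive z v a (a' z) -> is_derive z v b (b' z) ->
    is_derive z v (fun z => a z + c * b z) (a' z + c * b' z).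
  by move=> ha hb; apply: is_deriveD => //; exact: (is_deriveZ c hb).
move=> [f1 f2 f3 f4 f5 f6 f7] [g1 g2 g3 g4 g5 g6 g7]; split.
- exact: clin.
- exact: clin.
- by move=> i; exact: clin.
- by move=> i; exact: clin.
- by move=> z; exact: dlin.
- by move=> i z; exact: dlin.
- by move=> i z; exact: dlin.
Qed.

Lemma C21_supp f ft fi fii K : C21 f ft fi fii -> compact K -> (forall z, ~ K z -> f z = 0) ->
  [/\ forall z, ~ K z -> ft z = 0, forall i z, ~ K z -> fi i z = 0 &
      forall i z, ~ K z -> fii i z = 0].
Proof.
move=> F /supp_closed cK f0.
have fi0 i z : ~ K z -> fi i z = 0 by move=> nKz; exact: (derive_off cK f0 nKz (C21_dx F i z)).
split => //; first by move=> z nKz; exact: (derive_off cK f0 nKz (C21_dt F z)).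
by move=> i z nKz; exact: (derive_off cK (fi0 i) nKz (C21_dxx F i z)).
Qed.

Lemma C21_convol f ft fi fii K b : C21 f ft fi fii -> compact K -> (forall z, ~ K z -> f z = 0) ->
  mu.-integrable setT (EFin \o b) ->
  C21 (convol f b) (convol ft b) (fun i => convol (fi i) b) (fun i => convol (fii i) b).
Proof.
move=> F cK f0 bi; have [ft0 fi0 fii0] := C21_supp F cK f0.
case: F => f1 f2 f3 f4 f5 f6 f7; split.
- exact: convol_continuous cK f0 bi.
- exact: convol_continuous cK ft0 bi.
- by move=> i; exact: convol_continuous cK (fi0 i) bi.
- by move=> i; exact: convol_continuous cK (fii0 i) bi.
- exact: convol_is_derive cK f0 bi.
- by move=> i; exact: convol_is_derive cK f0 bi.
- by move=> i; exact: convol_is_derive cK (fi0 i) bi.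
Qed.

(** As [rho] has mass 1, the difference is the integral of rho(w) (g(w + z) - g(z)), where only |w|
    < e contributes. *)
Lemma convol_close g rho (e dlt : R) K z : continuous g -> compact K -> (forall z, ~ K z -> g z = 0) ->
  mollifier e rho -> (forall w, `|w| < e -> `|g (w + z) - g z| <= dlt) ->
  `|convol g rho z - g z| <= dlt.
Proof.
move=> cg cK g0 [rho0 krho rhoe rhoi rho1] hw.
rewrite -[X in _ - X]mulr1 -rho1 -RintegralZl// -RintegralB//; last 2 first.
- exact: convol_integrable cK g0 rhoi.
- by have := integrableZl measurableT (g z) rhoi; apply: eq_integrable.
have hi : mu.-integrable setT (EFin \o (fun w => rho w * g (w + z) - g z * rho w)).
  have := integrableB measurableT (convol_integrable z cg cK g0 rhoi)
    (integrableZl measurableT (g z) rhoi).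
  by apply: eq_integrable.
apply: le_trans (le_normr_Rintegral _ hi) _ => //.
rewrite -[leRHS]mulr1 -rho1 -RintegralZl//; apply: le_Rintegral => //.
- exact: integrable_norm hi.
- by have := integrableZl measurableT dlt rhoi; apply: eq_integrable.
move=> w _; rewrite mulrC -mulrBl normrM (ger0_norm (rho0 w)).
have [we|we] := ltP `|w| e; first by rewrite ler_wpM2r// hw.
by rewrite rhoe// !mulr0.
Qed.

Lemma convol_supp f rho (e : R) (K K' : set spacetime) z :
  (forall z, ~ K z -> f z = 0) ->
  (forall z w, K z -> `|w| <= e -> K' (w + z)) -> mollifier e rho -> ~ K' z -> convol f rho z = 0.
Proof.
move=> f0 KK' [_ _ rhoe _ _] nK'; rewrite /convol (_ : (fun w => rho w * f (w + z)) = cst 0).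
  by rewrite Rintegral_cst// mul0r.
apply/funext => w /=; have [we|we] := ltP `|w| e; last by rewrite rhoe// mul0r.
rewrite f0 ?mulr0// => /(KK' _ (- w)); rewrite normrN addKr => /(_ (ltW we)).
exact: nK'.
Qed.

(** By [convol_sym] all derivatives fall on [rho], so integrability of f is enough. *)
Lemma Ck_mollified f rho (e : R) k : mu.-integrable setT (EFin \o f) -> mollifier e rho ->
  Ck setT k (convol f rho).
Proof.
move=> fi [rho0 krho rhoe rhoi rho1].
have cB := @closed_ball_compact_xt R N e.
have rhoB w : ~ [set w : spacetime | `|w| <= e] w -> rho w = 0.
  by move=> /negP; rewrite -ltNge => /ltW/rhoe.
rewrite (convol_sym (Ck_continuous (krho 0)) cB rhoB fi).
apply: (@Ck_affine R spacetime spacetime k -%R -%R).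
- by move=> z; exact: opp_continuous.
- by move=> v x h; rewrite opprD scalerN.
- exact: (Ck_convol _ krho cB rhoB fi).
Qed.

(** The indicator of a neighbourhood of K is mollified. Two thickenings are taken: seen from K the
    averages stay inside the first and equal 1, and the second contains the support of the
    result. *)
Lemma smooth_cutoff (K W : set spacetime) : compact K -> open W -> K `<=` W ->
  exists chi K', [/\ forall k, Ck setT k chi, forall z, 0 <= chi z, forall z, K z -> chi z = 1,
    compact K' /\ K' `<=` W & forall z, ~ K' z -> chi z = 0].
Proof.
move=> cK oW KW.
have [d2 d20 [K2 [cK2 K2W KK2]]] := compact_thicken_xt cK oW KW.
have [d3 d30 [K3 [cK3 K3W KK3]]] := compact_thicken_xt cK2 oW K2W.
have e0 : 0 < Num.min d2 d3 by rewrite lt_min d20.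
set e := Num.min d2 d3 in e0.
have [rho mrho] := @mollifier_exists R N e e0.
have rhoi : mu.-integrable setT (EFin \o rho) by case: mrho.
have chii : mu.-integrable setT (EFin \o (\1_K2 : spacetime -> R)).
  apply: (compact_integrable _ cK2).
  - by apply: measurable_indic; exact: compact_measurable_xt.
  - by move=> z nK; rewrite indicE memNset.
  - by exists 1 => z; rewrite indicE; case: (_ \in _); rewrite /= ?normr1// normr0.
have rho_ge0 w : 0 <= rho w by case: mrho => + _ _ _ _; exact.
exists (convol (\1_K2 : spacetime -> R) rho), K3; split => //.
- by move=> k; exact: Ck_mollified chii mrho.
- by move=> z; apply: Rintegral_ge0 => w _; rewrite mulr_ge0// indicE.
- move=> z Kz; case: (mrho) => _ _ rhoe _ <-; apply: eq_Rintegral => w _.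
  have [we|we] := ltP `|w| e; last by rewrite rhoe// mul0r.
  rewrite indicE mem_set ?mulr1//; apply: KK2 => //.
  by apply: ltW; apply: lt_le_trans we _; rewrite ge_min lexx.
- move=> z; apply: (@convol_supp _ rho e K2 K3 _ _ _ mrho) => [y nK|y w Ky we].
    by rewrite indicE memNset.
  by apply: KK3 => //; apply: le_trans we _; rewrite ge_min lexx orbT.
Qed.

Variables (Omega : set space) (T : \bar R) (U Phi : spacetime -> R).
Hypothesis oO : open Omega.
Local Notation Q := (cylinder Omega T).
Let mQ : mxt Q. Proof. by apply: open_measurable_mu; exact: open_cylinder. Qed.

Definition pairing (W g : spacetime -> R) : R := \int[mu]_(z in Q) (W z * g z).

Lemma pairing_integrable W g K : L1loc_xt Q W -> compact K -> K `<=` Q -> continuous g ->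
  (forall z, ~ K z -> g z = 0) -> mu.-integrable Q (EFin \o (fun z => W z * g z)).
Proof.
move=> [_ Wi] cK KQ cg g0; have [M _ gM] := supp_bounded cg cK g0.
apply: (@integrable_supported_mul _ (space * measurableTypeR R)%type R mu K Q _ mQ KQ W g M) => //.
- exact: compact_measurable_mu.
- exact: Wi.
- by apply: measurable_funTS; exact: continuous_measurable_xtT.
- by move=> x _ nK; exact: g0.
Qed.

Lemma pairing_le W g K (M : R) : L1loc_xt Q W -> compact K -> K `<=` Q -> continuous g ->
  (forall z, ~ K z -> g z = 0) -> (forall z, `|g z| <= M) ->
  `|pairing W g| <= M * \int[mu]_(z in K) `|W z|.
Proof.
move=> [_ Wi] cK KQ cg g0 gM.
have mg : measurable_fun (K : set (space * measurableTypeR R)%type) g.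
  by apply: measurable_funTS; exact: continuous_measurable_xtT.
have H := (@Rintegral_supported_mul_le _ _ R mu K Q (compact_measurable_mu cK) KQ W g M
  (Wi _ cK KQ) mg (fun x _ => gM x) (fun x _ nK => g0 x nK)).
exact: H.
Qed.

Lemma pairing_lin W f g K (c : R) : L1loc_xt Q W -> compact K -> K `<=` Q ->
  continuous f -> continuous g ->
  (forall z, ~ K z -> f z = 0) -> (forall z, ~ K z -> g z = 0) ->
  pairing W (fun z => f z + c * g z) = pairing W f + c * pairing W g.
Proof.
move=> LW cK KQ cf cg f0 g0.
have fi := pairing_integrable LW cK KQ cf f0.
have gi := pairing_integrable LW cK KQ cg g0.
rewrite /pairing -(RintegralZl _ mQ)// -(RintegralD mQ)//; last first.
  by have := integrableZl mQ c gi; apply: eq_integrable.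
by apply: eq_Rintegral => z _; rewrite mulrDr mulrCA.
Qed.

(** A real-valued counterpart of [heat_integral], with the derivatives as arguments, so that
    linearity and estimates are statements about three pairings. *)
Definition heat_form (f ft : spacetime -> R) (fii : 'I_N -> spacetime -> R) : R :=
  pairing U ft + pairing U (fun z => \sum_i fii i z) + pairing Phi f.

Hypotheses (LU : L1loc_xt Q U) (LPhi : L1loc_xt Q Phi).

Lemma continuous_sum_fun (I : finType) (F : I -> spacetime -> R) :
  (forall i, continuous (F i)) -> continuous (fun z => \sum_i F i z).
Proof. move=> cF; rewrite unlock; elim: (index_enum I) => [|i s IH] /=; first exact: cst_continuous.
by move=> z; apply: cvgD; [exact: cF|exact: IH]. Qed.

Lemma heat_form_lin f ft fi fii g gt gi gii (c : R) K : C21 f ft fi fii -> C21 g gt gi gii ->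
  compact K -> K `<=` Q -> (forall z, ~ K z -> f z = 0) -> (forall z, ~ K z -> g z = 0) ->
  heat_form (fun z => f z + c * g z) (fun z => ft z + c * gt z) (fun i z => fii i z + c * gii i z)
  = heat_form f ft fii + c * heat_form g gt gii.
Proof.
move=> F G cK KQ f0 g0.
have [ft0 _ fii0] := C21_supp F cK f0.
have [gt0 _ gii0] := C21_supp G cK g0.
rewrite /heat_form.
have E : (fun z => \sum_i (fii i z + c * gii i z)) = (fun z => \sum_i fii i z + c * \sum_i gii i z).
  by apply/funext => z; rewrite big_split/= -mulr_sumr.
rewrite E !(pairing_lin (K := K)) //; first by ring.
all: try by [case: F|case: G].
- by apply: continuous_sum_fun; case: F.
- by apply: continuous_sum_fun; case: G.
- by move=> z nK; rewrite big1// => i _; exact: fii0.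
- by move=> z nK; rewrite big1// => i _; exact: gii0.
Qed.

(** Continuity of the form under uniform convergence of f, f_t and the f_ii with supports in a fixed
    compact set, which is exactly what mollification provides. *)
Lemma heat_form_le f ft fi fii (M : R) K : C21 f ft fi fii ->
  compact K -> K `<=` Q -> (forall z, ~ K z -> f z = 0) ->
  (forall z, `|f z| <= M) -> (forall z, `|ft z| <= M) -> (forall i z, `|fii i z| <= M) ->
  `|heat_form f ft fii| <= M * ((1 + N%:R) * \int[mu]_(z in K) `|U z| + \int[mu]_(z in K) `|Phi z|).
Proof.
move=> F cK KQ f0 fM ftM fiiM.
have [ft0 _ fii0] := C21_supp F cK f0.
rewrite mulrDr mulrA mulrDr mulr1 mulrDl.
apply: le_trans (ler_normD _ _) _; apply: lerD; last by apply: pairing_le => //; case: F.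
apply: le_trans (ler_normD _ _) _; apply: lerD; first by apply: pairing_le => //; case: F.
apply: pairing_le => //.
- by apply: continuous_sum_fun; case: F.
- by move=> z nK; rewrite big1// => i _; exact: fii0.
- move=> z; apply: le_trans (ler_norm_sum _ _ _) _.
  by apply: le_trans (ler_sum _ (fun i _ => fiiM i z)) _; rewrite sumr_const card_ord mulr_natr.
Qed.

Lemma heat_integral_C21 f ft fi fii K : C21 f ft fi fii ->
  compact K -> K `<=` Q -> (forall z, ~ K z -> f z = 0) ->
  heat_integral Omega T U Phi f = (heat_form f ft fii)%:E.
Proof.
move=> F cK KQ f0; have [ft0 _ fii0] := C21_supp F cK f0.
have i1 : mu.-integrable Q (EFin \o (fun z => U z * ft z)).
  by apply: (pairing_integrable LU cK KQ) => //; case: F.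
have i2 : mu.-integrable Q (EFin \o (fun z => U z * \sum_i fii i z)).
  apply: (pairing_integrable LU cK KQ); first by apply: continuous_sum_fun; case: F.
  by move=> z nK; rewrite big1// => i _; exact: fii0.
have i3 : mu.-integrable Q (EFin \o (fun z => Phi z * f z)).
  by apply: (pairing_integrable LPhi cK KQ) => //; case: F.
rewrite /heat_form /pairing -(RintegralD mQ)//= -(RintegralD mQ)//; last first.
  by have := integrableD mQ i1 i2; apply: eq_integrable.
rewrite /heat_integral /Rintegral fineK; last first.
  apply: integrable_fin_num => //.
  by have := integrableD mQ (integrableD mQ i1 i2) i3; apply: eq_integrable.
apply: eq_integral => z _; congr (_ * _ + _ * _ + _)%:E.
  by rewrite /dt (@derive_val _ _ _ _ _ _ _ (C21_dt F z)).
rewrite /laplacian; apply: eq_bigr => i _; rewrite /dx.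
rewrite (_ : (fun z => _) = fi i); last first.
  by apply/funext => y; rewrite (@derive_val _ _ _ _ _ _ _ (C21_dx F i y)).
by rewrite (@derive_val _ _ _ _ _ _ _ (C21_dxx F i z)).
Qed.

Hypothesis weakU : forall phi, test_function Q phi -> (forall z, Q z -> 0 <= phi z) ->
  heat_integral Omega T U Phi phi = 0%E.

Lemma CkS_sub k f : Ck setT k f -> Ck Q k f.
Proof.
elim: k f => [|k IH] f kf.
  by split=> //; apply: continuous_subspaceT; exact: Ck_continuous kf.
split; first by apply: continuous_subspaceT; exact: Ck_continuous kf.
move=> v; have [g fg kg] := CkS_elim kf v; split=> [x _|]; first by case: (fg x).
by exists g; [move=> x _; case: (fg x)|exact: IH].
Qed.

Lemma weak_smooth_ge0 f ft fi fii K : C21 f ft fi fii -> (forall k, Ck setT k f) ->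
  compact K -> K `<=` Q -> (forall z, ~ K z -> f z = 0) -> (forall z, 0 <= f z) ->
  heat_form f ft fii = 0.
Proof.
move=> F kf cK KQ f0 fge0; have := heat_integral_C21 F cK KQ f0.
rewrite weakU => [[]//| |z _]; last exact: fge0.
by split; [move=> k; exact: CkS_sub|exists K; split => // z _; exact: f0].
Qed.

(* The mollified test is made nonnegative by adding a multiple of a smooth
   cutoff, which can be tested too. *)
Lemma weak_C21 f ft fi fii K : C21 f ft fi fii ->
  compact K -> K `<=` Q -> (forall z, ~ K z -> f z = 0) -> heat_form f ft fii = 0.
Proof.
move=> F cK KQ f0; have [ft0 fi0 fii0] := C21_supp F cK f0.
have oQ : open Q by exact: open_cylinder.
have [d1 d10 [K1 [cK1 K1Q KK1]]] := compact_thicken_xt cK oQ KQ.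
have [chi [K3 [kchi chi_ge0 chi1 [cK3 K3Q] chi0]]] := smooth_cutoff cK1 oQ K1Q.
have [M M0 fM] := supp_bounded (C21_f F) cK f0.
have K0K1 : K `<=` K1.
  by move=> z Kz; rewrite -(add0r z); apply: KK1 => //; rewrite normr0 ltW.
have K1K3 z : ~ K3 z -> ~ K1 z.
  by move=> /chi0 chiz /chi1; rewrite chiz => /esym/eqP; rewrite oner_eq0.
set C := (1 + N%:R) * \int[mu]_(z in K1) `|U z| + \int[mu]_(z in K1) `|Phi z|.
have C0 : 0 <= C by rewrite addr_ge0 ?mulr_ge0// ?Rintegral_ge0.
apply/eqP; rewrite -normr_eq0; apply/eqP/le_anti; rewrite normr_ge0 andbT.
apply/ler_addgt0Pl => eps eps0; rewrite addr0.
pose dlt := eps / (C + 1).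
have dlt0 : 0 < dlt by rewrite divr_gt0// ltr_wpDl.
have near_unif (g : spacetime -> R) : continuous g -> (forall z, ~ K z -> g z = 0) ->
    nbhs (0 : R) (fun e => forall w z, `|w| < e -> `|g (w + z) - g z| <= dlt).
  move=> cg g0; have [d d0 hd] := supp_unif_continuous dlt0 cg cK g0.
  near=> e => w z we; apply: ltW; apply: hd; apply: lt_trans we _.
  by near: e; exact: lt_nbhsl.
(* A single radius for all purposes: at most d1, so that mollification keeps the support in K1, and
   small for the moduli of continuity of f, ft and every fii. *)
have [e [e0 ed1 [uf uft ufii]]] : exists e, [/\ 0 < e, e <= d1 &
   [/\ forall w z, `|w| < e -> `|f (w + z) - f z| <= dlt,
   forall w z, `|w| < e -> `|ft (w + z) - ft z| <= dlt &
   forall i w z, `|w| < e -> `|fii i (w + z) - fii i z| <= dlt]].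
  have [d d0 hd] : exists2 d : R, 0 < d & forall e, `|e| < d -> [/\ forall w z, `|w| < e -> `|f (w + z) - f z| <= dlt,
   forall w z, `|w| < e -> `|ft (w + z) - ft z| <= dlt &
   forall i w z, `|w| < e -> `|fii i (w + z) - fii i z| <= dlt].
    apply: (@nbhs0_ballP R R).
    have H1 := near_unif _ (C21_f F) f0.
    have H2 := near_unif _ (C21_ft F) ft0.
    have H3 : nbhs (0 : R) (fun e => forall i w z, `|w| < e -> `|fii i (w + z) - fii i z| <= dlt).
      have H3i i : nbhs (0 : R) (fun e => forall w z, `|w| < e -> `|fii i (w + z) - fii i z| <= dlt).
        by apply: near_unif => [|z /fii0]; [case: F|exact].
      exact: (@filter_forall _ _ _ _ (@nbhs_filter R (0 : R)) H3i).
    by apply: filterS3 H1 H2 H3.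
  have e0 : 0 < Num.min d1 (d / 2) by rewrite lt_min d10 divr_gt0.
  exists (Num.min d1 (d / 2)); split => //; first by rewrite ge_min lexx.
  apply: hd; rewrite gtr0_norm// gt_min; apply/orP; right.
  by rewrite ltr_pdivrMr// ltr_pMr// ltr1n.
have [rho mrho] := @mollifier_exists R N e e0.
have rhoi : mu.-integrable setT (EFin \o rho) by case: mrho.
pose fe := convol f rho.
have Fe : C21 fe (convol ft rho) (fun i => convol (fi i) rho) (fun i => convol (fii i) rho).
  exact: C21_convol F cK f0 rhoi.
have intf : mu.-integrable setT (EFin \o f).
  apply: (compact_integrable _ cK f0); last by exists M.
  by apply: continuous_measurable_xtT; case: F.
have fe0 z : ~ K1 z -> fe z = 0.
  apply: (convol_supp f0 _ mrho) => y w Ky we; apply: KK1 => //; exact: le_trans ed1.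
have [chit [chi_i [chi_ii CHI]]] := smooth_C21 kchi.
have feM z : `|fe z| <= M.
  rewrite /fe /convol; apply: le_trans (Rintegral_bounded_mul _ rhoi _ _) _ => //.
  - by apply: measurable_shifted; case: F.
  - case: (mrho) => rho0 _ _ _ rho1.
    by under eq_Rintegral do rewrite ger0_norm//; rewrite rho1 mulr1.
have fe0' z : ~ K3 z -> fe z = 0 by move=> /K1K3; exact: fe0.
have Hchi : heat_form chi chit chi_ii = 0 by exact: weak_smooth_ge0 CHI _ cK3 K3Q chi0 _.
(* The test is fe + M chi: chi = 1 wherever fe can be nonzero and |fe| <= M, so the sum is
   nonnegative. Removing the identity for chi leaves the one for fe. *)
have Hfe : heat_form fe (convol ft rho) (fun i => convol (fii i) rho) = 0.
  have := weak_smooth_ge0 (C21_lin M Fe CHI) _ cK3 K3Q.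
  rewrite (heat_form_lin M Fe CHI cK3 K3Q fe0' chi0) Hchi mulr0 addr0; apply.
  - by move=> k; apply: CkD; [exact: Ck_mollified intf mrho|exact: CkZ].
  - by move=> z nK; rewrite fe0'// chi0// mulr0 addr0.
  - move=> z; have [K1z|nK1z] := pselect (K1 z); last first.
      by rewrite fe0// add0r mulr_ge0// ltW.
    by rewrite chi1// mulr1 -lerBlDr sub0r; have := feM z; rewrite ler_norml => /andP[].
have f0' z : ~ K1 z -> f z = 0 by move=> nK; apply: f0 => /K0K1.
(* The form vanishes at fe, so its value at f is its value at f - fe, of size at most dlt C <=
   eps. *)
have := heat_form_lin (-1) F Fe cK1 K1Q f0' fe0.
rewrite Hfe mulr0 addr0 => <-.
apply: le_trans (heat_form_le (C21_lin (-1) F Fe) cK1 K1Q _ (_ : forall z, _ <= dlt) _ _) _.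
- by move=> z nK; rewrite f0'// fe0// mulr0 addr0.
- by move=> z; rewrite mulN1r distrC; apply: (convol_close _ cK f0 mrho) => [|w we]; [by case: F|exact: uf].
- by move=> z; rewrite mulN1r distrC; apply: (convol_close _ cK ft0 mrho) => [|w we]; [by case: F|exact: uft].
- by move=> i z; rewrite mulN1r distrC; apply: (convol_close _ cK (fii0 i) mrho) => [|w we]; [exact: (C21_fii F)|exact: ufii].
rewrite -/C /dlt mulrAC ler_pdivrMr ?ltr_wpDl// ler_wpM2l ?ltW//.
by rewrite ltrDl.
Unshelve. all: by end_near. Qed.
End weak_C21.

(** * Cutting off in time: the mass identity *)

Section ramp.
Context {R : realType}.
Implicit Types s t : R.

(** t |t| is of class C^1 with derivative 2 |t|: the building block of a C^1 quadratic spline. *)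
Definition sqn t := t * `|t|.

Lemma is_derive_sqn t : is_derive t 1 sqn (2 * `|t|).
Proof.
have dsq : is_derive t 1 (fun s : R => s * s) (2 * t).
  by apply: is_derive_eq (is_deriveM (is_derive_id t 1) (is_derive_id t 1)) _; rewrite /GRing.scale/=; ring.
have [t0|t0|t0] := ltgtP t 0.
- apply: (is_derive_local (f := fun s => - (s * s))).
    near=> s; rewrite /sqn ltr0_norm ?mulrN//.
    by near: s; exact: lt_nbhsl.
  by rewrite (ltr0_norm t0) mulrN; exact: is_deriveN.
- apply: (is_derive_local (f := fun s => s * s)).
    near=> s; rewrite /sqn gtr0_norm//.
    by near: s; exact: lt_nbhsr.
  by rewrite (gtr0_norm t0).
- rewrite t0 normr0 mulr0.
  have L : (fun h : R => h^-1 *: ((sqn \o shift 0) (h *: 1) - sqn 0)) @ 0^' --> (0 : R).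
    apply/cvgr0Pnorm_le => e e0; near=> h => /=.
    have h0 : h != 0 by near: h; exact: nbhs_dnbhs_neq.
    rewrite /sqn mul0r subr0 addr0 [_ *: 1]mulr1 [_ *: _]mulKf// normr_id.
    by near: h; exact: dnbhs0_le.
  apply: DeriveDef; first by apply/cvg_ex; exists 0.
  exact/cvg_lim.
Unshelve. all: by end_near. Qed.

(* [ramp] is a piecewise quadratic C^1 transition from 0 on t <= 0 to 1 on
   t >= 1, enough for a cutoff in time since only one time derivative is
   taken. *)
Definition ramp t := 2^-1 + sqn t - 2 * sqn (t - 2^-1) + sqn (t - 1).
(** The tent of height 2 over [0, 1], zero elsewhere. *)
Definition ramp' t := 2 * `|t| - 4 * `|t - 2^-1| + 2 * `|t - 1|.

Lemma is_derive_ramp t : is_derive t 1 ramp (ramp' t).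
Proof.
have dsh c : is_derive t 1 (fun s => sqn (s - c)) (2 * `|t - c|).
  apply: (@is_derive_affine R R R (fun s => s - c) id sqn); last exact: is_derive_sqn.
  by move=> h; rewrite addrA.
apply: is_derive_eq (is_deriveD (is_deriveB (is_deriveD (is_derive_cst (2^-1 : R) t 1) (is_derive_sqn t))
   (is_deriveZ 2 (dsh 2^-1))) (dsh 1)) _.
by rewrite /ramp' /GRing.scale/=; ring.
Qed.

Lemma ramp0 t : t <= 0 -> ramp t = 0.
Proof.
move=> t0; rewrite /ramp /sqn !ler0_norm//; last by lra. by field. by lra.
Qed.

Lemma ramp1 t : 1 <= t -> ramp t = 1.
Proof.
move=> t0; rewrite /ramp /sqn !ger0_norm//; last by lra. by field. by lra. by lra.
Qed.

Lemma ramp_ge0_le1 t : 0 <= ramp t <= 1.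
Proof.
have [t0|t0] := leP t 0; first by rewrite ramp0// lexx ler01.
have [t1|t1] := leP 1 t; first by rewrite ramp1// lexx ler01.
rewrite /ramp /sqn (gtr0_norm t0) (ltr0_norm (_ : t - 1 < 0)); last by lra.
have [h|h] := leP t 2^-1; [rewrite ler0_norm; last by lra|rewrite gtr0_norm; last by lra]; apply/andP; split; nra.
Qed.

Lemma ramp'_ge0 t : 0 <= ramp' t.
Proof.
rewrite /ramp'.
have [t0|t0] := leP t 0; [rewrite (ler0_norm t0)|rewrite (gtr0_norm t0)];
have [t1|t1] := leP 1 t; [rewrite (ger0_norm (_ : 0 <= t - 1)); last by lra|rewrite (ltr0_norm (_ : t - 1 < 0)); last by lra
 |rewrite (ger0_norm (_ : 0 <= t - 1)); last by lra|rewrite (ltr0_norm (_ : t - 1 < 0)); last by lra];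
have [h|h] := leP t 2^-1; try (rewrite (ler0_norm (_ : t - 2^-1 <= 0)); last by lra); try (rewrite (gtr0_norm (_ : 0 < t - 2^-1)); last by lra); lra.
Qed.

Lemma ramp'_eq0 t : t <= 0 \/ 1 <= t -> ramp' t = 0.
Proof.
rewrite /ramp' => -[t0|t1].
  rewrite (ler0_norm t0) (ler0_norm (_ : t - 2^-1 <= 0)); last by lra.
  by rewrite (ler0_norm (_ : t - 1 <= 0)); lra.
by rewrite !ger0_norm; lra.
Qed.

Lemma continuous_ramp' : continuous ramp'.
Proof.
have c (a b : R) : continuous (fun t : R => a * `|t - b|).
  by move=> t; apply: cvgMr; apply: cvg_norm; apply: cvgB; [exact: cvg_id|exact: cvg_cst].
move=> t; apply: cvgD; [apply: cvgB|exact: c]; last exact: c.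
by apply: cvgMr; exact: norm_continuous.
Qed.

(** The transition from 0 to 1 takes place on [s, s + e]; its derivative [step'] is a tent of
    integral 1 there, approximating the Dirac mass at s from later times. *)
Definition step (s e : R) t := ramp ((t - s) / e).
Definition step' (s e : R) t := ramp' ((t - s) / e) / e.

Lemma is_derive_step s e t : is_derive t 1 (step s e) (step' s e t).
Proof.
apply: (@is_derive_affine R R R (fun t => (t - s) / e) (fun c => c / e) ramp).
  by move=> h; rewrite /GRing.scale/=; ring.
by rewrite mul1r /step' [ramp' _ * _]mulrC; apply: is_derive_dir; exact: is_derive_ramp.
Qed.

Lemma continuous_step s e : continuous (step s e).
Proof. by move=> t; apply/differentiable_continuous/derivable1_diffP; case: (is_derive_step s e t). Qed.

Lemma continuous_step' s e : continuous (step' s e).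
Proof.
move=> t; apply: cvgMl; apply: (@continuous_comp _ _ _ (fun t => (t - s) / e) ramp'); last exact: continuous_ramp'.
by apply: cvgMl; apply: cvgB; [exact: cvg_id|exact: cvg_cst].
Qed.

Lemma step0 s e t : 0 < e -> t <= s -> step s e t = 0.
Proof. by move=> e0 ts; rewrite /step ramp0// mulr_le0_ge0 ?subr_le0// invr_ge0 ltW. Qed.

Lemma step1 s e t : 0 < e -> s + e <= t -> step s e t = 1.
Proof. by move=> e0 ts; rewrite /step ramp1// ler_pdivlMr// mul1r lerBrDl. Qed.

Lemma step_ge0_le1 s e t : 0 <= step s e t <= 1. Proof. exact: ramp_ge0_le1. Qed.

Lemma step'_ge0 s e t : 0 < e -> 0 <= step' s e t.
Proof. by move=> e0; rewrite mulr_ge0 ?ramp'_ge0// invr_ge0 ltW. Qed.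

Lemma step'_eq0 s e t : 0 < e -> t <= s \/ s + e <= t -> step' s e t = 0.
Proof.
move=> e0 h; rewrite /step' ramp'_eq0 ?mul0r//; case: h => h; [left|right].
  by rewrite mulr_le0_ge0 ?subr_le0// invr_ge0 ltW.
by rewrite ler_pdivlMr// mul1r lerBrDl.
Qed.

Lemma integral_step' s e : 0 < e ->
  (\int[lebesgue_measure]_(t in `[s, (s + e)%R]) (step' s e t)%:E = 1)%E.
Proof.
move=> e0; have se : s < s + e by rewrite ltrDl.
rewrite (@continuous_FTC2 R _ (step s e))//.
- by rewrite step1// step0// sube0.
- by apply: continuous_subspaceT; exact: continuous_step'.
- split.
  + by move=> t _; case: (is_derive_step s e t).
  + by apply: cvg_at_right_filter; exact: continuous_step.
  + by apply: cvg_at_left_filter; exact: continuous_step.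
- by move=> t _; rewrite derive1E; case: (is_derive_step s e t).
Qed.
End ramp.

(** The inner integral is bounded by the inner integral of |f|, whose integral is finite by
    Tonelli. *)
Lemma integrable_fubini_G d1 d2 (T1 : measurableType d1) (T2 : measurableType d2) (R : realType)
    (m1 : {sigma_finite_measure set T1 -> \bar R}) (m2 : {sigma_finite_measure set T2 -> \bar R})
    (f : T1 * T2 -> \bar R) :
  (m1 \x m2)%E.-integrable setT f -> m2.-integrable setT (fubini_G m1 f).
Proof.
move=> fi; have [mf foo] := integrableP _ _ _ fi.
apply/integrableP; split; first exact: measurable_fubini_G fi.
have mabs : measurable_fun setT (abse \o f) by exact: measurableT_comp.
apply: le_lt_trans foo; rewrite (@fubini_tonelli2 _ _ _ _ _ m1 m2 (abse \o f))//; last first.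
  by move=> z; exact: abse_ge0.
apply: ge0_le_integral => //.
- by apply: measurableT_comp => //; exact: measurable_fubini_G fi.
- by apply: measurable_fun_fubini_tonelli_G => // z; exact: abse_ge0.
- move=> t _; apply: le_abse_integral => //.
  exact: (measurableT_comp mf (measurable_pair2 t)).
Qed.

Section patch_continuous.
Context {R : realType} {V : normedModType R}.
Implicit Types (f g h : V -> R) (K : set V).

Lemma near_continuous f g (z : V) : (\near z, f z = g z) -> {for z, continuous f} ->
  {for z, continuous g}.
Proof.
move=> fg cf; have h : g x @[x --> z] `=>` f x @[x --> z] by exact: near_eq_cvg.
have E : f z = g z := nbhs_singleton fg.
have : f x @[x --> z] --> g z by rewrite -E; exact: cf.
by move=> {}cf; exact: cvg_trans h cf.
Qed.

Section patch.
Variables (Q K : set V).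
Hypotheses (oQ : open Q) (cK : closed K) (KQ : K `<=` Q).

Let patch_near h z : Q z -> \near z, h z = (h \_ Q) z.
Proof.
move=> Qz; have : nbhs z Q by apply: open_nbhs_nbhs.
by apply: filterS => y Qy; rewrite patchE mem_set.
Qed.

Let patch_near0 h z : (forall z, Q z -> ~ K z -> h z = 0) -> ~ Q z -> \near z, 0 = (h \_ Q) z.
Proof.
move=> h0 nQz; have : nbhs z (~` K).
  by apply: open_nbhs_nbhs; split; [rewrite openC|move=> /KQ].
apply: filterS => y nKy; rewrite patchE; case: ifPn => // /set_mem Qy.
by rewrite h0.
Qed.

(** The open sets Q and the complement of K cover the space; the extension by zero is h on the first
    and 0 on the second. *)
Lemma patch_continuous h : (forall z, Q z -> {for z, continuous h}) ->
  (forall z, Q z -> ~ K z -> h z = 0) -> continuous (h \_ Q).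
Proof.
move=> ch h0 z; have [Qz|nQz] := pselect (Q z).
  by apply: near_continuous (patch_near h Qz) _; exact: ch.
by apply: near_continuous (patch_near0 h0 nQz) _; exact: cst_continuous.
Qed.

Lemma patch_is_derive h h' v : (forall z, Q z -> is_derive z v h (h' z)) ->
  (forall z, Q z -> ~ K z -> h z = 0) -> forall z, is_derive z v (h \_ Q) ((h' \_ Q) z).
Proof.
move=> dh h0 z; have [Qz|nQz] := pselect (Q z).
  by apply: is_derive_local (patch_near h Qz) _; rewrite patchE mem_set//; exact: dh.
apply: is_derive_local (patch_near0 h0 nQz) _.
by rewrite patchE memNset//; exact: is_derive_cst.
Qed.
End patch.
End patch_continuous.

(** * Tests reaching the initial time *)

Section admissible.
Context {R : realType} {N : nat}.
Local Notation space := 'rV[R]_N.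
Local Notation spacetime := ('rV[R]_N * R)%type.
Local Notation mu := (@lebesgue_xt R N).
Local Notation mxt := (@measurable _ (space * measurableTypeR R)%type).
Implicit Types (f g h W : spacetime -> R) (K : set spacetime).

Variables (Omega : set space) (T : \bar R).
Hypothesis oO : open Omega.
Local Notation Q := (cylinder Omega T).
Local Notation Q0 := (cylinder0 Omega T).
Let oQ : open Q. Proof. exact: open_cylinder. Qed.
Let mQ : mxt Q. Proof. by apply: open_measurable_mu. Qed.

(* Tests supported in Omega * [0, T) are only controlled in the open cylinder:
   nothing is asked of the derivatives at t = 0 except boundedness nearby. *)
Record admissible (K : set spacetime) (M : R) (g gt : spacetime -> R)
    (gi gii : 'I_N -> spacetime -> R) : Prop := MkAdmissible {
  adm_K : compact K;
  adm_KQ : K `<=` Q0;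
  adm_c : forall z, Q z -> {for z, continuous g};
  adm_ct : forall z, Q z -> {for z, continuous gt};
  adm_ci : forall i z, Q z -> {for z, continuous (gi i)};
  adm_cii : forall i z, Q z -> {for z, continuous (gii i)};
  adm_dt : forall z, Q z -> is_derive z ((0, 1) : spacetime) g (gt z);
  adm_dx : forall i z, Q z -> is_derive z ((delta_mx 0 i, 0) : spacetime) g (gi i z);
  adm_dxx : forall i z, Q z -> is_derive z ((delta_mx 0 i, 0) : spacetime) (gi i) (gii i z);
  adm_0 : forall z, Q z -> ~ K z -> g z = 0;
  adm_M : forall z, Q z -> `|g z| <= M;
  adm_Mt : forall z, Q z -> `|gt z| <= M;
  adm_Mii : forall i z, Q z -> `|gii i z| <= M }.

Lemma derive_off_open g v z d K : closed K -> (forall z, Q z -> ~ K z -> g z = 0) ->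
  Q z -> ~ K z -> is_derive z v g d -> d = 0.
Proof.
move=> cK g0 Qz nKz [_ <-]; rewrite -(@derive_cst R spacetime R 0 v z); apply: near_eq_derive.
have : nbhs z (Q `&` ~` K).
  by apply: open_nbhs_nbhs; split=> //; apply: openI => //; rewrite openC.
by apply: filterS => y [Qy nKy]; exact: g0.
Qed.

Lemma adm_supp K M g gt gi gii : admissible K M g gt gi gii ->
  [/\ forall z, Q z -> ~ K z -> gt z = 0, forall i z, Q z -> ~ K z -> gi i z = 0 &
      forall i z, Q z -> ~ K z -> gii i z = 0].
Proof.
move=> A; have cK := supp_closed (adm_K A).
have gi0 i z : Q z -> ~ K z -> gi i z = 0.
  by move=> Qz nKz; exact: (derive_off_open cK (adm_0 A) Qz nKz (adm_dx A i Qz)).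
split => //; first by move=> z Qz nKz; exact: (derive_off_open cK (adm_0 A) Qz nKz (adm_dt A Qz)).
by move=> i z Qz nKz; exact: (derive_off_open cK (gi0 i) Qz nKz (adm_dxx A i Qz)).
Qed.

(** For s > 0 this turns a compact subset of Omega x [0, T) into a compact subset of the open
    cylinder, where U and Phi are integrable. *)
Definition late K (s : R) : set spacetime := K `&` [set z | s <= z.2].

Lemma late_compact K s : compact K -> compact (late K s).
Proof.
move=> cK; apply: compact_closedI => //.
apply: (@preimage_closed _ _ (fun z : spacetime => z.2) [set x : R | s <= x]); last exact: closed_ge.
by move=> z _; exact: cvg_snd.
Qed.

Lemma late_sub K s : K `<=` Q0 -> 0 < s -> late K s `<=` Q.
Proof. by move=> KQ s0 z [/KQ[Oz [_ zT]] sz]; split => //; split => //; exact: lt_le_trans sz. Qed.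

Lemma continuous_in_measurable h (D : set spacetime) : D `<=` Q -> mxt D ->
  (forall z, Q z -> {for z, continuous h}) -> measurable_fun (D : set (space * measurableTypeR R)%type) h.
Proof.
move=> DQ mD ch; apply: (@measurable_funS _ _ _ _ Q) => //.
apply: continuous_measurable_xt; first exact: open_measurable_xt.
by rewrite continuous_open_subspace// => z /set_mem; exact: ch.
Qed.

Lemma continuous_snd_comp (c : R -> R) : continuous c -> continuous (fun z : spacetime => c z.2).
Proof. by move=> cc z; apply: (@continuous_comp _ _ _ snd c); [exact: cvg_snd|exact: cc]. Qed.

(** The factor [step s e] vanishes for t <= s, so the product is supported in [late K s], compact in
    the open cylinder, and extends by zero to all of space-time. Space derivatives treat the factor
    as a constant. *)
Lemma C21_cut K M g gt gi gii s e : admissible K M g gt gi gii -> 0 < s -> 0 < e ->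
  C21 ((fun z => g z * step s e z.2) \_ Q)
    ((fun z => gt z * step s e z.2 + g z * step' s e z.2) \_ Q)
    (fun i => (fun z => gi i z * step s e z.2) \_ Q)
    (fun i => (fun z => gii i z * step s e z.2) \_ Q).
Proof.
move=> A s0 e0; have [gt0 gi0 gii0] := adm_supp A.
have cK := adm_K A.
have cKs := supp_closed (@late_compact K s cK).
have KsQ := late_sub (adm_KQ A) s0.
have off h : (forall z, Q z -> ~ K z -> h z = 0) ->
    forall z, Q z -> ~ late K s z -> h z * step s e z.2 = 0.
  move=> h0 z Qz /not_andP[nK|/negP]; first by rewrite h0// mul0r.
  by rewrite -ltNge => /ltW zs; rewrite step0// mulr0.
have off' h : (forall z, Q z -> ~ K z -> h z = 0) ->
    forall z, Q z -> ~ late K s z -> h z * step' s e z.2 = 0.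
  move=> h0 z Qz /not_andP[nK|/negP]; first by rewrite h0// mul0r.
  by rewrite -ltNge => /ltW zs; rewrite step'_eq0// ?mulr0//; left.
have cs h : (forall z, Q z -> {for z, continuous h}) ->
    forall z, Q z -> {for z, continuous (fun z => h z * step s e z.2)}.
  by move=> ch z Qz; apply: cvgM; [exact: ch|apply: continuous_snd_comp; exact: continuous_step].
have cs' h : (forall z, Q z -> {for z, continuous h}) ->
    forall z, Q z -> {for z, continuous (fun z => h z * step' s e z.2)}.
  by move=> ch z Qz; apply: cvgM; [exact: ch|apply: continuous_snd_comp; exact: continuous_step'].
have dstep (z : spacetime) (v : spacetime) : is_derive z v (fun z : spacetime => step s e z.2) (v.2 * step' s e z.2).
  apply: (@is_derive_affine R spacetime R snd snd (step s e)) => //.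
  by apply: is_derive_dir; exact: is_derive_step.
have dx h h' i : (forall z, Q z -> is_derive z ((delta_mx 0 i, 0) : spacetime) h (h' z)) ->
   forall z, Q z -> is_derive z ((delta_mx 0 i, 0) : spacetime) (fun z => h z * step s e z.2) (h' z * step s e z.2).
  move=> dh z Qz; apply: is_derive_eq (is_deriveM (dh z Qz) (dstep z _)) _.
  by rewrite /GRing.scale/= mul0r mulr0 add0r mulrC.
have ci i z : Q z -> {for z, continuous (gi i)} by case: A => *; auto.
have cii i z : Q z -> {for z, continuous (gii i)} by case: A => *; auto.
split.
- exact: (patch_continuous oQ cKs KsQ (cs _ (adm_c A)) (off _ (adm_0 A))).
- have c1 z : Q z -> {for z, continuous (fun z => gt z * step s e z.2 + g z * step' s e z.2)}.
    by move=> Qz; apply: cvgD; [exact: (cs _ (adm_ct A))|exact: (cs' _ (adm_c A))].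
  apply: (patch_continuous oQ cKs KsQ c1) => z Qz nK.
  by rewrite (off _ gt0)// (off' _ (adm_0 A))// addr0.
- by move=> i; exact: (patch_continuous oQ cKs KsQ (cs _ (ci i)) (off _ (gi0 i))).
- by move=> i; exact: (patch_continuous oQ cKs KsQ (cs _ (cii i)) (off _ (gii0 i))).
- have d1 z : Q z -> is_derive z ((0, 1) : spacetime) (fun z => g z * step s e z.2)
      (gt z * step s e z.2 + g z * step' s e z.2).
    move=> Qz; apply: is_derive_eq (is_deriveM (adm_dt A Qz) (dstep z _)) _.
    by rewrite /GRing.scale/= mul1r addrC [step _ _ _ * _]mulrC.
  exact: (patch_is_derive oQ cKs KsQ d1 (off _ (adm_0 A))).
- by move=> i; exact: (patch_is_derive oQ cKs KsQ (dx _ _ i (adm_dx A i)) (off _ (adm_0 A))).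
- by move=> i; exact: (patch_is_derive oQ cKs KsQ (dx _ _ i (adm_dxx A i)) (off _ (gi0 i))).
Qed.

Variables (U Phi : spacetime -> R).
Hypotheses (LU : L1loc_xt Q U) (LPhi : L1loc_xt Q Phi).
Hypothesis weakU : forall phi, test_function Q phi -> (forall z, Q z -> 0 <= phi z) ->
  heat_integral Omega T U Phi phi = 0%E.
Hypothesis CU : C_L1loc Omega T U.

Definition mass g (t : R) : R := \int[lebesgue_x]_(x in Omega) (U (x, t) * g (x, t)).

Definition heat_density g gt (gii : 'I_N -> spacetime -> R) (z : spacetime) : R :=
  U z * gt z + U z * (\sum_i gii i z) + Phi z * g z.

Lemma late_integrable W h K (M s : R) : L1loc_xt Q W -> compact K -> K `<=` Q0 -> 0 < s ->
  (forall z, Q z -> {for z, continuous h}) -> (forall z, Q z -> `|h z| <= M) ->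
  (forall z, Q z -> ~ late K s z -> h z = 0) ->
  mu.-integrable Q (EFin \o (fun z => W z * h z)).
Proof.
move=> LW cK KQ s0 ch hM h0.
have KsQ := late_sub KQ s0; have cKs := @late_compact K s cK.
apply: (@integrable_supported_mul _ (space * measurableTypeR R)%type R mu (late K s) Q _ mQ KsQ W h M) => //.
- exact: compact_measurable_mu.
- by case: LW => _; exact.
- by apply: continuous_in_measurable => //; exact: compact_measurable_mu.
- by move=> z /KsQ; exact: hM.
Qed.

Lemma heat_density_integrable K M g gt gi gii s : admissible K M g gt gi gii -> 0 < s ->
  mu.-integrable (Q `&` [set z | s < z.2]) (EFin \o (heat_density g gt gii)).
Proof.
move=> A s0; have [gt0 gi0 gii0] := adm_supp A.
have cK := adm_K A; have cKs := @late_compact K s cK; have KsQ := late_sub (adm_KQ A) s0.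
have mD : mxt (Q `&` [set z | s < z.2]).
  apply: open_measurable_mu; apply: openI => //.
  apply: (@open_comp _ _ (fun z : spacetime => z.2) [set x : R | s < x]); last exact: open_gt.
  by move=> z _; exact: cvg_snd.
have DQ : Q `&` [set z | s < z.2] `<=` Q by move=> z [].
have KD : late K s `&` (Q `&` [set z | s < z.2]) `<=` Q `&` [set z | s < z.2] by move=> z [].
have mKD : mxt (late K s `&` (Q `&` [set z | s < z.2])).
  by apply: measurableI => //; exact: compact_measurable_mu.
have I W h M' : L1loc_xt Q W -> (forall z, Q z -> {for z, continuous h}) ->
    (forall z, Q z -> `|h z| <= M') -> (forall z, Q z -> ~ K z -> h z = 0) ->
    mu.-integrable (Q `&` [set z | s < z.2]) (EFin \o (fun z => W z * h z)).
  move=> LW ch hM h0.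
  apply: (@integrable_supported_mul _ (space * measurableTypeR R)%type R mu _ _ mKD mD KD W h M').
  - apply: (@integrableS _ _ _ mu (late K s)) => //; first exact: compact_measurable_mu.
    by case: LW => _; exact.
  - by apply: continuous_in_measurable => // z [_ []].
  - by move=> z [_ [Qz _]]; exact: hM.
  - move=> z [Qz sz] nK; apply: h0 => // Kz; apply: nK; split => //; split => //; exact: ltW.
have i1 := I _ _ _ LU (adm_ct A) (adm_Mt A) gt0.
have i2 : mu.-integrable (Q `&` [set z | s < z.2]) (EFin \o (fun z => U z * \sum_i gii i z)).
  apply: (I _ _ (M *+ N) LU).
  - move=> z Qz; rewrite unlock; elim: (index_enum _) => [|i l IH] /=; first exact: cst_continuous.
    by apply: cvgD; [exact: (adm_cii A)|exact: IH].
  - move=> z Qz; apply: le_trans (ler_norm_sum _ _ _) _.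
    by apply: le_trans (ler_sum _ (fun i _ => adm_Mii A i Qz)) _; rewrite sumr_const card_ord.
  - by move=> z Qz nK; rewrite big1// => i _; exact: gii0.
have i3 := I _ _ _ LPhi (adm_c A) (adm_M A) (adm_0 A).
by have := integrableD mD (integrableD mD i1 i2) i3; apply: eq_integrable.
Qed.

Lemma step'_bounded (s e : R) : 0 < e -> exists2 M, 0 < M & forall t, `|step' s e t| <= M.
Proof.
move=> e0; apply: (@supp_bounded R R (step' s e) `[s, s + e]%classic).
- exact: continuous_step'.
- exact: segment_compact.
- move=> t; rewrite /= in_itv/= => /negP; rewrite negb_and -!ltNge => /orP[h|h]; rewrite step'_eq0//; [left|right]; exact: ltW.
Qed.

(** The weak formulation tested with g times [step s e]: the product rule in time yields a single
    extra term U g step', concentrated on s < t < s + e. *)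
Lemma cut_identity K M g gt gi gii s e : admissible K M g gt gi gii -> 0 < s -> 0 < e ->
  \int[mu]_(z in Q) (U z * (g z * step' s e z.2)) +
  \int[mu]_(z in Q) (heat_density g gt gii z * step s e z.2) = 0.
Proof.
move=> A s0 e0; have [gt0 gi0 gii0] := adm_supp A.
have cK := adm_K A; have cKs := @late_compact K s cK; have KsQ := late_sub (adm_KQ A) s0.
have off h : (forall z, Q z -> ~ K z -> h z = 0) ->
    forall z, Q z -> ~ late K s z -> h z * step s e z.2 = 0.
  move=> h0 z Qz /not_andP[nK|/negP]; first by rewrite h0// mul0r.
  by rewrite -ltNge => /ltW zs; rewrite step0// mulr0.
have off' h : (forall z, Q z -> ~ K z -> h z = 0) ->
    forall z, Q z -> ~ late K s z -> h z * step' s e z.2 = 0.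
  move=> h0 z Qz /not_andP[nK|/negP]; first by rewrite h0// mul0r.
  by rewrite -ltNge => /ltW zs; rewrite step'_eq0// ?mulr0//; left.
have I W h M' : L1loc_xt Q W -> (forall z, Q z -> {for z, continuous h}) ->
    (forall z, Q z -> `|h z| <= M') -> (forall z, Q z -> ~ K z -> h z = 0) ->
    mu.-integrable Q (EFin \o (fun z => W z * (h z * step s e z.2))).
  move=> LW ch hM h0.
  apply: (@late_integrable W (fun z => h z * step s e z.2) K M' s LW cK (adm_KQ A) s0).
  - by move=> z Qz; apply: cvgM; [exact: ch|apply: continuous_snd_comp; exact: continuous_step].
  - move=> z Qz; rewrite normrM; have /andP[st0 st1] := step_ge0_le1 s e z.2.
    by rewrite (ger0_norm st0) -[leRHS]mulr1; apply: ler_pM => //; exact: hM.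
  - exact: off.
have i1 := I _ _ _ LU (adm_ct A) (adm_Mt A) gt0.
have i2 : mu.-integrable Q (EFin \o (fun z => U z * ((\sum_i gii i z) * step s e z.2))).
  apply: (I _ _ (M *+ N) LU).
  - move=> z Qz; rewrite unlock; elim: (index_enum _) => [|i l IH] /=; first exact: cst_continuous.
    by apply: cvgD; [exact: (adm_cii A)|exact: IH].
  - move=> z Qz; apply: le_trans (ler_norm_sum _ _ _) _.
    by apply: le_trans (ler_sum _ (fun i _ => adm_Mii A i Qz)) _; rewrite sumr_const card_ord.
  - by move=> z Qz nK; rewrite big1// => i _; exact: gii0.
have i3 := I _ _ _ LPhi (adm_c A) (adm_M A) (adm_0 A).
have [M' M'0 stM] := step'_bounded s e0.
have i4 : mu.-integrable Q (EFin \o (fun z => U z * (g z * step' s e z.2))).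
  apply: (@late_integrable U (fun z => g z * step' s e z.2) K (M * M') s LU cK (adm_KQ A) s0).
  - by move=> z Qz; apply: cvgM; [exact: (adm_c A)|apply: continuous_snd_comp; exact: continuous_step'].
  - by move=> z Qz; rewrite normrM; apply: ler_pM => //; exact: (adm_M A).
  - by apply: off'; exact: (adm_0 A).
have g0 z : ~ late K s z -> ((fun z => g z * step s e z.2) \_ Q) z = 0.
  move=> nK; rewrite patchE; case: ifPn => // /set_mem Qz; apply: off => //; exact: (adm_0 A).
have := weak_C21 oO LU LPhi weakU (C21_cut A s0 e0) cKs KsQ g0.
have P W h : pairing Omega T W (h \_ Q) = \int[mu]_(z in Q) (W z * h z).
  by apply: eq_Rintegral => z Qz; rewrite patchE Qz.
rewrite /heat_form !P.
have -> : pairing Omega T U (fun z => \sum_i ((fun z => gii i z * step s e z.2) \_ Q) z) =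
    \int[mu]_(z in Q) (U z * ((\sum_i gii i z) * step s e z.2)).
  apply: eq_Rintegral => z Qz; rewrite mulr_suml; congr (_ * _).
  by apply: eq_bigr => i _; rewrite patchE Qz.
move=> <-.
have -> : \int[mu]_(z in Q) (U z * (gt z * step s e z.2 + g z * step' s e z.2)) =
    \int[mu]_(z in Q) (U z * (gt z * step s e z.2)) + \int[mu]_(z in Q) (U z * (g z * step' s e z.2)).
  by rewrite -(RintegralD mQ)//; apply: eq_Rintegral => z _; rewrite mulrDr.
have -> : \int[mu]_(z in Q) (heat_density g gt gii z * step s e z.2) =
    \int[mu]_(z in Q) (U z * (gt z * step s e z.2)) +
    \int[mu]_(z in Q) (U z * ((\sum_i gii i z) * step s e z.2)) +
    \int[mu]_(z in Q) (Phi z * (g z * step s e z.2)).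
  rewrite -(RintegralD mQ)// -(RintegralD mQ)//; last first.
    by have := integrableD mQ i1 i2; apply: eq_integrable.
  by apply: eq_Rintegral => z _; rewrite /heat_density; ring.
by ring.
Qed.

Lemma slice_continuous h (t : R) : oo_time T t -> (forall z, Q z -> {for z, continuous h}) ->
  forall x, Omega x -> {for x, continuous (fun x => h (x, t))}.
Proof.
move=> Tt ch x Ox; have Qz : Q (x, t) by [].
apply: (@continuous_comp _ _ _ (fun x : space => (x, t)) h); last exact: ch.
move=> P [[A B] /= [nA nB] AB]; have : nbhs x A by [].
by apply: filterS => y Ay; apply: AB; split => //=; exact: nbhs_singleton.
Qed.

Lemma slice_measurable h (t : R) (D : set space) : oo_time T t -> measurable D -> D `<=` Omega ->
  (forall z, Q z -> {for z, continuous h}) -> measurable_fun D (fun x => h (x, t)).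
Proof.
move=> Tt mD DO ch; apply: (@measurable_funS _ _ _ _ Omega) => //; first exact: open_measurable_rV.
apply: continuous_measurable_rV; first exact: open_measurable_rV.
by rewrite continuous_open_subspace// => x /set_mem; exact: slice_continuous.
Qed.

Section slices.
Variables (K : set spacetime) (h : spacetime -> R) (t M : R) (W : space -> R).
Hypotheses (cK : compact K) (KQ : K `<=` Q0) (Tt : oo_time T t).
Hypotheses (ch : forall z, Q z -> {for z, continuous h}).
Hypotheses (h0 : forall z, Q z -> ~ K z -> h z = 0) (hM : forall z, Q z -> `|h z| <= M).
Hypothesis LW : L1loc_x Omega W.

Lemma shadow_compact : compact (fst @` K : set space).
Proof.
by apply: continuous_compact => //; apply: continuous_subspaceT => z; exact: cvg_fst.
Qed.

Lemma shadow_sub : fst @` K `<=` Omega.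
Proof. by move=> _ [z /KQ[Oz _] <-]. Qed.

(** Every slice of h vanishes off the projection of K to space, its shadow, a compact subset of
    Omega on which W is integrable. *)
Lemma slice_integrable : lebesgue_x.-integrable Omega (EFin \o (fun x => W x * h (x, t))).
Proof.
have mO := open_measurable_rV oO.
have mKx := compact_measurable_rV shadow_compact.
apply: (@integrable_supported_mul _ space R lebesgue_x (fst @` K) Omega mKx mO shadow_sub W _ M).
- by case: LW => _ LW2; apply: LW2; [exact: shadow_compact|exact: shadow_sub].
- by apply: slice_measurable => //; exact: shadow_sub.
- by move=> x /shadow_sub Ox; exact: hM.
- by move=> x Ox nK; apply: h0 => // Kz; apply: nK; exists (x, t).
Qed.

Lemma slice_le : `|\int[lebesgue_x]_(x in Omega) (W x * h (x, t))| <=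
  M * \int[lebesgue_x]_(x in fst @` K) `|W x|.
Proof.
have mO := open_measurable_rV oO.
have mKx := compact_measurable_rV shadow_compact.
apply: (@Rintegral_supported_mul_le _ space R lebesgue_x (fst @` K) Omega mKx shadow_sub W _ M).
- by case: LW => _ LW2; apply: LW2; [exact: shadow_compact|exact: shadow_sub].
- by apply: slice_measurable => //; exact: shadow_sub.
- by move=> x /shadow_sub Ox; exact: hM.
- by move=> x Ox nK; apply: h0 => // Kz; apply: nK; exists (x, t).
Qed.
End slices.

(** Two moduli combine: t |-> U(t) is continuous in L^1 of the shadow of K, and g(., t) tends to
    g(., s) uniformly on that shadow by compactness. *)
Lemma mass_continuous K M g gt gi gii s : admissible K M g gt gi gii -> oo_time T s ->
  {for s, continuous (mass g)}.
Proof.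
move=> A Ts.
have cK := adm_K A; have KQ := adm_KQ A.
have cKx := shadow_compact cK; have KxO := shadow_sub KQ.
have mO := open_measurable_rV oO.
have mKx := compact_measurable_rV cKx.
have LUt t : oo_time T t -> L1loc_x Omega (fun x => U (x, t)) by case: CU => + _; exact.
have nbhsT : \forall t \near s, oo_time T t.
  by apply: open_nbhs_nbhs; split => //; exact: open_oo_time.
apply/cvgrPdist_lt => eps eps0.
set B := \int[lebesgue_x]_(x in fst @` K) `|U (x, s)|.
have B0 : 0 <= B by exact: Rintegral_ge0.
pose M1 := `|M| + 1.
have M10 : 0 < M1 by rewrite ltr_wpDl.
pose dlt := eps / 2 / (B + 1).
have dlt0 : 0 < dlt by rewrite !divr_gt0// ltr_wpDl.
pose eta := eps / 2 / M1.
have eta0 : 0 < eta by rewrite !divr_gt0.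
have Uclose : \forall t \near s, \int[lebesgue_x]_(x in fst @` K) `|U (x, t) - U (x, s)| < eta.
  case: CU => _ /(_ _ cKx KxO s Ts) /fine_cvgP[_ /cvgrPdist_lt/(_ eta eta0)].
  by apply: filterS => t; rewrite sub0r normrN; apply: le_lt_trans; exact: ler_norm.
have gclose : \forall t \near s, fst @` K `<=` [set x | `|g (x, s) - g (x, t)| < dlt].
  pose P (t : R) (x : space) := `|g (x, s) - g (x, t)| < dlt.
  apply: (proj1 (compact_near_coveringP (fst @` K)) cKx R (nbhs s) P) => x /KxO Ox.
  have Qxs : Q (x, s) by [].
  have cg := adm_c A Qxs.
  have cgs := slice_continuous Ts (adm_c A) Ox.
  have c1 : (fun p : space * R => g (p.1, s) - g (p.1, p.2)) @ (x, s) --> g (x, s) - g (x, s).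
    apply: cvgB.
      by apply: (@cvg_comp _ _ _ fst (fun x => g (x, s)) (nbhs (x, s)) (nbhs x)); [exact: cvg_fst|exact: cgs].
    by rewrite [X in X @ _ --> _](_ : _ = g); [exact: cg|apply/funext => -[]].
  move/cvgrPdist_lt : c1 => /(_ dlt dlt0); rewrite subrr; apply: filterS => -[y t] /=.
  by rewrite sub0r normrN.
near=> t.
have Tt : oo_time T t by near: t.
have LUs := LUt _ Ts; have LUT := LUt _ Tt.
have LD : L1loc_x Omega (fun x => U (x, s) - U (x, t)).
  split; first by apply: measurable_funB; [case: LUs|case: LUT].
  move=> C cC CO; have := integrableB (compact_measurable_rV cC) (LUs.2 _ cC CO) (LUT.2 _ cC CO).
  by apply: eq_integrable => //; exact: compact_measurable_rV.
have g0 := adm_0 A.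
have iss := slice_integrable cK KQ Ts (adm_c A) g0 (adm_M A) LUs.
have ist := slice_integrable cK KQ Tt (adm_c A) g0 (adm_M A) LUs.
have itt := slice_integrable cK KQ Tt (adm_c A) g0 (adm_M A) LUT.
have idt := slice_integrable cK KQ Tt (adm_c A) g0 (adm_M A) LD.
have -> : mass g s - mass g t =
    \int[lebesgue_x]_(x in Omega) (U (x, s) * (g (x, s) - g (x, t))) +
    \int[lebesgue_x]_(x in Omega) ((U (x, s) - U (x, t)) * g (x, t)).
  rewrite /mass -(RintegralB mO)// -(RintegralD mO)//; last first.
    by have := integrableB mO iss ist; apply: eq_integrable => // x _; rewrite /= -EFinB mulrBr.
  by apply: eq_Rintegral => x _; ring.
rewrite [ltRHS]splitr; apply: le_lt_trans (ler_normD _ _) _; apply: ltrD.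
  apply: (@le_lt_trans _ _ (dlt * B)).
    apply: (@Rintegral_supported_mul_le _ space R lebesgue_x (fst @` K) Omega mKx KxO (fun x => U (x, s))
       (fun x => g (x, s) - g (x, t)) dlt).
    - exact: LUs.2.
    - by apply: measurable_funB; exact: slice_measurable KxO (adm_c A).
    - by move=> x Kx; apply: ltW; move: x Kx; near: t.
    - by move=> x Ox nK; rewrite !g0// ?subrr// => Kz; apply: nK; eexists; by [exact: Kz|].
  rewrite /dlt mulrAC ltr_pdivrMr ?ltr_wpDl// ltr_pM2l ?divr_gt0//.
  by rewrite ltrDl.
apply: le_lt_trans (slice_le cK KQ Tt (adm_c A) g0 _ LD) _.
  by move=> z Qz; apply: le_trans (adm_M A Qz) (_ : _ <= M1); rewrite (le_trans (ler_norm _))// lerDl.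
rewrite mulrC -ltr_pdivlMr// -/eta.
under eq_Rintegral do rewrite distrC.
by near: t.
Unshelve. all: by end_near. Qed.

(** Fubini turns the extra term of [cut_identity] into an average of masses with weight [step']. *)
Lemma mass_fubini K M g gt gi gii s e : admissible K M g gt gi gii -> 0 < s -> 0 < e -> oo_time T (s + e) ->
  lebesgue_measure.-integrable setT (EFin \o (fun t => mass g t * step' s e t)) /\
  \int[mu]_(z in Q) (U z * (g z * step' s e z.2)) =
  \int[lebesgue_measure]_t (mass g t * step' s e t).
Proof.
move=> A s0 e0 Tse.
have cK := adm_K A; have KQ := adm_KQ A.
have mO := open_measurable_rV oO.
have LUt t : oo_time T t -> L1loc_x Omega (fun x => U (x, t)) by case: CU => + _; exact.
have [M' M'0 stM] := step'_bounded s e0.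
pose F z := U z * (g z * step' s e z.2).
have Fi : mu.-integrable Q (EFin \o F).
  apply: (@late_integrable U (fun z => g z * step' s e z.2) K (M * M') s LU cK KQ s0).
  - by move=> z Qz; apply: cvgM; [exact: (adm_c A)|apply: continuous_snd_comp; exact: continuous_step'].
  - by move=> z Qz; rewrite normrM; apply: ler_pM => //; exact: (adm_M A).
  - move=> z Qz /not_andP[nK|/negP]; first by rewrite (adm_0 A)// mul0r.
    by rewrite -ltNge => /ltW zs; rewrite step'_eq0// ?mulr0//; left.
have FQi := proj1 (integrable_mkcond _ mQ) Fi.
have G t : fubini_G (lebesgue_rV N) ((EFin \o F) \_ Q) t = (mass g t * step' s e t)%:E.
  rewrite /fubini_G; have [Tt|nTt] := pselect (oo_time T t); last first.
    (* At times outside ]0, T[ the weight vanishes, because [s, s + e] lies in ]0, T[. *)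
    have -> : step' s e t = 0.
      apply: step'_eq0 => //; apply/orP; rewrite -[_ || _]negbK negb_or -!ltNge; apply/negP => /andP[st tse].
      apply: nTt; split; first exact: lt_trans st.
      by case: Tse => _; apply: lt_trans; rewrite lte_fin.
    rewrite mulr0 integral0_eq// => x _; rewrite patchE memNset// => -[_].
    exact: nTt.
  rewrite [LHS](_ : _ = (\int[lebesgue_x]_(x in Omega) ((U (x, t) * g (x, t))%:E * (step' s e t)%:E))%E); last first.
    rewrite [RHS]integral_mkcond; apply: eq_integral => x _; rewrite !patchE.
    have [Ox|nOx] := pselect (Omega x).
      by rewrite !mem_set//= /F /= -EFinM mulrA.
    by rewrite !memNset// => -[].
  have i1 := slice_integrable cK KQ Tt (adm_c A) (adm_0 A) (adm_M A) (LUt _ Tt).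
  rewrite integralZr// [RHS]EFinM; congr (_ * _)%E.
  by rewrite /mass /Rintegral fineK//; exact: integrable_fin_num.
have GE : fubini_G (lebesgue_rV N) ((EFin \o F) \_ Q) = EFin \o (fun t => mass g t * step' s e t).
  by apply/funext.
split; first by rewrite -GE; exact: integrable_fubini_G.
have := @integral21_prod_meas1 _ _ _ _ R (lebesgue_rV N) (@lebesgue_measure R) _ FQi.
move=> H; rewrite /Rintegral.
transitivity (fine (\int[lebesgue_measure]_t fubini_G (lebesgue_rV N) ((EFin \o F) \_ Q) t)%E).
  by rewrite H; congr fine; rewrite [LHS]integral_mkcond.
by congr fine; apply: eq_integral => t _; exact: G.
Qed.

(** The limit e -> 0 of [cut_identity]: weighted averages of the continuous function [mass g] over
    [s, s + e] tend to its value at s, and the steps tend to the indicator of {t > s}, dominated by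
    |heat_density|. *)
Theorem mass_identity K M g gt gi gii s : admissible K M g gt gi gii -> oo_time T s ->
  mass g s + \int[mu]_(z in Q `&` [set z | s < z.2]) heat_density g gt gii z = 0.
Proof.
move=> A Ts; have s0 : 0 < s by case: Ts.
have mD : mxt (Q `&` [set z | s < z.2]).
  apply: open_measurable_mu; apply: openI => //.
  apply: (@open_comp _ _ (fun z : spacetime => z.2) [set x : R | s < x]); last exact: open_gt.
  by move=> z _; exact: cvg_snd.
set D := Q `&` _ in mD *.
have Hi : mu.-integrable D (EFin \o heat_density g gt gii) := heat_density_integrable A s0.
(* Openness of ]0, T[ leaves room after s for the transition of the step. *)
have [c c0 hc] : exists2 c : R, 0 < c & forall e, e <= c -> 0 < e -> oo_time T (s + e).
  have : nbhs s (oo_time T) by apply: open_nbhs_nbhs; split => //; exact: open_oo_time.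
  move=> /nbhs_ballP[c /= c0 sc]; exists (c / 2); first by rewrite divr_gt0.
  move=> e ec e0; apply: sc; rewrite /ball/= opprD addrA subrr sub0r normrN gtr0_norm//.
  by apply: le_lt_trans ec _; rewrite ltr_pdivrMr// ltr_pMr// ltr1n.
pose e (n : nat) := c / n.+1%:R.
have e0 n : 0 < e n by rewrite divr_gt0.
have Te n : oo_time T (s + e n).
  by apply: hc => //; rewrite ler_pdivrMr// ler_pMr// ler1n.
have e_cvg : e n @[n --> \oo] --> 0.
  rewrite /e -(mulr0 c); apply: cvgMr; exact: cvg_harmonic.
pose a n := \int[mu]_(z in Q) (U z * (g z * step' s (e n) z.2)).
pose b n := \int[mu]_(z in Q) (heat_density g gt gii z * step s (e n) z.2).
have ab n : a n + b n = 0 by exact: cut_identity A s0 (e0 n).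
have a_cvg : a n @[n --> \oo] --> mass g s.
  apply/cvgrPdist_le => eps eps0.
  have /cvgrPdist_lt/(_ eps eps0)/nbhs_ballP[d /= d0 hd] := mass_continuous A Ts.
  near=> n.
  have [ai aE] := mass_fubini A s0 (e0 n) (Te n).
  have st1 : (\int[lebesgue_measure]_t (step' s (e n) t)%:E = 1)%E.
    rewrite -(integral_step' s (e0 n)) [RHS]integral_mkcond; apply: eq_integral => t _.
    rewrite patchE; case: ifPn => // /negP; rewrite inE /= in_itv/= => /negP.
    rewrite negb_and -!ltNge => /orP[h|h]; rewrite step'_eq0//; [left|right]; exact: ltW.
  have sti : lebesgue_measure.-integrable setT (EFin \o step' s (e n)).
    apply/integrableP; split.
      by apply/measurable_EFinP; apply: continuous_measurable_fun; exact: continuous_step'.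
    under eq_integral do rewrite /= ger0_norm ?step'_ge0//.
    by rewrite st1 ltry.
  have st1' : \int[lebesgue_measure]_t step' s (e n) t = 1 by rewrite /Rintegral st1.
  rewrite /a aE -[X in X - _]mulr1 -st1' -(RintegralZl _ measurableT)// -(RintegralB measurableT)//; last first.
    by have := integrableZl measurableT (mass g s) sti; apply: eq_integrable.
  have di : lebesgue_measure.-integrable setT (EFin \o (fun t => mass g s * step' s (e n) t - mass g t * step' s (e n) t)).
    by have := integrableB measurableT (integrableZl measurableT (mass g s) sti) ai; apply: eq_integrable.
  apply: le_trans (le_normr_Rintegral measurableT di) _.
  rewrite -[leRHS]mulr1 -st1' -(RintegralZl _ measurableT)//.
  apply: le_Rintegral => //.
  - exact: integrable_norm di.
  - by have := integrableZl measurableT eps sti; apply: eq_integrable.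
  move=> t _; rewrite -mulrBl normrM (ger0_norm (step'_ge0 _ _ (e0 n))).
  have [/andP[st tse]|] := boolP ((s < t) && (t < s + e n)); last first.
    rewrite negb_and -!leNgt => /orP h; rewrite step'_eq0// ?mulr0//.
  rewrite ler_wpM2r ?step'_ge0// ltW// hd// /ball/= distrC gtr0_norm ?subr_gt0//.
  rewrite ltrBlDl; apply: lt_trans tse _; rewrite ltrD2l.
  near: n; have /cvgrPdist_lt/(_ d d0) := e_cvg; apply: filterS => n.
  by rewrite sub0r normrN gtr0_norm.
have b_cvg : b n @[n --> \oo] --> \int[mu]_(z in D) heat_density g gt gii z.
  have bE n : b n = \int[mu]_(z in D) (heat_density g gt gii z * step s (e n) z.2).
    rewrite /b /D [RHS]Rintegral_mkcondr; apply: eq_Rintegral => z Qz; rewrite patchE.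
    case: ifPn => // /negP; rewrite inE /= => /negP; rewrite -leNgt => zs.
    by rewrite step0// mulr0.
  have [] := @dominated_convergence _ _ _ mu D mD
     (fun n => EFin \o (fun z => heat_density g gt gii z * step s (e n) z.2))
     (EFin \o heat_density g gt gii) (EFin \o (fun z => `|heat_density g gt gii z|)).
  - move=> n; apply/measurable_EFinP; apply: measurable_funM.
      by apply/measurable_EFinP; exact: measurable_int Hi.
    apply: measurable_funTS; apply: continuous_measurable_xtT.
    by apply: continuous_snd_comp; exact: continuous_step.
  - exact: measurable_int Hi.
  - apply: aeW => z [Qz /= sz]; apply/cvg_EFin; first by apply: nearW.
    rewrite -[X in _ --> X]mulr1; apply: cvgMr.
    have sz0 : 0 < z.2 - s by rewrite subr_gt0.
    have H : \forall n \near \oo, e n < z.2 - s.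
      have /cvgrPdist_lt/(_ _ sz0) := e_cvg.
      by apply: filterS => n; rewrite sub0r normrN gtr0_norm.
    apply: cvg_near_cst; apply: filterS H => n en; rewrite step1// addrC -lerBrDr.
    exact: ltW.
  - exact: integrable_norm.
  - apply: aeW => z n Dz; rewrite /= lee_fin normrM -[leRHS]mulr1 ler_wpM2l//.
    by have /andP[st0 st1] := step_ge0_le1 s (e n) z.2; rewrite ger0_norm.
  move=> _ _ H; rewrite (_ : b = fun n => fine (\int[mu]_(z in D) (heat_density g gt gii z * step s (e n) z.2)%:E)%E); last first.
    by apply/funext => n; rewrite bE.
  apply: fine_cvg; rewrite /Rintegral fineK; first exact: H.
  exact: integrable_fin_num.
have L : (fun n => a n + b n) @ \oo --> mass g s + \int[mu]_(z in D) heat_density g gt gii z.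
  exact: cvgD a_cvg b_cvg.
move: L; rewrite (_ : (fun n => a n + b n) = cst 0); last by apply/funext => n; exact: ab.
by move=> /cvg_lim <-//; rewrite lim_cst.
Unshelve. all: by end_near. Qed.
End admissible.

Lemma continuous_pos_part {R : realType} : continuous (fun y : R => Num.max y 0).
Proof.
move=> y.
by apply: (@continuous_max R _ id (fun=> 0) y); [exact: cvg_id|exact: cst_continuous].
Qed.

Section Cc_cutoff.
Context {R : realType} {N : nat}.
Local Notation space := 'rV[R]_N.
Local Notation spacetime := ('rV[R]_N * R)%type.
Local Notation mu := (@lebesgue_xt R N).

(** Functions are global and vanish off K, unlike in [Ck_c Omega 0], where only values on Omega
    count; [weak_convergence] passes from the latter to the former by extension by zero. *)
Definition Cc (Omega : set space) (f : space -> R) := continuous f /\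
  exists K, [/\ compact K, K `<=` Omega & forall x, ~ K x -> f x = 0].

(** The slice at time 0 of a space-time cutoff around K x {0}. *)
Lemma Cc_cutoff (Omega K : set space) : open Omega -> compact K -> K `<=` Omega ->
  exists chi, [/\ Cc Omega chi, forall x, 0 <= chi x & forall x, K x -> chi x = 1].
Proof.
move=> oO cK KO.
have cK0 : compact (K `*` [set 0 : R]) by apply: compact_setX => //; exact: compact_set1.
have oW : open (Omega `*` [set: R]).
  rewrite openE => -[x t] [/= Ox _]; exists (Omega, setT) => //=; split; last exact: filterT.
  exact: open_nbhs_nbhs.
have KW : K `*` [set 0 : R] `<=` Omega `*` [set: R] by move=> -[x t] [/= /KO].
have [chi [K' [kchi chi0 chi1 [cK' K'W] chiK']]] := smooth_cutoff cK0 oW KW.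
exists (fun x => chi (x, 0)); split => //; last by move=> x Kx; apply: chi1.
split.
  move=> x; apply: (@continuous_comp _ _ _ (fun x : space => (x, 0 : R)) chi); last exact: (Ck_continuous (kchi 0)).
  move=> P [[A B] /= [nA nB] AB]; have : nbhs x A by [].
  by apply: filterS => y Ay; apply: AB; split => //=; exact: nbhs_singleton.
exists (fst @` K'); split.
- by apply: continuous_compact => //; apply: continuous_subspaceT => z; exact: cvg_fst.
- by move=> _ [z /K'W[Oz _] <-].
- by move=> x nK; apply: chiK' => Kx; apply: nK; exists (x, 0).
Qed.
End Cc_cutoff.

(** * The Riesz representation theorem on an open set *)

Section Cc_theory.
Context {R : realType} {N : nat}.
Local Notation space := 'rV[R]_N.
Variable Omega : set space.
Implicit Types f g : space -> R.

Lemma Cc0 : Cc Omega (fun _ => 0).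
Proof. by split; [exact: cst_continuous|exists set0; split => //; exact: compact0]. Qed.

Lemma CcD f g : Cc Omega f -> Cc Omega g -> Cc Omega (fun x => f x + g x).
Proof.
move=> [cf [K [cK KO f0]]] [cg [L [cL LO g0]]]; split.
  by move=> x; exact: (cvgD (cf x) (cg x)).
exists (K `|` L); split; first exact: compactU.
  by move=> x [/KO|/LO].
by move=> x /not_orP[nK nL]; rewrite f0// g0// addr0.
Qed.

Lemma CcM f g : Cc Omega f -> continuous g -> Cc Omega (fun x => f x * g x).
Proof.
move=> [cf [K [cK KO f0]]] cg; split.
  by move=> x; exact: (cvgM (cf x) (cg x)).
by exists K; split => // x nK; rewrite f0// mul0r.
Qed.

Lemma CcZ (c : R) f : Cc Omega f -> Cc Omega (fun x => c * f x).
Proof.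
move=> Cf; have := CcM Cf (@cst_continuous space R c).
by congr Cc; apply/funext => x; rewrite mulrC.
Qed.

Lemma Cc_comp (h : R -> R) f : continuous h -> h 0 = 0 -> Cc Omega f -> Cc Omega (h \o f).
Proof.
move=> ch h0 [cf [K [cK KO f0]]]; split.
  by move=> x; apply: continuous_comp; [exact: cf|exact: ch].
by exists K; split => // x nK; rewrite /= f0.
Qed.

Lemma Cc_sum (n : nat) (F : nat -> space -> R) : (forall i, (i < n)%N -> Cc Omega (F i)) ->
  Cc Omega (fun x => \sum_(i < n) F i x).
Proof.
elim: n => [|n IH] CF.
  by rewrite (_ : (fun x => _) = (fun=> 0)); [exact: Cc0|apply/funext => x; rewrite big_ord0].
rewrite (_ : (fun x => _) = (fun x => \sum_(i < n) F i x + F n x)).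
  by apply: CcD; [apply: IH => i iltn; apply: CF; exact: ltnW|exact: CF].
by apply/funext => x; rewrite big_ord_recr.
Qed.
End Cc_theory.

Section riesz.
Context {R : realType} {N : nat}.
Local Notation space := 'rV[R]_N.
Variables (Omega : set space) (l : (space -> R) -> R).
Hypothesis oO : open Omega.
Hypothesis lD : forall f g, Cc Omega f -> Cc Omega g -> l (fun x => f x + g x) = l f + l g.
Hypothesis lZ : forall c f, Cc Omega f -> l (fun x => c * f x) = c * l f.
Hypothesis l_ge0 : forall f, Cc Omega f -> (forall x, 0 <= f x) -> 0 <= l f.
Implicit Types (f g : space -> R) (A B : set space).

Lemma functional_le f g : Cc Omega f -> Cc Omega g -> (forall x, f x <= g x) -> l f <= l g.
Proof.
move=> Cf Cg fg; rewrite -subr_ge0.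
have Cf' := CcZ (-1) Cf.
have : 0 <= l (fun x => g x + -1 * f x).
  by apply: l_ge0; [exact: CcD|move=> x; rewrite mulN1r subr_ge0].
by rewrite lD// lZ// mulN1r.
Qed.

Lemma functional0 : l (fun _ => 0) = 0.
Proof.
rewrite -[RHS](mul0r (l (fun=> 0))) -(lZ 0 (@Cc0 _ _ Omega)); congr l.
by apply/funext => x; rewrite mul0r.
Qed.

Lemma functional_sum (n : nat) (F : nat -> space -> R) : (forall i, (i < n)%N -> Cc Omega (F i)) ->
  l (fun x => \sum_(i < n) F i x) = \sum_(i < n) l (F i).
Proof.
elim: n => [|n IH] CF.
  rewrite big_ord0 -[RHS]functional0; congr l; apply/funext => x; exact: big_ord0.
rewrite big_ord_recr/= -IH; last by move=> i iltn; apply: CF; exact: ltnW.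
rewrite -lD//; [|by apply: Cc_sum => i iltn; apply: CF; exact: ltnW|exact: CF].
by congr l; apply/funext => x; rewrite big_ord_recr.
Qed.

(* Increasing covers make countable subadditivity a matter of adding the
   covers diagonally. *)
Definition riesz_cover A (M : R) := exists psi : nat -> space -> R,
  [/\ forall n, Cc Omega (psi n), forall n x, 0 <= psi n x,
      forall n m x, (n <= m)%N -> psi n x <= psi m x,
      forall x, A x -> Omega x -> exists n, 1 <= psi n x & forall n, l (psi n) <= M].

Definition riesz_outer A : \bar R := ereal_inf [set M%:E | M in riesz_cover A].

Lemma riesz_outer_le A M : riesz_cover A M -> (riesz_outer A <= M%:E)%E.
Proof. by move=> AM; apply: ereal_inf_lbound; exists M. Qed.

Lemma riesz_outer_ge0 A : (0 <= riesz_outer A)%E.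
Proof.
apply: le_ereal_inf_tmp => _ [M [psi [Cpsi psi0 _ _ psiM]] <-].
by rewrite lee_fin; apply: le_trans (psiM 0%N); exact: l_ge0.
Qed.

Lemma riesz_outer0 : riesz_outer set0 = 0%E.
Proof.
apply/eqP; rewrite eq_le riesz_outer_ge0 andbT; apply: riesz_outer_le.
exists (fun _ _ => 0); split => //; first by move=> _; exact: Cc0.
by move=> _; rewrite functional0.
Qed.

Lemma le_riesz_outer : {homo riesz_outer : A B / A `<=` B >-> (A <= B)%E}.
Proof.
move=> A B AB; apply: le_ereal_inf_tmp => _ [M [psi [H1 H2 H3 H4 H5]] <-].
by apply: riesz_outer_le; exists psi; split => // x /AB; exact: H4.
Qed.

Lemma riesz_outer_sigma_subadditive : sigma_subadditive riesz_outer.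
Proof.
move=> A; have [/eqP ->|Soo] := boolP ((\sum_(n <oo) riesz_outer (A n)) == +oo)%E.
  by rewrite leey.
apply/lee_addgt0Pr => e e0.
have S0 : (0 <= \sum_(n <oo) riesz_outer (A n))%E.
  by apply: nneseries_ge0 => n _ _; exact: riesz_outer_ge0.
have Aoo n : (riesz_outer (A n) < +oo)%E.
  rewrite ltNge leye_eq; apply/negP => /eqP Ai; move/negP: Soo; apply.
  apply/eqP; apply: (eseries_pinfty _ _ Ai) => // k _.
  by rewrite -ltNye (lt_le_trans _ (riesz_outer_ge0 _)).
have Afin n : riesz_outer (A n) \is a fin_num by rewrite ge0_fin_numE// riesz_outer_ge0.
have /choice[M hM] n : exists M, riesz_cover (A n) M /\
    (M%:E <= riesz_outer (A n) + (e / (2 ^ n.+1)%:R)%:E)%E.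
  have en : 0 < e / (2 ^ n.+1)%:R by rewrite divr_gt0// ltr0n expn_gt0.
  have /(_ (Afin n)) := @lb_ereal_inf_adherent R [set M%:E | M in riesz_cover (A n)] _ en.
  by move=> [_ [M cM <-] ltM]; exists M; split => //; exact: ltW.
have /choice[psi hpsi] n : exists psi : nat -> space -> R,
  [/\ forall n, Cc Omega (psi n), forall n x, 0 <= psi n x,
      forall n m x, (n <= m)%N -> psi n x <= psi m x,
      forall x, A n x -> Omega x -> exists n, 1 <= psi n x & forall k, l (psi k) <= M n].
  by have [[psi h] _] := hM n; exists psi.
have M0 n : 0 <= M n.
  by have [h1 h2 _ _ h5] := hpsi n; apply: le_trans (h5 0%N); exact: l_ge0.
have SM : (\sum_(n <oo) (M n)%:E <= \sum_(n <oo) riesz_outer (A n) + e%:E)%E.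
  apply: le_trans (epsilon_trick xpredT _ (ltW e0)); last by move=> n; exact: riesz_outer_ge0.
  by apply: lee_nneseries => n _ => [_|]; [rewrite lee_fin|exact: (hM n).2].
apply: le_trans SM.
have [/eqP ->|SMoo] := boolP ((\sum_(n <oo) (M n)%:E) == +oo)%E; first by rewrite leey.
have SMfin : (\sum_(n <oo) (M n)%:E)%E \is a fin_num.
  rewrite ge0_fin_numE; first by rewrite ltNge leye_eq.
  by apply: nneseries_ge0 => n _ _; rewrite lee_fin.
rewrite -(fineK SMfin); apply: riesz_outer_le.
(* These sums increase with n, as both the number of terms and each term do, and l maps them below
   the partial sums of M. *)
exists (fun n x => \sum_(k < n) psi k n x); split.
- by move=> n; apply: (@Cc_sum _ _ _ n (fun k => psi k n)) => i _; have [] := hpsi i.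
- by move=> n x; apply: sumr_ge0 => k _; have [_ + _ _ _] := hpsi k; exact.
- move=> n m x nm; rewrite -!(big_mkord xpredT (fun k => psi k _ x)).
  rewrite -[leLHS]addr0 [leRHS](big_cat_nat (n := n))//=; apply: lerD.
    by apply: ler_sum => k _; have [_ _ + _ _] := hpsi k; exact.
  by apply: sumr_ge0 => k _; have [_ + _ _ _] := hpsi k; exact.
- move=> x [k _ Akx] Ox; have [p0 pp pm pc _] := hpsi k.
  have [n n1] := pc x Akx Ox.
  (* At least k + 1, so that term k belongs to the sum, and at least n, so that it has reached 1 at
     x. *)
  exists (maxn k.+1 n); apply: le_trans n1 _.
  apply: le_trans (pm _ _ x (leq_maxr k.+1 n)) _.
  rewrite (bigD1 (Ordinal (leq_maxl k.+1 n)))//= lerDl.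
  by apply: sumr_ge0 => j _; have [_ + _ _ _] := hpsi j; exact.
- move=> n; rewrite (@functional_sum n (fun k => psi k n)); last by move=> i _; have [] := hpsi i.
  apply: (@le_trans _ _ (\sum_(k < n) M k)); first by apply: ler_sum => k _; have [_ _ _ _] := hpsi k; exact.
  rewrite -lee_fin (fineK SMfin) -sumEFin -(big_mkord xpredT (fun k => (M k)%:E)).
  by apply: nneseries_lim_ge => k _ _; rewrite lee_fin.
Qed.

HB.instance Definition _ := isOuterMeasure.Build R space riesz_outer
  riesz_outer0 riesz_outer_ge0 le_riesz_outer riesz_outer_sigma_subadditive.

(* A cover of X is split along the half-space by the continuous functions
   min(1, max(0, n (x_i - c))), which increase to its indicator. Half-spaces
   suffice as the sigma-algebra is generated by the coordinates. *)
Lemma halfspace_caratheodory (i : 'I_N) (c : R) :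
  riesz_outer.-caratheodory [set x : space | c < x ord0 i].
Proof.
apply: le_caratheodory_measurable => X.
apply: le_ereal_inf_tmp => _ [M [psi [Cpsi psi0 psim psic psiM]] <-].
apply/lee_addgt0Pr => e e0.
pose g (n : nat) (x : space) : R := Num.min 1 (Num.max 0 (n%:R * (x ord0 i - c))).
have cg n : continuous (g n).
  move=> x; apply: (@continuous_min R _ (fun=> 1) (fun x : space => Num.max 0 (n%:R * (x ord0 i - c))) x).
    exact: cst_continuous.
  apply: (@continuous_max R _ (fun=> 0) (fun x : space => n%:R * (x ord0 i - c)) x).
    exact: cst_continuous.
  have cc : continuous (fun x : space => x ord0 i) by exact: coord_continuous.
  exact: (cvgM (cvg_cst _) (cvgB (cc x) (cvg_cst _))).
have g0 n x : 0 <= g n x by rewrite le_min ler01 le_max lexx.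
have g1 n x : g n x <= 1 by rewrite ge_min lexx.
have gm n m x : (n <= m)%N -> g n x <= g m x.
  move=> nm; rewrite /g; apply: le_min2 => //; have [xc|xc] := leP 0 (x ord0 i - c).
    by apply: le_max2 => //; rewrite ler_wpM2r// ler_nat.
  by rewrite !max_l// mulr_ge0_le0// ltW.
(* The share of the cover that falls on the half-space; the index [n0] attains it up to e. *)
pose m := sup [set l (fun x => psi n x * g n x) | n in setT].
have Cpg n k : Cc Omega (fun x => psi n x * g k x) by exact: CcM.
have ub : has_sup [set l (fun x => psi n x * g n x) | n in setT].
  split; first by exists (l (fun x => psi 0%N x * g 0%N x)); exists 0%N.
  exists M => _ [n _ <-]; apply: le_trans (psiM n).
  by apply: functional_le => // x; rewrite -[leRHS]mulr1 ler_wpM2l.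
have [_ [n0 _ <-] n0m] := sup_adherent e0 ub.
rewrite -/m in n0m.
have H1 : (riesz_outer (X `&` [set x | (c < x ord0 i)%R]) <= m%:E)%E.
  apply: riesz_outer_le; exists (fun n x => psi n x * g n x); split => //.
  - by move=> n x; rewrite mulr_ge0.
  - by move=> n k x nk; apply: ler_pM => //; [exact: psim|exact: gm].
  - move=> x [Xx /= cx] Ox; have [n n1] := psic x Xx Ox.
    have xc : 0 < x ord0 i - c by rewrite subr_gt0.
    pose k := Num.truncn (x ord0 i - c)^-1.
    exists (maxn n k.+1).
    have -> : g (maxn n k.+1) x = 1.
      apply/eqP; rewrite eq_le g1/= /g le_min lexx/= le_max; apply/orP; right.
      rewrite -ler_pdivrMr// mul1r; apply: le_trans (_ : k.+1%:R <= _); last by rewrite ler_nat leq_maxr.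
      by apply/ltW; exact: truncnS_gt.
    by rewrite mulr1; apply: le_trans n1 _; apply: psim; exact: leq_maxl.
  - by move=> n; apply: ub_le_sup; [case: ub|exists n].
have Cp1g n : Cc Omega (fun x => psi n x * (1 - g n0 x)).
  by apply: CcM => // x; exact: (cvgB (cvg_cst _) (cg n0 x)).
(* Here the cut is frozen at g n0, which vanishes off the half-space. Passing to the index max(n,
   n0) makes psi dominate psi n0, so what is subtracted from M is more than m - e. *)
have H2 : (riesz_outer (X `&` ~` [set x | (c < x ord0 i)%R]) <= (M - m + e)%:E)%E.
  apply: riesz_outer_le; exists (fun n x => psi n x * (1 - g n0 x)); split => //.
  - by move=> n x; rewrite mulr_ge0// subr_ge0.
  - by move=> n k x nk; rewrite ler_wpM2r ?subr_ge0//; exact: psim.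
  - move=> x [Xx /= /negP]; rewrite -leNgt => cx Ox; have [n n1] := psic x Xx Ox; exists n.
    rewrite (_ : g n0 x = 0) ?subr0 ?mulr1//.
    apply/eqP; rewrite eq_le g0 andbT /g ge_min; apply/orP; right.
    by rewrite ge_max lexx/= mulr_ge0_le0// subr_le0.
  - move=> n; apply: (@le_trans _ _ (l (fun x => psi (maxn n n0) x * (1 - g n0 x)))).
      by apply: functional_le => // x; rewrite ler_wpM2r ?subr_ge0//; apply: psim; exact: leq_maxl.
    rewrite (_ : (fun x => psi (maxn n n0) x * (1 - g n0 x)) =
      (fun x => psi (maxn n n0) x + (-1) * (psi (maxn n n0) x * g n0 x))); last first.
      by apply/funext => x; ring.
    rewrite lD//; last exact: CcZ.
    rewrite lZ// mulN1r -addrA; apply: lerD; first exact: psiM.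
    rewrite lerNl opprD opprK; apply: le_trans (ltW n0m) _.
    by apply: functional_le => // x; rewrite ler_wpM2r//; apply: psim; exact: leq_maxr.
apply: le_trans (leeD H1 H2) _; rewrite -EFinD lee_fin; lra.
Qed.

(** Caratheodory-measurable sets form a sigma-algebra, rays ]c, +oo[ generate the Borel sets of R,
    and preimages under coordinates generate those of R^N, so half-spaces decide. *)
Lemma borel_caratheodory : measurable `<=` riesz_outer.-caratheodory.
Proof.
move=> A mA.
suff : g_sigma_preimage (@rV_coord R N) `<=` riesz_outer.-cara.-measurable by exact.
apply: smallest_sub.
  split => [|X mX|F mF]; first exact: measurable0.
    by rewrite setTD; exact: measurableC.
  exact: bigcupT_measurable.
move=> X; rewrite -bigcup_seq => -[i _ [C mC <-]] /=.
rewrite setTI.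
have {}mC : (@RGenOInfty.G R).-sigma.-measurable C by rewrite -RGenOInfty.measurableE.
move: C mC.
apply: (@smallest_sub _ _ _ [set C | riesz_outer.-cara.-measurable (rV_coord i @^-1` C)]).
  split => [|D mD|F mF] /=; first by rewrite preimage_set0; exact: measurable0.
    by rewrite setTD preimage_setC; exact: measurableC.
  by rewrite preimage_bigcup; exact: bigcupT_measurable.
move=> _ [c ->] /=.
rewrite (_ : _ @^-1` _ = [set x : space | c < x ord0 i]); first exact: halfspace_caratheodory.
by apply/seteqP; split => x /=; rewrite in_itv/= andbT.
Qed.

Definition riesz_measure : set space -> \bar R := riesz_outer.

Let riesz_measure0 : riesz_measure set0 = 0%E. Proof. exact: riesz_outer0. Qed.
Let riesz_measure_ge0 A : (0 <= riesz_measure A)%E. Proof. exact: riesz_outer_ge0. Qed.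
Let riesz_measure_sigma : semi_sigma_additive riesz_measure.
Proof.
move=> F mF tF mUF; apply: (@caratheodory_measure_sigma_additive R space riesz_outer) => //.
  by move=> i; exact: (borel_caratheodory (mF i)).
exact: borel_caratheodory.
Qed.

HB.instance Definition _ := isMeasure.Build _ _ _ riesz_measure
  riesz_measure0 riesz_measure_ge0 riesz_measure_sigma.

(** A cover has to reach 1 only at points of Omega, so the zero function covers the complement. *)
Lemma riesz_measureC : riesz_measure (~` Omega) = 0%E.
Proof.
apply/eqP; rewrite eq_le riesz_measure_ge0 andbT; apply: riesz_outer_le.
exists (fun _ _ => 0); split => //; first by move=> _; exact: Cc0.
by move=> _; rewrite functional0.
Qed.

Lemma riesz_measure_le f A : Cc Omega f -> (forall x, 0 <= f x) -> (forall x, A x -> 1 <= f x) ->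
  (riesz_measure A <= (l f)%:E)%E.
Proof.
move=> Cf f0 f1; apply: riesz_outer_le; exists (fun=> f); split => //.
by move=> x Ax _; exists 0%N; exact: f1.
Qed.

(** A Dini argument: a cover increases with n and reaches 1 at each point of K, so by compactness
    one of its members exceeds 1 - eta on all of K and dominates (1 - eta) f. *)
Lemma riesz_measure_ge f (K : set space) : Cc Omega f -> (forall x, 0 <= f x <= 1) -> compact K ->
  K `<=` Omega -> (forall x, ~ K x -> f x = 0) -> ((l f)%:E <= riesz_measure K)%E.
Proof.
move=> Cf f01 cK KO f0.
apply: le_ereal_inf_tmp => _ [M [psi [Cpsi psi0 psim psic psiM]] <-].
have f_ge0 x : 0 <= f x by have /andP[] := f01 x.
have f_le1 x : f x <= 1 by have /andP[] := f01 x.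
have lf0 : 0 <= l f by exact: l_ge0.
rewrite lee_fin; apply/ler_addgt0Pl => e e0.
pose eta := e / (l f + 1).
have eta0 : 0 < eta by rewrite divr_gt0// ltr_wpDl.
have : \forall n \near \oo, K `<=` [set x | 1 - eta < psi n x].
  pose P (n : nat) (x : space) := 1 - eta < psi n x.
  apply: (proj1 (compact_near_coveringP K) cK nat \oo P) => x Kx.
  have [n n1] := psic x Kx (KO _ Kx).
  exists ([set y | 1 - eta < psi n y], [set k | (n <= k)%N]); last first.
    by move=> [y k] [/= h nk]; apply: lt_le_trans h _; exact: psim.
  split => /=; last by exists n.
  have [cp _] := Cpsi n; apply: (cp x [set r | 1 - eta < r]).
  by apply: lt_nbhsr; apply: lt_le_trans n1; rewrite ltrBlDr ltrDl.
move=> [n _ /(_ n (leqnn n)) hn].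
have : l (fun x => (1 - eta) * f x) <= M.
  apply: le_trans (psiM n); apply: functional_le => //; first exact: CcZ.
  move=> x; have [Kx|nKx] := pselect (K x); last by rewrite f0// mulr0.
  have [h|h] := leP 0 (1 - eta); last by apply: le_trans (psi0 n x); rewrite mulr_le0_ge0// ltW.
  by apply: le_trans (ltW (hn x Kx)); rewrite -[leRHS]mulr1 ler_wpM2l.
rewrite lZ// mulrBl mul1r lerBlDr => /le_trans; apply; rewrite addrC lerD2r.
by rewrite /eta mulrAC ler_pdivrMr ?ltr_wpDl// ler_wpM2l ?ltW// ltrDl.
Qed.

Lemma riesz_measure_compact (K : set space) : compact K -> K `<=` Omega -> (riesz_measure K < +oo)%E.
Proof.
move=> cK KO; have [chi [Cchi chi0 chi1]] := Cc_cutoff oO cK KO.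
apply: le_lt_trans (ltry (l chi)); apply: riesz_measure_le => // x Kx.
by rewrite chi1.
Qed.

Lemma Cc_integrable f : Cc Omega f -> riesz_measure.-integrable setT (EFin \o f).
Proof.
move=> [cf [K [cK KO f0]]]; have mK := compact_measurable_rV cK.
have mf : measurable_fun setT f.
  by apply: continuous_measurable_rV => //; exact: continuous_subspaceT.
have [M M0 fM] := supp_bounded cf cK f0.
have Ki : riesz_measure.-integrable K (EFin \o f).
  apply: measurable_bounded_integrable => //; first exact: riesz_measure_compact.
    exact: measurable_funTS.
  exists M; split; first exact: num_real.
  by move=> y My x _; apply: le_trans (fM x) (ltW My).
have := proj1 (integrable_mkcond _ mK) Ki.
apply: eq_integrable => // x _; rewrite patchE; case: ifPn => // /negP.
by rewrite inE => /f0 /= ->.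
Qed.

Lemma dist_le_itv (a b x y : R) : a <= x <= b -> a <= y <= b -> `|x - y| <= b - a.
Proof. by move=> /andP[? ?] /andP[? ?]; rewrite ler_norml; apply/andP; split; lra. Qed.

(** Cutting [0, y] into unit layers: the term j is the length of its part in [j, j + 1]. *)
Lemma clip_sum (n : nat) (y : R) : 0 <= y ->
  \sum_(j < n) Num.min 1 (Num.max 0 (y - j%:R)) = Num.min n%:R y.
Proof.
move=> y0; elim: n => [|n IH]; first by rewrite big_ord0 min_l.
rewrite big_ord_recr/= IH.
have [yn|yn] := leP y n%:R.
  rewrite (max_l (_ : y - n%:R <= 0)) ?subr_le0// !min_r//.
    by rewrite addr0.
  by apply: le_trans yn _; rewrite ler_nat.
rewrite (max_r (_ : 0 <= y - n%:R)) ?subr_ge0 ?ltW//.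
rewrite -natr1; have [h|h] := leP 1 (y - n%:R).
  by rewrite [RHS]min_l// addrC -lerBrDr.
by rewrite [RHS]min_r; [rewrite addrC subrK|rewrite addrC -lerBlDr ltW].
Qed.

(* Layer cake: f = d sum_j min(1, max(0, f / d - j)), where the integral and the
   functional of the j-th layer both lie between the measures of the
   superlevel sets of f at (j + 1) d and j d. *)
Lemma riesz_integral_ge0 f : Cc Omega f -> (forall x, 0 <= f x) ->
  (\int[riesz_measure]_x (f x)%:E = (l f)%:E)%E.
Proof.
move=> Cf f0; have [cf [K [cK KO fK]]] := Cf.
have [B B0 fB] := supp_bounded cf cK fK.
have fi := Cc_integrable Cf.
rewrite -[LHS](fineK (integrable_fin_num _ fi))//; congr EFin.
rewrite -/(Rintegral _ _ _).
set I := Rintegral _ _ _.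
apply/eqP; rewrite -subr_eq0 -normr_eq0; apply/eqP/le_anti; rewrite normr_ge0 andbT.
have muK0 := riesz_measure_compact cK KO.
have muKfin : riesz_measure K \is a fin_num by rewrite ge0_fin_numE.
apply/ler_addgt0Pl => e e0; rewrite addr0.
pose m := fine (riesz_measure K).
have m0 : 0 <= m by exact: fine_ge0.
(* The layer height: the integral and the functional will differ by at most d (w 0 - w n) <= d m <=
   e. *)
pose d := e / (m + 1).
have d0 : 0 < d by rewrite divr_gt0// ltr_wpDl.
(* Enough layers to exceed the bound B, so that the truncation at n in [clip_sum] is inactive. *)
pose n := (Num.truncn (B / d)).+1.
have nB : B / d <= n%:R by apply: ltW; exact: truncnS_gt.
pose h (j : nat) (y : R) := Num.min 1 (Num.max 0 (y / d - j%:R)).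
have ch j : continuous (h j).
  move=> y; apply: (@continuous_min R _ (fun=> 1) (fun y : R => Num.max 0 (y / d - j%:R)) y).
    exact: cst_continuous.
  apply: (@continuous_max R _ (fun=> 0) (fun y : R => y / d - j%:R) y).
    exact: cst_continuous.
  by apply: cvgB; [apply: cvgMl; exact: cvg_id|exact: cvg_cst].
have h00 j : h j 0 = 0.
  by rewrite /h mul0r sub0r max_l ?min_r// lerNl oppr0.
pose F j x := h j (f x).
have CF j : Cc Omega (F j) by exact: Cc_comp.
have F01 j x : 0 <= F j x <= 1.
  by rewrite /F /h le_min ler01 le_max lexx ge_min lexx.
have fE x : f x = d * \sum_(j < n) F j x.
  rewrite /F /h clip_sum; last by rewrite divr_ge0// ltW.
  rewrite min_r; first by rewrite mulrCA mulfV ?mulr1// gt_eqF.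
  by apply: le_trans nB; rewrite ler_pM2r ?invr_gt0//; apply: le_trans (ler_norm _) (fB x).
pose L (j : nat) : set space := K `&` [set x | j%:R <= f x / d].
have cL j : compact (L j).
  apply: compact_closedI => //.
  apply: (@preimage_closed _ _ (fun x => f x / d) [set y : R | j%:R <= y]); last exact: closed_ge.
  by move=> x _; exact: (cvgM (cf x) (cvg_cst _)).
have LO j : L j `<=` Omega by move=> x [/KO].
have mL j := compact_measurable_rV (cL j).
have muLfin j : riesz_measure (L j) \is a fin_num.
  by rewrite ge0_fin_numE//; exact: riesz_measure_compact.
pose w j := fine (riesz_measure (L j)).
have F_off j x : ~ L j x -> F j x = 0.
  move=> /not_andP[nK|/negP]; first by rewrite /F fK.
  by rewrite -ltNge => xj; rewrite /F /h max_l ?min_r// subr_le0 ltW.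
have F_on j x : L j.+1 x -> 1 <= F j x.
  by move=> [_ /= xj]; rewrite /F /h le_min lexx/= le_max lerBrDr -natr1 in xj *; rewrite addrC xj orbT.
have Fi j := Cc_integrable (CF j).
have lF j : w j.+1 <= l (F j) <= w j.
  apply/andP; split; rewrite -lee_fin /w fineK//.
    by apply: riesz_measure_le => // [x|x]; [have /andP[] := F01 j x|exact: F_on].
  by apply: riesz_measure_ge => //; exact: F_off.
have iF j : w j.+1 <= \int[riesz_measure]_x F j x <= w j.
  have wE k : w k = \int[riesz_measure]_(x in L k) 1 by rewrite Rintegral_cst// mul1r.
  have i1 k : riesz_measure.-integrable (L k) (EFin \o (fun=> 1 : R)).
    apply: measurable_bounded_integrable => //; first by rewrite -ge0_fin_numE.
    by exists 1; split; [exact: num_real|move=> y y1 x _; rewrite normr1 ltW].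
  have iL k : riesz_measure.-integrable (L k) (EFin \o F j) by exact: integrableS (Fi j).
  apply/andP; split.
    apply: (@le_trans _ _ (\int[riesz_measure]_(x in L j.+1) F j x)).
      by rewrite wE; apply: le_Rintegral => // x; exact: F_on.
    by apply: ge0_subset_Rintegral => // x _; have /andP[] := F01 j x.
  have -> : \int[riesz_measure]_x F j x = \int[riesz_measure]_(x in L j) F j x.
    rewrite [RHS]Rintegral_mkcond; apply: eq_Rintegral => x _; rewrite patchE; case: ifPn => // /negP.
    by rewrite inE => /F_off.
  by rewrite wE; apply: le_Rintegral => // x _; have /andP[] := F01 j x.
have IE : I = d * \sum_(j < n) \int[riesz_measure]_x F j x.
  have CS k : Cc Omega (fun x => \sum_(j < k) F j x) by exact: Cc_sum.
  have -> : I = \int[riesz_measure]_x (d * \sum_(j < n) F j x) by apply: eq_Rintegral => x _; exact: fE.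
  rewrite RintegralZl//; last exact: Cc_integrable (CS n).
  congr (_ * _); elim: (n) => [|k IH].
    under eq_Rintegral do rewrite big_ord0.
    by rewrite big_ord0 Rintegral_cst// mul0r.
  under eq_Rintegral do rewrite big_ord_recr/=.
  by rewrite RintegralD// ?IH ?big_ord_recr//; exact: Cc_integrable (CS k).
have lE : l f = d * \sum_(j < n) l (F j).
  rewrite -(@functional_sum n F)// -lZ; last exact: Cc_sum.
  by congr l; apply/funext => x; exact: fE.
rewrite IE lE -mulrBr -sumrB normrM (gtr0_norm d0).
apply: (@le_trans _ _ (d * (w 0%N - w n))).
  apply: ler_wpM2l; first exact: ltW.
  apply: le_trans (ler_norm_sum _ _ _) _.
  (* The error of layer j is at most w j - w (j + 1), and these differences telescope. *)
  rewrite (_ : w 0%N - w n = \sum_(0 <= j < n) (- w j.+1 - - w j)); last first.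
    by rewrite telescope_sumr// opprK addrC.
  rewrite big_mkord; apply: ler_sum => j _; rewrite opprK [leRHS]addrC.
  exact: dist_le_itv.
apply: (@le_trans _ _ (d * m)).
  apply: ler_wpM2l; [exact: ltW|apply: (@le_trans _ _ (w 0%N))]; first by rewrite gerBl fine_ge0.
  by apply: fine_le => //; apply: le_measure; rewrite ?inE//; [exact: compact_measurable_rV|move=> x []].
by rewrite /d mulrAC ler_pdivrMr ?ltr_wpDl// ler_wpM2l ?ltW// ltrDl.
Qed.

(** Positive and negative parts of f stay in C_c(Omega), which reduces the formula to
    [riesz_integral_ge0]. *)
Lemma riesz_integral f : Cc Omega f ->
  (\int[riesz_measure]_(x in Omega) (f x)%:E = (l f)%:E)%E.
Proof.
move=> Cf.
pose p (y : R) := Num.max y 0.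
have cp : continuous p by exact: continuous_pos_part.
have cq : continuous (fun y : R => p (- y)).
  by move=> y; apply: (@continuous_comp _ _ _ -%R p); [exact: opp_continuous|exact: cp].
have Cp : Cc Omega (p \o f) by apply: Cc_comp => //; rewrite /p maxxx.
have Cq : Cc Omega ((fun y => p (- y)) \o f) by apply: Cc_comp => //; rewrite /p oppr0 maxxx.
have p0 y : 0 <= p y by rewrite le_max lexx orbT.
have pq y : y = p y + -1 * p (- y).
  rewrite /p; have [y0|y0] := leP 0 y.
    by rewrite max_r ?mulr0 ?addr0// oppr_le0.
  by rewrite max_l ?oppr_ge0 ?ltW// mulN1r opprK add0r.
have [cf [K [cK KO fK]]] := Cf.
have mO : measurable Omega by exact: open_measurable_rV.
have -> : (\int[riesz_measure]_(x in Omega) (f x)%:E = \int[riesz_measure]_x (f x)%:E)%E.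
  rewrite integral_mkcond; apply: eq_integral => x _; rewrite patchE; case: ifPn => // /negP nO.
  by rewrite fK// => /KO; rewrite -inE.
have -> : l f = l (p \o f) - l ((fun y => p (- y)) \o f).
  rewrite -mulN1r -lZ// -lD//; last exact: CcZ.
  by congr l; apply/funext => x; rewrite [LHS]pq.
under eq_integral do rewrite [f _]pq mulN1r EFinB.
rewrite integralB//; last 2 first.
- exact: Cc_integrable Cp.
- exact: Cc_integrable Cq.
by rewrite (riesz_integral_ge0 Cp) ?(riesz_integral_ge0 Cq)//= => x; exact: p0.
Qed.

Theorem riesz_representation : exists m : {measure set space -> \bar R},
  radon_measure Omega m /\
  forall f, Cc Omega f -> (\int[m]_(x in Omega) (f x)%:E = (l f)%:E)%E.
Proof.
exists riesz_measure; split; last exact: riesz_integral.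
by split; [exact: riesz_measureC|exact: riesz_measure_compact].
Qed.

End riesz.

(** * Time slices *)

Section slices.
Context {R : realType} {N : nat}.
Local Notation space := 'rV[R]_N.
Local Notation spacetime := ('rV[R]_N * R)%type.
Local Notation mu := (@lebesgue_xt R N).
Local Notation mxt := (@measurable _ (space * measurableTypeR R)%type).

Lemma ae_xtS (P P' : spacetime -> Prop) : (forall z, P z -> P' z) ->
  {ae mu, forall z, P z} -> {ae mu, forall z, P' z}.
Proof. by move=> PP'; apply: (@filterS _ _ (ae_filter_ringOfSetsType mu)). Qed.

Lemma ae_xtI (P P' : spacetime -> Prop) : {ae mu, forall z, P z} -> {ae mu, forall z, P' z} ->
  {ae mu, forall z, P z /\ P' z}.
Proof. exact: (@filterI _ _ (ae_filter_ringOfSetsType mu)). Qed.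

Lemma lebesgue_measure_gt0 : (0 < lebesgue_measure [set: R])%E.
Proof.
apply: (@lt_le_trans _ _ (lebesgue_measure `[0%R, 1%R])).
  by rewrite lebesgue_measure_itv/= lte_fin ltr01 sube0 lte_fin ltr01.
by apply: le_measure; rewrite ?inE.
Qed.

Section tonelli.
Variables (A : set space) (B : set R) (f : spacetime -> R).
Hypotheses (mA : measurable A) (mB : measurable B).
Hypothesis mf : measurable_fun (A `*` B : set (space * measurableTypeR R)%type) f.

Let F : space * measurableTypeR R -> \bar R := (fun z => `|f z|%:E) \_ (A `*` B).

Let mAB : mxt (A `*` B). Proof. exact: measurableX. Qed.

Let mF : measurable_fun setT F.
Proof.
apply/(measurable_restrictT _ mAB); apply/measurable_EFinP.
exact: measurableT_comp mf.
Qed.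

Let F0 z : (0 <= F z)%E.
Proof. by rewrite /F patchE; case: ifPn => // _; rewrite lee_fin. Qed.

Let GE : fubini_G (lebesgue_rV N) F = (fun t => \int[lebesgue_x]_(x in A) `|f (x, t)|%:E)%E \_ B.
Proof.
apply/funext => t; rewrite /fubini_G patchE; case: ifPn => [/set_mem Bt|/negP nB].
  rewrite [RHS]integral_mkcond; apply: eq_integral => x _; rewrite /F !patchE.
  by have [Ax|nAx] := pselect (A x); [rewrite !mem_set|rewrite !memNset// => -[]].
by apply: integral0_eq => x _; rewrite /F patchE memNset// => -[_ /mem_set].
Qed.

Lemma tonelli_box : (\int[mu]_(z in A `*` B) `|f z|%:E =
  \int[lebesgue_measure]_(t in B) \int[lebesgue_x]_(x in A) `|f (x, t)|%:E)%E.
Proof.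
rewrite [RHS]integral_mkcond -GE -(@fubini_tonelli2 _ _ _ _ R (lebesgue_rV N) lebesgue_measure F mF F0).
by rewrite integral_mkcond.
Qed.

Lemma measurable_slice_norm : measurable_fun B (fun t => \int[lebesgue_x]_(x in A) `|f (x, t)|%:E)%E.
Proof.
apply/(measurable_restrictT _ mB); rewrite -GE.
exact: (@measurable_fun_fubini_tonelli_G _ _ _ _ R (lebesgue_rV N) F mF F0).
Qed.
End tonelli.

(** A null set contains no interval of positive length. *)
Lemma ae_exists_near (P : R -> Prop) (s : R) (V : set R) :
  (\forall t \ae lebesgue_measure, P t) -> nbhs s V -> exists2 t, V t & P t.
Proof.
move=> [A [mA A0 PA]] /nbhs_ballP[d /= d0 dV]; apply: contrapT => H.
have : `[(s - d / 2)%R, (s + d / 2)%R]%classic `<=` A.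
  move=> t /=; rewrite in_itv/= => /andP[t1 t2]; apply: PA => Pt; apply: H; exists t => //.
  apply: dV; rewrite /ball/= ltr_distlC; apply/andP; split.
    by apply: lt_le_trans t1; rewrite ltrD2l ltrN2 ltr_pdivrMr// ltr_pMr// ltr1n.
  by apply: le_lt_trans t2 _; rewrite ltrD2l ltr_pdivrMr// ltr_pMr// ltr1n.
move=> sA; have : (lebesgue_measure `[(s - d / 2)%R, (s + d / 2)%R] <= 0)%E.
  by rewrite -A0; apply: le_measure; rewrite ?inE.
rewrite lebesgue_measure_itv/= lte_fin ifT; last first.
  by rewrite ltrD2l (lt_trans (_ : _ < 0))// ?oppr_lt0 divr_gt0.
rewrite leNgt -EFinB lte_fin (_ : _ - _ = d) ?d0//; by field.
Qed.

Lemma oo_time_gt (T : \bar R) (t : R) : 0 <= t -> (t%:E < T)%E -> exists2 tau, t < tau & oo_time T tau.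
Proof.
case: T => [r||] //= t0 tT.
- exists ((t + r) / 2); first by rewrite lte_fin in tT; lra.
  by rewrite lte_fin in tT; split; [lra|rewrite lte_fin; lra].
- by exists (t + 1); [rewrite ltrDl|split; [rewrite ltr_wpDl|rewrite ltry]].
Qed.

(** A nonempty compact K attains its latest time, which lies below T. *)
Lemma cylinder0_time (Omega : set space) (T : \bar R) (K : set spacetime) : (0 < T)%E ->
  compact K -> K `<=` cylinder0 Omega T -> exists2 tau, oo_time T tau & forall z, K z -> z.2 < tau.
Proof.
move=> T0 cK KQ; have [->|/set0P K0] := eqVneq K set0.
  by have [tau _ Tt] := oo_time_gt (lexx 0) T0; exists tau.
have c2 : {within K, continuous (snd : spacetime -> R)} by apply: continuous_subspaceT => z; exact: cvg_snd.
have [c /set_mem Kc hc] := compact_EVT_max K0 cK c2.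
have [_ [c0 cT]] := KQ _ Kc.
have [tau ct Tt] := oo_time_gt c0 cT; exists tau => // z Kz.
by apply: le_lt_trans ct; apply: hc; rewrite inE.
Qed.

Lemma closed_ball_compact_rV (d : R) : compact [set w : space | `|w| <= d].
Proof.
apply: bounded_closed_compact.
  by exists d; split; [exact: num_real|move=> y dy x /= /le_trans; apply; exact: ltW].
apply: (@preimage_closed _ _ (fun w : space => `|w|) [set y : R | y <= d]); last exact: closed_le.
by move=> x _; exact: norm_continuous.
Qed.

(** A union of small balls centred on K, whose closure stays in a compact thickening of K. *)
Lemma compactly_contained_nbhs (Omega K : set space) : open Omega -> compact K -> K `<=` Omega ->
  exists2 omega, compactly_contained omega Omega & K `<=` omega.
Proof.
move=> oO cK KO.
have [d d0 [K' [cK' K'O KK']]] := compact_thicken closed_ball_compact_rV cK oO KO.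
pose om : set space := \bigcup_(y in K) ball y d.
have omK' : closure om `<=` K'.
  rewrite (closure_id K').1; last exact: supp_closed.
  apply: closure_subset => x [y Ky]; rewrite -ball_normE /ball_/= => yx.
  by rewrite -(subrK y x); apply: KK' => //; rewrite distrC ltW.
exists om; last by move=> x Kx; exists x => //; exact: ballxx.
split.
- by apply: bigcup_open => y _; exact: ball_open.
- exact: (subclosed_compact (@closed_closure _ om) cK' omK').
- exact: subset_trans K'O.
Qed.

Variables (Omega : set space) (T : \bar R) (U : spacetime -> R).
Hypotheses (oO : open Omega) (CU : C_L1loc Omega T U).
Local Notation Q := (cylinder Omega T).
Local Notation Q0 := (cylinder0 Omega T).

(* A bound valid for almost every time holds at every time, by continuity in
   L^1. *)
Lemma slice_bound (K : set space) (V : set R) (h : R -> R) (c : R) : compact K -> K `<=` Omega ->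
  open V -> V `<=` oo_time T -> continuous h -> (forall y, 0 <= h y) -> (forall y y', h y <= h y' + `|y' - y|) ->
  (\forall t \ae lebesgue_measure, V t -> (\int[lebesgue_x]_(x in K) (h (U (x, t)))%:E <= c%:E)%E) ->
  forall s, V s -> (\int[lebesgue_x]_(x in K) (h (U (x, s)))%:E <= c%:E)%E.
Proof.
move=> cK KO oV VT ch h0 h1 hV s Vs; apply/lee_addgt0Pr => e e0.
have mK := compact_measurable_rV cK.
have /(_ [set y | y < e%:E]%E) /= := CU.2 K cK KO s (VT _ Vs).
have n0 : nbhs (0%E : \bar R) [set y : \bar R | (y < e%:E)%E].
  by apply: open_nbhs_nbhs; split; [exact: open_ereal_lt_ereal|rewrite /= lte_fin].
move=> /(_ n0) /= Hs.
have [t [Vt /= te] /(_ Vt) Pt] := ae_exists_near hV (filterI (open_nbhs_nbhs (conj oV Vs)) Hs).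
have mU r : V r -> measurable_fun K (fun x => U (x, r)).
  by move=> /VT Tr; apply: measurable_funS (CU.1 r Tr).1 => //; exact: open_measurable_rV.
have mh : measurable_fun setT h by exact: continuous_measurable_fun.
have mhU r : V r -> measurable_fun K (fun x => h (U (x, r))) by move=> Vr; exact: measurableT_comp (mU r Vr).
apply: (@le_trans _ _ (\int[lebesgue_x]_(x in K) ((h (U (x, t)))%:E + `|U (x, t) - U (x, s)|%:E))%E).
  apply: ge0_le_integral => //.
  - by move=> x _; rewrite lee_fin.
  - by apply/measurable_EFinP; exact: mhU.
  - apply/measurable_EFinP/measurable_funD; first exact: mhU.
    by apply: measurableT_comp => //; apply: measurable_funB; exact: mU.
  - by move=> x _; rewrite -EFinD lee_fin.
rewrite ge0_integralD//.
- by apply: leeD => //; exact: ltW.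
- by move=> x _; rewrite lee_fin.
- by apply/measurable_EFinP; exact: mhU.
- by apply/measurable_EFinP; apply: measurableT_comp => //; apply: measurable_funB; exact: mU.
Qed.

Hypothesis LU : L1loc_xt Q U.
Hypothesis U0 : {ae mu, forall z, Q z -> 0 <= U z}.

(** By Tonelli the negative part of U has integral 0 over K at almost every time; [slice_bound] with
    c = 0 extends this to every time. *)
Lemma slice_ge0 (K : set space) (s : R) : compact K -> K `<=` Omega -> oo_time T s ->
  {ae lebesgue_x, forall x, K x -> 0 <= U (x, s)}.
Proof.
move=> cK KO Ts; have mK := compact_measurable_rV cK.
have oT := @open_oo_time R T.
pose h (y : R) := Num.max 0 (- y).
have ch : continuous h.
  move=> y; apply: (@continuous_max R _ (fun=> 0) -%R y); [exact: cst_continuous|exact: opp_continuous].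
have h0 y : 0 <= h y by rewrite le_max lexx.
have mh : measurable_fun setT h by exact: continuous_measurable_fun.
have mT : measurable (oo_time T) by exact: open_measurable.
have mKT : mxt (K `*` oo_time T) by exact: measurableX.
have mhU : measurable_fun (K `*` oo_time T : set (space * measurableTypeR R)%type) (h \o U).
  apply: measurableT_comp => //; apply: measurable_funS LU.1.
    by apply: open_measurable_mu; exact: open_cylinder.
  by move=> [x t] [/= /KO].
have : (\int[lebesgue_x]_(x in K) (h (U (x, s)))%:E <= 0%:E)%E.
  apply: (@slice_bound K (oo_time T)) => //.
    move=> y y'; rewrite ge_max addr_ge0//=.
    have : - y' <= h y' by rewrite le_max lexx orbT.
    by have := ler_norm (y' - y); lra.
  have nh (t : R) : (\int[lebesgue_x]_(x in K) (h (U (x, t)))%:E = \int[lebesgue_x]_(x in K) `|(h \o U) (x, t)|%:E)%E.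
    by apply: eq_integral => x _; rewrite ger0_norm ?h0.
  have := tonelli_box mK mT mhU.
  have -> : (\int[mu]_(z in K `*` oo_time T) `|(h \o U) z|%:E = 0)%E.
    apply/(ae_eq_integral_abs mu mKT (f := EFin \o (h \o U))); first exact/measurable_EFinP.
    apply: ae_xtS U0 => -[x t] Uge [/= Kx Tt].
    by rewrite /h max_l// oppr_le0; apply: Uge; split => //; exact: KO.
  move=> /esym Z.
  have mG := measurable_slice_norm mK mT mhU.
  have : ae_eq lebesgue_measure (oo_time T) (fun t => \int[lebesgue_x]_(x in K) `|(h \o U) (x, t)|%:E)%E (cst 0%E).
    apply/ae_eq_integral_abs => //; rewrite -[RHS]Z; apply: eq_integral => t _.
    by rewrite gee0_abs//; apply: integral_ge0 => x _; rewrite lee_fin.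
  by apply: filterS => t Ht Tt; rewrite nh Ht.
move=> H; have {H} : ae_eq lebesgue_x K (fun x => (h (U (x, s)))%:E) (cst 0%E).
  apply/ae_eq_integral_abs => //.
    apply/measurable_EFinP; apply: measurableT_comp => //.
    by apply: measurable_funS (CU.1 s Ts).1 => //; exact: open_measurable_rV.
  apply/eqP; rewrite eq_le; apply/andP; split; last by apply: integral_ge0.
  by under eq_integral do rewrite gee0_abs ?lee_fin ?h0//.
apply: filterS => x Hx Kx; have [+] := Hx Kx.
have : - U (x, s) <= h (U (x, s)) by rewrite le_max lexx orbT.
by move=> + E; rewrite E oppr_le0.
Qed.

(** The working form of L^infty_loc([0, T); L^1_loc(Omega)): the bound holds at every time, not just
    at almost every one. *)
Definition bounded_mass := forall (K : set space) (tau : R), compact K -> K `<=` Omega -> oo_time T tau ->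
  exists M : R, forall t, 0 < t <= tau -> (\int[lebesgue_x]_(x in K) `|U (x, t)|%:E <= M%:E)%E.

(** The working form of L^1_loc([0, T); L^1_loc(Omega)): the compact sets may touch t = 0, while
    only values in the open cylinder enter. *)
Definition L1upto0 (W : spacetime -> R) :=
  measurable_fun (Q : set (space * measurableTypeR R)%type) W /\
  forall K, compact K -> K `<=` Q0 -> mu.-integrable (K `&` Q) (EFin \o W).

Let mO : measurable Omega. Proof. exact: open_measurable_rV. Qed.
Let mT : measurable (oo_time T). Proof. by apply: open_measurable; exact: open_oo_time. Qed.
Let mQ : mxt Q. Proof. by apply: open_measurable_mu; exact: open_cylinder. Qed.

Lemma itv_oo_time (tau : R) : oo_time T tau -> `]0, tau[%classic `<=` oo_time T.
Proof.
move=> [_ tT] t /=; rewrite in_itv/= => /andP[t0 tt]; split => //.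
by apply: lt_trans tT; rewrite lte_fin.
Qed.

Lemma compact_box (K : set space) (tau : R) : compact K -> K `<=` Omega -> oo_time T tau ->
  compact (K `*` `[0, tau]%classic : set spacetime) /\ K `*` `[0, tau]%classic `<=` Q0.
Proof.
move=> cK KO [t0 tT]; split; first by apply: compact_setX => //; exact: segment_compact.
move=> [x t] [/= /KO Ox]; rewrite in_itv/= => /andP[t0' tt]; split => //; split => //=.
by apply: le_lt_trans tT; rewrite lee_fin.
Qed.

Lemma box_measurable (A : set space) (tau : R) (W : spacetime -> R) : A `<=` Omega -> measurable A -> oo_time T tau ->
  measurable_fun (Q : set (space * measurableTypeR R)%type) W ->
  measurable_fun (A `*` `]0, tau[%classic : set (space * measurableTypeR R)%type) W.
Proof.
move=> AO mA Tt; apply: measurable_funS => //.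
by move=> [x t] [/= /AO Ax /(itv_oo_time Tt)].
Qed.

Lemma bounded_mass_L1upto0 : (0 < T)%E -> bounded_mass -> L1upto0 U.
Proof.
move=> T0 bU; split; first exact: LU.1.
move=> K cK KQ; have [tau Tt Ktau] := cylinder0_time T0 cK KQ.
have cKx : compact (fst @` K : set space) by exact: shadow_compact.
have KxO : fst @` K `<=` Omega by move=> _ [z /KQ[Oz _] <-].
have mKx := compact_measurable_rV cKx.
have mI : measurable `]0, tau[%classic by [].
have mU := box_measurable KxO mKx Tt LU.1.
have [M hM] := bU _ tau cKx KxO Tt.
have mKQ : mxt (K `&` Q) by apply: measurableI => //; exact: compact_measurable_mu.
have H : mu.-integrable (fst @` K `*` `]0, tau[%classic : set (space * measurableTypeR R)%type) (EFin \o U).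
  apply/integrableP; split; first exact/measurable_EFinP.
  rewrite (tonelli_box mKx mI mU).
  apply: (@le_lt_trans _ _ (\int[lebesgue_measure]_(t in `]0%R, tau[) M%:E)%E).
    apply: ge0_le_integral => //.
    - by move=> t _; apply: integral_ge0 => x _; rewrite lee_fin.
    - exact: measurable_slice_norm.
    - move=> t; rewrite /= in_itv/= => /andP[t0 tt].
      by apply: hM; rewrite t0 ltW.
  have fI : lebesgue_measure (`]0%R, tau[%classic : set R) \is a fin_num.
    by rewrite lebesgue_measure_itv/= lte_fin; case: ifP.
  by rewrite integral_cst// -[X in (_ * X)%E](fineK fI) -EFinM ltry.
apply: integrableS H => //; first exact: measurableX.
move=> z [Kz [Oz [z0 _]]]; split; first by exists z.
by rewrite /= in_itv/= z0; exact: Ktau.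
Qed.

Lemma L1upto0_Lploc (W : spacetime -> R) : L1upto0 W -> Lploc_L1loc 1%:E Omega T W.
Proof.
move=> [mW Wi]; split => // tau om Tt [oom com comO].
have omO : om `<=` Omega by apply: subset_trans comO; exact: subset_closure.
have mom := open_measurable_rV oom.
rewrite Lnorm1; set f := (X in X \_ _).
have f0 t : (0 <= f t)%E by apply: integral_ge0 => x _; rewrite lee_fin.
have -> : (\int[lebesgue_measure]_t `|(f \_ `]0%R, tau[) t| = \int[lebesgue_measure]_(t in `]0%R, tau[) f t)%E.
  rewrite [RHS]integral_mkcond; apply: eq_integral => t _; rewrite gee0_abs//.
  by rewrite patchE; case: ifPn.
have mI : measurable `]0, tau[%classic by [].
have mW' := box_measurable omO mom Tt mW.
rewrite /f -(tonelli_box mom mI mW').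
have [cB BQ] := compact_box com comO Tt.
have mcB : mxt (closure om `*` `[0, tau]%classic `&` Q).
  by apply: measurableI => //; exact: compact_measurable_mu.
have [_ /=] := integrableP _ _ _ (Wi _ cB BQ); apply: le_lt_trans.
apply: ge0_subset_integral => //; first exact: measurableX.
  by apply/measurable_EFinP; apply: measurableT_comp => //; exact: measurable_funS mW.
move=> [x t] [/= omx]; rewrite in_itv/= => /andP[t0 tt]; split.
  by split => /=; [exact: subset_closure|rewrite in_itv/= !ltW].
by split; [exact: omO|apply: (itv_oo_time Tt); rewrite /= in_itv/= t0].
Qed.

(** Makes |Phi| a legitimate choice of F: extended by 0 to t = 0, it is integrable on compact
    subsets of Omega x [0, T). *)
Lemma Lploc_L1loc_xt (W : spacetime -> R) : (0 < T)%E -> Lploc_L1loc 1%:E Omega T W ->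
  L1loc_xt Q0 ((fun z => `|W z|) \_ Q).
Proof.
move=> T0 [mW Wi].
have mW1 : measurable_fun setT ((fun z => `|W z|) \_ Q : space * measurableTypeR R -> R).
  by apply/(measurable_restrictT _ mQ); exact: measurableT_comp mW.
split; first exact: measurable_funTS.
move=> K cK KQ; have [tau Tt Ktau] := cylinder0_time T0 cK KQ.
have cKx : compact (fst @` K : set space) by exact: shadow_compact.
have KxO : fst @` K `<=` Omega by move=> _ [z /KQ[Oz _] <-].
have [om cc Kom] := compactly_contained_nbhs oO cKx KxO.
have [oom com comO] := cc.
have omO : om `<=` Omega by apply: subset_trans comO; exact: subset_closure.
have mom := open_measurable_rV oom.
have mI : measurable `]0, tau[%classic by [].
have mW' := box_measurable omO mom Tt mW.
have mB : mxt (om `*` `]0, tau[%classic) by exact: measurableX.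
apply/integrableP; split; first by apply/measurable_EFinP; exact: measurable_funTS.
have := Wi tau om Tt cc; rewrite Lnorm1; set f := (X in X \_ _).
have f0 t : (0 <= f t)%E by apply: integral_ge0 => x _; rewrite lee_fin.
have -> : (\int[lebesgue_measure]_t `|(f \_ `]0%R, tau[) t| = \int[lebesgue_measure]_(t in `]0%R, tau[) f t)%E.
  rewrite [RHS]integral_mkcond; apply: eq_integral => t _; rewrite gee0_abs//.
  by rewrite patchE; case: ifPn.
rewrite /f -(tonelli_box mom mI mW'); apply: le_lt_trans.
rewrite [leLHS]integral_mkcond [leRHS]integral_mkcond.
have mK : mxt K by exact: compact_measurable_mu.
apply: ge0_le_integral => //.
- by move=> z _; rewrite patchE; case: ifPn => // _; rewrite lee_fin.
- apply/(measurable_restrictT _ mK); apply/measurable_EFinP; apply: measurableT_comp => //.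
  exact: measurable_funTS.
- by apply/(measurable_restrictT _ mB); apply/measurable_EFinP; apply: measurableT_comp mW'.
move=> z _; rewrite [leLHS]patchE; case: ifPn => [/set_mem Kz|_]; last first.
  by rewrite patchE; case: ifPn => // _; rewrite lee_fin.
rewrite /= patchE; case: ifPn => [/set_mem [Oz [z0 zT]]|_]; last first.
  by rewrite normr0 patchE; case: ifPn => // _; rewrite lee_fin.
rewrite normr_id patchE mem_set//; split; first by apply: Kom; exists z.
by rewrite /= in_itv/= z0; exact: Ktau.
Qed.

Lemma bounded_mass_Lploc : bounded_mass -> Lploc_L1loc +oo%E Omega T U.
Proof.
move=> bU; split; first exact: LU.1.
move=> tau om Tt [oom com comO]; have [M hM] := bU _ tau com comO Tt.
have omO : om `<=` Omega by apply: subset_trans comO; exact: subset_closure.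
rewrite unlock; case: ifPn => // _.
(* The function under the norm is 0 outside ]0, tau[, hence the maximum with 0. *)
apply: (@le_lt_trans _ _ (Num.max M 0)%:E); last by rewrite ltry.
apply/ess_supP; apply: nearW => t /=; rewrite patchE; case: ifPn => [|_]; last first.
  by rewrite abse0 lee_fin le_max lexx orbT.
rewrite inE /= in_itv/= => /andP[t0 tt].
rewrite gee0_abs; last by apply: integral_ge0 => x _; rewrite lee_fin.
apply: (@le_trans _ _ M%:E); last by rewrite lee_fin le_max lexx.
apply: le_trans (hM t _); last by rewrite t0 ltW.
have Tt' : oo_time T t by apply: (itv_oo_time Tt); rewrite /= in_itv/= t0.
apply: ge0_subset_integral => //.
- exact: open_measurable_rV.
- exact: compact_measurable_rV.
- apply/measurable_EFinP; apply: measurableT_comp => //.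
  by apply: measurable_funS (CU.1 t Tt').1.
- exact: subset_closure.
Qed.

Lemma Lploc_bounded_mass : Lploc_L1loc +oo%E Omega T U -> bounded_mass.
Proof.
move=> [_ LUoo] K tau cK KO Tt.
(* [slice_bound] works on an open set of times; ]0, tau'[ with tau' > tau contains tau itself. *)
have [tau' tt' Tt'] := oo_time_gt (ltW Tt.1) Tt.2.
have [om cc Kom] := compactly_contained_nbhs oO cK KO.
have [oom com comO] := cc.
have omO : om `<=` Omega by apply: subset_trans comO; exact: subset_closure.
have := LUoo tau' om Tt' cc; rewrite unlock ifT; last by exact: lebesgue_measure_gt0.
set f := (X in X \_ _); set e := ess_sup _ _ => efin.
have f0 t : (0 <= f t)%E by apply: integral_ge0 => x _; rewrite lee_fin.
have [M eM] : exists M : R, (e <= M%:E)%E.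
  by case: e efin => [r||] // _; [exists r; exact: lexx|exists 0; exact: leNye].
exists M => t /andP[t0 tt].
apply: (@slice_bound K `]0, tau'[%classic Num.norm M cK KO) => //.
- exact: itv_oo_time.
- exact: norm_continuous.
- by move=> y y'; rewrite -lerBlDl distrC; exact: lerB_dist.
- have /ess_supP := eM; apply: filterS => r /= + Ir; rewrite patchE mem_set//.
  rewrite gee0_abs//; apply: le_trans; apply: ge0_subset_integral => //.
  + exact: compact_measurable_rV.
  + exact: open_measurable_rV.
  + apply/measurable_EFinP; apply: measurableT_comp => //.
    by apply: measurable_funS (CU.1 r (itv_oo_time Tt' Ir)).1.
- by rewrite /= in_itv/= t0; exact: le_lt_trans tt'.
Qed.
End slices.

(** * A priori bounds up to the initial time *)

Section box_test.
Context {R : realType} {N : nat}.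
Local Notation space := 'rV[R]_N.
Local Notation spacetime := ('rV[R]_N * R)%type.

(** Only the line through z in direction v matters, so the box test can be differentiated as a
    function of one real variable. *)
Lemma is_derive_line (f : spacetime -> R) (v z : spacetime) (d : R) :
  is_derive (0 : R) 1 (fun h : R => f (h *: v + z)) d -> is_derive z v f d.
Proof.
move=> [df fd].
have E : (fun h : R => h^-1 *: ((f \o shift z) (h *: v) - f z)) =
   (fun h : R => h^-1 *: (((fun h : R => f (h *: v + z)) \o shift (0 : R)) (h *: (1 : R)) - f (0 *: v + z))).
  by apply/funext => h /=; rewrite addr0 scale0r add0r /GRing.scale/= mulr1.
apply: DeriveDef; first by rewrite /derivable E.
by rewrite -fd /derive E.
Qed.

Lemma rV_norm_le (x : space) (r : R) : 0 <= r -> (`|x| <= r) = [forall i, `|x ord0 i| <= r].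
Proof.
move=> r0; apply/idP/forallP => [h i|h].
  apply: le_trans h; rewrite [leRHS]/Num.norm/= mx_normrE.
  exact: (le_bigmax _ (fun i => `|x i.1 i.2|) (ord0, i)).
rewrite [leLHS]/Num.norm/= mx_normrE; apply: bigmax_le => // -[i j] _ /=.
by rewrite ord1.
Qed.

Variables (a : space) (r t0 t1 : R).
Hypotheses (r0 : 0 < r) (t00 : 0 < t0) (t01 : t0 < t1).

Let y (i : 'I_N) (z : spacetime) : R := (z.1 ord0 i - a ord0 i) / r.
Let B (z : spacetime) : R := \prod_i bump1 (y i z).
(** The product without its factor i, which is constant along the i-th direction. *)
Let Bi (i : 'I_N) (z : spacetime) : R := \prod_(j | j != i) bump1 (y j z).
(** The constant of [bump1''_ge], divided by r^2 through the scaling and added up over the N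
    coordinates. *)
Let C : R := 64 * N%:R / r ^+ 2.
(** Exactly e^{Ct} up to t0, where the subsolution property is wanted, then switched off by time
    t1. *)
Let c (t : R) : R := expR (C * t) * (1 - step t0 (t1 - t0) t).
Let c' (t : R) : R := C * c t - expR (C * t) * step' t0 (t1 - t0) t.

Let g z := B z * c z.2.
Let gt z := B z * c' z.2.
Let gi i z := bump1' (y i z) / r * Bi i z * c z.2.
Let gii i z := bump1'' (y i z) / r ^+ 2 * Bi i z * c z.2.

Let d0 : 0 < t1 - t0. Proof. by rewrite subr_gt0. Qed.

Let c_derive (t : R) : is_derive t 1 c (c' t).
Proof.
have dE : is_derive t 1 (fun t => expR (C * t)) (C * expR (C * t)).
  apply: (@is_derive_affine R R R (fun t => C * t) (fun v => C * v) expR).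
    by move=> h; rewrite mulrDr /GRing.scale/= mulrCA.
  by rewrite mulr1; apply: is_derive_dir; exact: is_derive_expR.
have dS : is_derive t 1 (fun t => 1 - step t0 (t1 - t0) t) (0 - step' t0 (t1 - t0) t).
  by apply: is_deriveB; exact: is_derive_step.
by apply: is_derive_eq (is_deriveM dE dS) _; rewrite /GRing.scale/= /c' /c; ring.
Qed.

Let cc : continuous c.
Proof. by move=> t; apply/differentiable_continuous/derivable1_diffP; case: (c_derive t). Qed.

Let cc' : continuous c'.
Proof.
move=> t; apply: cvgB; first by apply: cvgMr; exact: cc.
apply: cvgM; last exact: continuous_step'.
apply: (@continuous_comp _ _ _ (fun t => C * t) expR); last exact: continuous_expR.
by apply: cvgMr; exact: cvg_id.
Qed.

Let cy i : continuous (y i).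
Proof.
move=> z; apply: cvgMl; apply: cvgB; last exact: cvg_cst.
apply: (@continuous_comp _ _ _ fst (fun x : space => x ord0 i)); first exact: cvg_fst.
exact: coord_continuous.
Qed.

Let cbump i : continuous (fun z => bump1 (y i z)).
Proof. by move=> z; apply: (@continuous_comp _ _ _ (y i) bump1); [exact: cy|exact: (Ck_continuous (Ck_bump1 0))]. Qed.

Let cprod (P : pred 'I_N) : continuous (fun z => \prod_(j | P j) bump1 (y j z)).
Proof.
rewrite unlock; elim: (index_enum _) => [|i s IH] /= z; first exact: cvg_cst.
by case: (P i); [apply: cvgM; [exact: cbump|exact: IH]|exact: IH].
Qed.

Let csnd (b : R -> R) : continuous b -> continuous (fun z : spacetime => b z.2).
Proof. by move=> cb z; apply: (@continuous_comp _ _ _ snd b); [exact: cvg_snd|exact: cb]. Qed.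

Let BE i z : B z = bump1 (y i z) * Bi i z.
Proof. by rewrite /B (bigD1 i). Qed.

Let y_line i (h : R) z : y i (h *: ((delta_mx 0 i, 0) : spacetime) + z) = h / r + y i z.
Proof. by rewrite /y /= !mxE !eqxx /= mulr1 -mulrDl addrA. Qed.

Let Bi_line i (h : R) z : Bi i (h *: ((delta_mx 0 i, 0) : spacetime) + z) = Bi i z.
Proof.
apply: eq_bigr => j ji; rewrite /y /= !mxE (negbTE ji) andbF mulr0 add0r//.
Qed.

Let t_line i (h : R) (z : spacetime) : (h *: ((delta_mx 0 i, 0) : spacetime) + z).2 = z.2.
Proof. by rewrite /= scaler0 add0r. Qed.

Let x_line (h : R) (z : spacetime) : (h *: ((0, 1) : spacetime) + z) = (z.1, h + z.2).
Proof.
by rewrite [z in LHS]surjective_pairing; congr pair; rewrite /= ?scaler0 ?add0r// /GRing.scale/= mulr1.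
Qed.

Let bump_line (b b' : R -> R) i z (k : R) : (forall s : R, is_derive s 1 b (b' s)) ->
  is_derive (0 : R) 1 (fun h => b (h / r + y i z) * k) (b' (y i z) / r * k).
Proof.
move=> bb'.
have D : is_derive (0 : R) 1 (fun h => b (h / r + y i z)) (r^-1 * b' (y i z)).
  apply: (@is_derive_affine R R R (fun h => h / r + y i z) (fun v => v / r) b).
    by move=> h; rewrite /GRing.scale/= mulr1 addr0 mul0r add0r mul1r.
  by rewrite mul0r add0r mul1r; apply: is_derive_dir; exact: bb'.
apply: is_derive_eq (is_deriveM D (is_derive_cst k (0 : R) 1)) _.
by rewrite /GRing.scale/=; ring.
Qed.

Lemma box_C21 : C21 g gt gi gii.
Proof.
have cB1 : continuous (bump1' : R -> R) by move=> s; apply/differentiable_continuous/derivable1_diffP; case: (is_derive_bump1' s).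
have cfl n : continuous (@flat R n) by exact: (Ck_continuous (Ck_flat 0 n)).
have cB2 : continuous (bump1'' : R -> R).
  have c1 n : continuous (fun s : R => flat n (1 + s)).
    move=> s; apply: (@continuous_comp R R R (fun s : R => 1 + s) (flat n)); last exact: cfl.
    by apply: cvgD; [exact: cvg_cst|exact: cvg_id].
  have c2 n : continuous (fun s : R => flat n (1 - s)).
    move=> s; apply: (@continuous_comp R R R (fun s : R => 1 - s) (flat n)); last exact: cfl.
    by apply: cvgB; [exact: cvg_cst|exact: cvg_id].
  move=> s; apply: cvgD.
    apply: cvgB; first by apply: cvgM; [apply: cvgB; [exact: c1|apply: cvgMr; exact: c1]|exact: c2].
    by apply: cvgMr; apply: cvgM; [exact: c1|exact: c2].
  by apply: cvgM; [exact: c1|apply: cvgB; [exact: c2|apply: cvgMr; exact: c2]].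
split.
- by move=> z; apply: cvgM; [exact: cprod|exact: csnd].
- by move=> z; apply: cvgM; [exact: cprod|exact: csnd].
- move=> i z; apply: cvgM; last exact: csnd.
  apply: cvgM; last exact: cprod.
  by apply: cvgMl; apply: (@continuous_comp _ _ _ (y i) bump1'); [exact: cy|exact: cB1].
- move=> i z; apply: cvgM; last exact: csnd.
  apply: cvgM; last exact: cprod.
  by apply: cvgMl; apply: (@continuous_comp _ _ _ (y i) bump1''); [exact: cy|exact: cB2].
- move=> z; apply: is_derive_line.
  rewrite (_ : (fun h => _) = (fun h => B z * c (h + z.2))); last first.
    by apply/funext => h; rewrite x_line.
  have D : is_derive (0 : R) 1 (fun h => c (h + z.2)) (c' z.2).
    apply: (@is_derive_affine R R R (fun h => h + z.2) id c); first by move=> h; rewrite addrA.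
    by rewrite add0r; exact: c_derive.
  apply: is_derive_eq (is_deriveM (is_derive_cst (B z) (0 : R) 1) D) _.
  by rewrite /GRing.scale/= /gt; ring.
- move=> i z; apply: is_derive_line.
  rewrite (_ : (fun h => _) = (fun h => bump1 (h / r + y i z) * (Bi i z * c z.2))); last first.
    by apply/funext => h; rewrite /g (BE i) y_line Bi_line t_line mulrA.
  by rewrite /gi -mulrA; apply: bump_line => s; exact: is_derive_bump1.
- move=> i z; apply: is_derive_line.
  rewrite (_ : (fun h => _) = (fun h => bump1' (h / r + y i z) * (r^-1 * Bi i z * c z.2))); last first.
    by apply/funext => h; rewrite /gi y_line Bi_line t_line !mulrA.
  rewrite (_ : gii i z = bump1'' (y i z) / r * (r^-1 * Bi i z * c z.2)); last first.
    by rewrite /gii expr2 invfM; ring.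
  by apply: bump_line => s; exact: is_derive_bump1'.
Qed.

Let c_ge0 t : 0 <= c t.
Proof.
have /andP[h1 h2] := step_ge0_le1 t0 (t1 - t0) t.
by rewrite mulr_ge0 ?expR_ge0// subr_ge0.
Qed.

Let B_ge0 z : 0 <= B z. Proof. by apply: prodr_ge0 => i _; exact: bump1_ge0. Qed.

Lemma box_ge0 z : 0 <= g z. Proof. by rewrite mulr_ge0. Qed.

Lemma box_supp z : ~ ([set x : space | `|x - a| <= r] `*` [set t | t <= t1]) z -> g z = 0.
Proof.
move=> /not_andP[/negP|/negP] /=.
  rewrite (rV_norm_le _ (ltW r0)) negb_forall => /existsP[i]; rewrite !mxE -ltNge => hi.
  rewrite /g (BE i) bump1_eq0 ?mul0r// /y normrM normfV (gtr0_norm r0).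
  by rewrite ler_pdivlMr// mul1r ltW.
rewrite -ltNge => tt; rewrite /g /c step1 ?subrr ?mulr0//.
by rewrite addrC subrK ltW.
Qed.

(** For t <= t0 the time derivative is exactly C g; sharing C among the coordinates leaves in each
    of them the nonnegative quantity 64 bump1 + bump1''. *)
Lemma box_subsolution z : z.2 <= t0 -> 0 <= gt z + \sum_i gii i z.
Proof.
move=> zt; have -> : gt z = C * g z.
  by rewrite /gt /g /c' step'_eq0//; [rewrite mulr0 subr0; ring|left].
have -> : C * g z = \sum_(i < N) (64 / r ^+ 2 * g z).
  by rewrite sumr_const card_ord -mulr_natl /C; ring.
rewrite -big_split/=; apply: sumr_ge0 => i _.
have -> : 64 / r ^+ 2 * g z + gii i z = (64 * bump1 (y i z) + bump1'' (y i z)) / r ^+ 2 * Bi i z * c z.2.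
  by rewrite /gii /g (BE i); ring.
rewrite mulr_ge0// mulr_ge0//; last by apply: prodr_ge0 => j _; exact: bump1_ge0.
rewrite mulr_ge0//.
- by have := bump1''_ge (y i z); rewrite mulNr -subr_ge0 opprK addrC.
- by rewrite invr_ge0 sqr_ge0.
Qed.

(** At half radius each bump is at least e^(-4), and e^{Ct} >= 1 for t >= 0. *)
Lemma box_lower : exists2 k : R, 0 < k & forall z, `|z.1 - a| <= r / 2 -> 0 <= z.2 <= t0 -> k <= g z.
Proof.
have flat_lower (s : R) : 2^-1 <= s -> expR (- 2) <= flat 0 s.
  move=> s2; have s0 : 0 < s by apply: lt_le_trans s2.
  rewrite /flat s0 expr0 mul1r ler_expR lerN2 invf_ple// ?posrE//.
exists ((expR (- 2) * expR (- 2)) ^+ N); first by rewrite exprn_gt0// mulr_gt0// expR_gt0.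
have r20 : 0 <= r / 2 by rewrite divr_ge0// ltW.
move=> z; rewrite (rV_norm_le _ r20) => /forallP hz /andP[z0 zt].
rewrite -[leLHS]mulr1; apply: ler_pM => //.
- rewrite /B -[X in _ ^+ X](card_ord N) -prodr_const; apply: ler_prod => i _.
  rewrite mulr_ge0 ?expR_ge0//=.
  have : `|y i z| <= 2^-1.
    have := hz i; rewrite !mxE /y normrM normfV (gtr0_norm r0).
    by rewrite ler_pdivrMr// mulrC.
  rewrite ler_norml => /andP[y1 y2].
  by apply: ler_pM; rewrite ?expR_ge0//; apply: flat_lower; lra.
- rewrite /c step0// subr0 mulr1 -expR0 ler_expR mulr_ge0//.
  by rewrite /C !mulr_ge0// invr_ge0 sqr_ge0.
Qed.

Lemma box_test_function : exists g gt gi gii, [/\ C21 g gt gi gii,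
    forall z, 0 <= g z,
    forall z, ~ ([set x : space | `|x - a| <= r] `*` [set t | t <= t1]) z -> g z = 0,
    forall z, z.2 <= t0 -> 0 <= gt z + \sum_i gii i z &
    exists2 k : R, 0 < k & forall z, `|z.1 - a| <= r / 2 -> 0 <= z.2 <= t0 -> k <= g z].
Proof.
exists g, gt, gi, gii; split.
- exact: box_C21.
- exact: box_ge0.
- exact: box_supp.
- exact: box_subsolution.
- exact: box_lower.
Qed.
End box_test.

Section admissible_intro.
Context {R : realType} {N : nat}.
Local Notation space := 'rV[R]_N.
Local Notation spacetime := ('rV[R]_N * R)%type.
Variables (Omega : set space) (T : \bar R).
Hypothesis oO : open Omega.
Local Notation Q := (cylinder Omega T).
Local Notation Q0 := (cylinder0 Omega T).
Implicit Types (g gt : spacetime -> R) (gi gii : 'I_N -> spacetime -> R).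

(** Bounds are asked on K only, where compactness provides them; off K the function and its
    derivatives vanish. *)
Lemma admissible_intro (K : set spacetime) g gt gi gii : compact K -> K `<=` Q0 ->
  (forall z, Q z -> {for z, continuous g}) -> (forall z, Q z -> {for z, continuous gt}) ->
  (forall i z, Q z -> {for z, continuous (gi i)}) -> (forall i z, Q z -> {for z, continuous (gii i)}) ->
  (forall z, Q z -> is_derive z ((0, 1) : spacetime) g (gt z)) ->
  (forall i z, Q z -> is_derive z ((delta_mx 0 i, 0) : spacetime) g (gi i z)) ->
  (forall i z, Q z -> is_derive z ((delta_mx 0 i, 0) : spacetime) (gi i) (gii i z)) ->
  (forall z, Q z -> ~ K z -> g z = 0) ->
  (exists M, forall z, Q z -> K z -> `|g z| <= M) -> (exists M, forall z, Q z -> K z -> `|gt z| <= M) ->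
  (forall i, exists M, forall z, Q z -> K z -> `|gii i z| <= M) ->
  exists2 M : R, 0 <= M & admissible Omega T K M g gt gi gii.
Proof.
move=> cK KQ c1 c2 c3 c4 d1 d2 d3 g0 [M1 b1] [M2 b2] /choice[M3 b3].
have clK := supp_closed cK.
have gt0 z : Q z -> ~ K z -> gt z = 0 by move=> Qz nK; exact: (derive_off_open oO clK g0 Qz nK (d1 z Qz)).
have gi0 i z : Q z -> ~ K z -> gi i z = 0 by move=> Qz nK; exact: (derive_off_open oO clK g0 Qz nK (d2 i z Qz)).
have gii0 i z : Q z -> ~ K z -> gii i z = 0 by move=> Qz nK; exact: (derive_off_open oO clK (gi0 i) Qz nK (d3 i z Qz)).
pose M := `|M1| + `|M2| + \sum_i `|M3 i|.
have S0 : 0 <= \sum_i `|M3 i| by exact: sumr_ge0.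
have M0 : 0 <= M by rewrite !addr_ge0.
have bnd (h : spacetime -> R) M' : M' <= M -> (forall z, Q z -> ~ K z -> h z = 0) -> (forall z, Q z -> K z -> `|h z| <= M') ->
    forall z, Q z -> `|h z| <= M.
  move=> MM h0 hM z Qz; have [Kz|nK] := pselect (K z); first exact: le_trans (hM z Qz Kz) MM.
  by rewrite h0// normr0.
exists M => //; split => //.
- apply: bnd g0 b1; rewrite /M -addrA; apply: le_trans (ler_norm _) _.
  by rewrite lerDl addr_ge0.
- apply: bnd gt0 b2; apply: le_trans (ler_norm _) _.
  by rewrite /M (addrC `|M1|) -addrA lerDl addr_ge0.
- move=> i; apply: bnd (gii0 i) (b3 i); apply: le_trans (ler_norm _) _.
  rewrite /M (bigD1 i)//= addrCA lerDl !addr_ge0//; exact: sumr_ge0.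
Qed.

Lemma C21_admissible (K : set spacetime) g gt gi gii : C21 g gt gi gii -> compact K -> K `<=` Q0 ->
  (forall z, Q z -> ~ K z -> g z = 0) -> exists2 M : R, 0 <= M & admissible Omega T K M g gt gi gii.
Proof.
move=> [c1 c2 c3 c4 d1 d2 d3] cK KQ g0.
have bnd (h : spacetime -> R) : continuous h -> exists M, forall z, Q z -> K z -> `|h z| <= M.
  move=> ch; have [M _ hM] := within_bounded (continuous_subspaceT ch) cK.
  by exists M => z _; exact: hM.
apply: admissible_intro => //.
- by move=> z _; exact: c1.
- by move=> z _; exact: c2.
- by move=> i z _; exact: c3.
- by move=> i z _; exact: c4.
- exact: bnd.
- exact: bnd.
- by move=> i; exact: bnd.
Qed.

Lemma open_below (t : R) : open (Omega `*` [set s : R | s < t]).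
Proof.
rewrite openE => -[x s] [/= Ox st]; exists (Omega, [set s : R | s < t]) => //=; split.
  exact: open_nbhs_nbhs.
by apply: open_nbhs_nbhs; split => //; exact: open_lt.
Qed.

(** A test that is regular on all of space-time may live at negative times too; only its part at t
    >= 0 has to fit in Omega x [0, T). *)
Lemma late_admissible (K : set spacetime) g gt gi gii (t : R) : C21 g gt gi gii -> oo_time T t ->
  compact K -> K `<=` Omega `*` [set s : R | s < t] -> (forall z, ~ K z -> g z = 0) ->
  exists2 M : R, 0 <= M & admissible Omega T (late K 0) M g gt gi gii.
Proof.
move=> gC [_ tT] cK KW g0; apply: (C21_admissible gC).
- exact: late_compact.
- move=> [x s] [/KW[Ox /= st] s0]; split => //; split => //=.
  by apply: lt_trans tT; rewrite lte_fin.
- by move=> z [_ [z0 _]] nK; apply: g0 => Kz; apply: nK; split => //; exact: ltW.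
Qed.
End admissible_intro.

Section ae_monotone.
Context d (T : measurableType d) (R : realType) (mu : {measure set T -> \bar R}).
Variables (D : set T).
Hypothesis mD : measurable D.
Implicit Types f g : T -> R.

(** Replaces an almost everywhere nonnegative integrand by an everywhere nonnegative one, to which
    the results on nonnegative integrals apply. *)
Lemma Rintegral_ae_ge0 f : mu.-integrable D (EFin \o f) -> {ae mu, forall x, D x -> 0 <= f x} ->
  (\int[mu]_(x in D) (f x)%:E = \int[mu]_(x in D) (Num.max (f x) 0)%:E)%E.
Proof.
move=> fi f0; have mf : measurable_fun D f by apply/measurable_EFinP; exact: measurable_int fi.
apply: ae_eq_integral => //; first exact/measurable_EFinP.
  apply/measurable_EFinP; apply: (@measurableT_comp _ _ _ _ _ _ (fun y : R => Num.max y 0)) => //.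
  by apply: continuous_measurable_fun; exact: continuous_pos_part.
by apply: filterS f0 => x f0 Dx /=; rewrite max_l// f0.
Qed.

Lemma ae_le_Rintegral f g : mu.-integrable D (EFin \o f) -> mu.-integrable D (EFin \o g) ->
  {ae mu, forall x, D x -> f x <= g x} -> \int[mu]_(x in D) f x <= \int[mu]_(x in D) g x.
Proof.
move=> fi gi fg; rewrite -subr_ge0 -RintegralB//.
have hi : mu.-integrable D (EFin \o (fun x => g x - f x)).
  by have := integrableB mD gi fi; apply: eq_integrable.
rewrite /Rintegral Rintegral_ae_ge0//; first by apply: fine_ge0; apply: integral_ge0 => x _; rewrite lee_fin le_max lexx orbT.
by apply: filterS fg => x fg Dx; rewrite subr_ge0 fg.
Qed.
End ae_monotone.

Section a_priori.
Context {R : realType} {N : nat}.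
Local Notation space := 'rV[R]_N.
Local Notation spacetime := ('rV[R]_N * R)%type.
Local Notation mu := (@lebesgue_xt R N).
Local Notation mxt := (@measurable _ (space * measurableTypeR R)%type).
Variables (Omega : set space) (T : \bar R) (U Phi : spacetime -> R).
Local Notation Q := (cylinder Omega T).
Local Notation Q0 := (cylinder0 Omega T).
Hypotheses (oO : open Omega) (T0 : (0 < T)%E).
Hypotheses (LU : L1loc_xt Q U) (LPhi : L1loc_xt Q Phi).
Hypothesis weakU : forall phi, test_function Q phi -> (forall z, Q z -> 0 <= phi z) ->
  heat_integral Omega T U Phi phi = 0%E.
Hypothesis CU : C_L1loc Omega T U.
Hypothesis U0 : {ae mu, forall z, Q z -> 0 <= U z}.

Let mO : measurable Omega. Proof. exact: open_measurable_rV. Qed.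
Let mQ : mxt Q. Proof. by apply: open_measurable_mu; exact: open_cylinder. Qed.

Local Notation D s := (Q `&` [set z : spacetime | s < z.2]).

Lemma late_cylinder_measurable (s : R) : mxt (D s).
Proof.
apply: open_measurable_mu; apply: openI; first exact: open_cylinder.
apply: (@open_comp _ _ (fun z : spacetime => z.2) [set x : R | s < x]); last exact: open_gt.
by move=> z _; exact: cvg_snd.
Qed.

Lemma cylinder_sub0 : Q `<=` Q0.
Proof. by move=> [x t] [Ox [/= t0 tT]]; split => //; split => //; exact: ltW. Qed.

Lemma L1loc_xt_L1upto0 (F : spacetime -> R) : L1loc_xt Q0 F -> L1upto0 Omega T F.
Proof.
move=> [mF iF]; split.
  apply: (@measurable_funS _ _ _ _ Q0) => //; last exact: cylinder_sub0.
  have -> : Q0 = Omega `*` co_time T by [].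
  apply: measurableX => //.
  rewrite (_ : co_time T = [set 0] `|` oo_time T); first by apply: measurableU => //; apply: open_measurable; exact: open_oo_time.
  apply/seteqP; split => [t [t0 tT]|t [->|[t0 tT]]]; last by split => //; exact: ltW.
    by have [->|tn] := eqVneq t 0; [left|right; split => //; rewrite lt_neqAle eq_sym tn].
  by split => //=.
move=> K cK KQ; apply: integrableS (iF K cK KQ) => //; first exact: compact_measurable_mu.
by apply: measurableI => //; exact: compact_measurable_mu.
Qed.

Lemma L1upto0_mul (W h : spacetime -> R) (K : set spacetime) (M : R) : L1upto0 Omega T W ->
  compact K -> K `<=` Q0 -> (forall z, Q z -> {for z, continuous h}) ->
  (forall z, Q z -> ~ K z -> h z = 0) -> (forall z, Q z -> `|h z| <= M) ->
  mu.-integrable Q (EFin \o (fun z => W z * h z)).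
Proof.
move=> [mW Wi] cK KQ ch h0 hM.
have mKQ : mxt (K `&` Q) by apply: measurableI => //; exact: compact_measurable_mu.
have KQQ : K `&` Q `<=` Q by move=> z [].
apply: (@integrable_supported_mul _ (space * measurableTypeR R)%type R mu _ _ mKQ mQ KQQ W h M).
- exact: Wi.
- by apply: continuous_in_measurable => //.
- by move=> z [_ Qz]; exact: hM.
- by move=> z Qz nK; apply: h0 => // Kz; exact: nK.
Qed.

Section one_test.
Variables (K : set spacetime) (M : R) (g gt : spacetime -> R) (gi gii : 'I_N -> spacetime -> R).
Hypothesis A : admissible Omega T K M g gt gi gii.

Lemma adm_heat_bound z : Q z -> `|gt z + \sum_i gii i z| <= M * (1 + N%:R).
Proof.
move=> Qz; apply: le_trans (ler_normD _ _) _; rewrite mulrDr mulr1; apply: lerD; first exact: (adm_Mt A).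
apply: le_trans (ler_norm_sum _ _ _) _.
by apply: le_trans (ler_sum _ (fun i _ => adm_Mii A i Qz)) _; rewrite sumr_const card_ord mulr_natr.
Qed.

Lemma adm_heat_continuous z : Q z -> {for z, continuous (fun z => gt z + \sum_i gii i z)}.
Proof.
move=> Qz; apply: cvgD; first exact: (adm_ct A).
rewrite unlock; elim: (index_enum _) => [|i l IH] /=; first exact: cst_continuous.
by apply: cvgD; [exact: (adm_cii A)|exact: IH].
Qed.

Lemma adm_heat_supp z : Q z -> ~ K z -> gt z + \sum_i gii i z = 0.
Proof.
move=> Qz nK; have [gt0 _ gii0] := adm_supp oO A.
by rewrite gt0// add0r big1// => i _; exact: gii0.
Qed.

Lemma heat_densityE z : heat_density U Phi g gt gii z = U z * (gt z + \sum_i gii i z) + Phi z * g z.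
Proof. by rewrite /heat_density mulrDr. Qed.

Lemma mass_le t M' : oo_time T t -> 0 <= M ->
  (\int[lebesgue_x]_(x in fst @` K) `|U (x, t)|%:E <= M'%:E)%E -> `|mass Omega U g t| <= M * M'.
Proof.
move=> Tt M0 hM'.
have cK := adm_K A; have KQ := adm_KQ A.
have := slice_le oO cK KQ Tt (adm_c A) (adm_0 A) (adm_M A) (CU.1 t Tt).
move=> /le_trans; apply; rewrite ler_wpM2l//.
have fi : lebesgue_x.-integrable (fst @` K) (EFin \o (fun x => U (x, t))).
  by apply: (CU.1 t Tt).2; [exact: shadow_compact|exact: shadow_sub KQ].
have := integrable_fin_num _ (integrable_norm fi) => /(_ (compact_measurable_rV (shadow_compact cK))) fin.
by rewrite -lee_fin /Rintegral fineK.
Qed.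

Section bound.
Variable F : spacetime -> R.
Hypotheses (LF : L1upto0 Omega T F) (FPhi : {ae mu, forall z, Q z -> - F z <= Phi z}).
Variable tau : R.
Hypotheses (tau0 : 0 < tau) (g_ge0 : forall z, 0 <= g z) (M0 : 0 <= M).
Hypothesis sub : forall z, z.2 <= tau -> 0 <= gt z + \sum_i gii i z.

Lemma subsolution_mass_bound : exists M', forall s, 0 < s -> oo_time T s -> mass Omega U g s <= M'.
Proof.
have cK := adm_K A; have KQ := adm_KQ A.
(* An integrable bound for - heat_density that does not depend on s: - Phi g is at most M |F| on K,
   and - U (g_t + Lap g) is nonpositive up to tau and at most M (1 + N) |U| afterwards, where U is
   integrable. *)
pose G z := M * ((fun z => `|F z|) \_ (K `&` Q)) z + M * (1 + N%:R) * ((fun z => `|U z|) \_ (late K tau)) z.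
have mKQ : mxt (K `&` Q) by apply: measurableI => //; exact: compact_measurable_mu.
have cl : compact (late K tau) by exact: late_compact.
have ml : mxt (late K tau) by exact: compact_measurable_mu.
have lQ := late_sub KQ tau0.
have i1 : mu.-integrable Q (EFin \o ((fun z => `|F z|) \_ (K `&` Q))).
  apply: (@integrableS _ _ _ mu setT) => //.
  have := integrable_norm (LF.2 K cK KQ) => /(integrable_mkcond _ mKQ); apply: eq_integrable => // z _.
  by rewrite /= !patchE; case: ifPn.
have i2 : mu.-integrable Q (EFin \o ((fun z => `|U z|) \_ (late K tau))).
  apply: (@integrableS _ _ _ mu setT) => //.
  have := integrable_norm (LU.2 _ cl lQ) => /(integrable_mkcond _ ml); apply: eq_integrable => // z _.
  by rewrite /= !patchE; case: ifPn.
have Gi : mu.-integrable Q (EFin \o G).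
  have := integrableD mQ (integrableZl mQ M i1) (integrableZl mQ (M * (1 + N%:R)) i2).
  by apply: eq_integrable.
have p0 (f : spacetime -> R) (B : set spacetime) z : 0 <= ((fun z => `|f z|) \_ B) z.
  by rewrite patchE; case: ifPn.
have G0 z : 0 <= G z by rewrite addr_ge0// mulr_ge0// mulr_ge0// addr_ge0.
exists (\int[mu]_(z in Q) G z) => s s0 Ts.
have := mass_identity oO LU LPhi weakU CU A Ts.
have mD := late_cylinder_measurable s.
have Hi := heat_density_integrable oO LU LPhi A s0.
move=> /eqP; rewrite addr_eq0 => /eqP ->.
have GDi : mu.-integrable (D s) (EFin \o G) by apply: (@integrableS _ _ _ mu Q).
apply: (@le_trans _ _ (\int[mu]_(z in D s) G z)); last first.
  by apply: (@ge0_subset_Rintegral _ _ _ mu Q).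
have NHi : mu.-integrable (D s) (EFin \o (fun z => (-1) * heat_density U Phi g gt gii z)).
  by have := integrableZl mD (-1) Hi; apply: eq_integrable.
rewrite -mulN1r -(RintegralZl (-1) mD Hi).
apply: (@ae_le_Rintegral _ (space * measurableTypeR R)%type R mu (D s) mD) => //.
apply: ae_xtS (ae_xtI U0 FPhi) => z [Uz Fz] [Qz sz].
rewrite heat_densityE mulN1r opprD.
have [Kz|nK] := pselect (K z); last by rewrite adm_heat_supp// (adm_0 A)// !mulr0 subr0 oppr0.
rewrite /G patchE mem_set// addrC; apply: lerD.
  apply: (@le_trans _ _ (F z * g z)); first by rewrite -mulNr ler_wpM2r// lerNl Fz.
  apply: le_trans (_ : `|F z| * g z <= _); first by rewrite ler_wpM2r// ler_norm.
  rewrite mulrC ler_wpM2r//; apply: le_trans (ler_norm _) _; exact: (adm_M A).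
have [zt|tz] := leP z.2 tau.
  by apply: (@le_trans _ _ 0); [rewrite oppr_le0 mulr_ge0 ?Uz ?sub|rewrite mulr_ge0// mulr_ge0// addr_ge0].
rewrite patchE mem_set; last by split => //; exact: ltW.
apply: le_trans (ler_norm _) _; rewrite normrN normrM mulrC ler_wpM2r//.
exact: adm_heat_bound.
Qed.
End bound.
End one_test.

Section bounded.
Variable F : spacetime -> R.
Hypotheses (LF : L1upto0 Omega T F) (FPhi : {ae mu, forall z, Q z -> - F z <= Phi z}).
Variable tau : R.
Hypothesis Ttau : oo_time T tau.

(** The box test is at least k on the half-size ball throughout [0, tau], so k times the mass there
    is at most [mass g], which [subsolution_mass_bound] controls. *)
Lemma ball_mass_bound (a : space) (r : R) : 0 < r -> [set x | `|x - a| <= r] `<=` Omega ->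
  exists M : R, forall t B, 0 < t <= tau -> measurable B -> B `<=` ball a (r / 2) ->
    (\int[lebesgue_x]_(x in B) `|U (x, t)|%:E <= M%:E)%E.
Proof.
move=> r0 BO; have tau0 : 0 < tau by case: Ttau.
(* A time t1 > tau leaves room to switch the test off before T. *)
have [t1 tt1 Tt1] := oo_time_gt (ltW tau0) Ttau.2.
have [g [gt [gi [gii [gC g0 gK gsub [k k0 gk]]]]]] := box_test_function a r0 tt1.
have cB : compact [set x : space | `|x - a| <= r].
  apply: bounded_closed_compact.
    exists (`|a| + r); split; first exact: num_real.
    move=> y dy x /= xr; apply/ltW/(le_lt_trans _ dy); rewrite -(subrK a x) addrC.
    by apply: le_trans (ler_normD _ _) _; rewrite lerD2l.
  apply: (@preimage_closed _ _ (fun w : space => `|w - a|) [set y : R | y <= r]); last exact: closed_le.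
  move=> x _; apply: (@continuous_comp _ _ _ (fun w : space => w - a) Num.norm); last exact: norm_continuous.
  exact: (cvgB cvg_id (cvg_cst a)).
have [cK KQ] := compact_box cB BO Tt1.
have gK' z : Q z -> ~ ([set x : space | `|x - a| <= r] `*` `[0, t1]%classic) z -> g z = 0.
  move=> [_ [z0 _]] nK; apply: gK => -[xr zt]; apply: nK; split => //.
  by rewrite /= in_itv/= ltW.
have [M M0 A] := C21_admissible oO gC cK KQ gK'.
have [M' hM'] := subsolution_mass_bound A LF FPhi tau0 g0 M0 gsub.
exists (M' / k) => t B /andP[t0 tt] mB Ba.
have Tt : oo_time T t by split => //; apply: le_lt_trans Ttau.2; rewrite lee_fin.
have BK : B `<=` [set x | `|x - a| <= r].
  move=> x /Ba; rewrite -ball_normE /ball_/= distrC => /ltW/le_trans; apply.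
  by rewrite ler_pdivrMr// ler_pMr// ler1n.
have Bi : lebesgue_x.-integrable B (EFin \o (fun x => U (x, t))).
  by apply: integrableS ((CU.1 t Tt).2 _ cB BO) => //; exact: compact_measurable_rV.
have BO' : B `<=` Omega by exact: subset_trans BO.
have Bni : lebesgue_x.-integrable Omega (EFin \o ((fun x => `|U (x, t)|) \_ B)).
  apply: (@integrableS _ _ _ lebesgue_x setT) => //.
  have := integrable_norm Bi => /(integrable_mkcond _ mB); apply: eq_integrable => // x _.
  by rewrite /= !patchE; case: ifPn.
have RB : \int[lebesgue_x]_(x in Omega) ((fun x => `|U (x, t)|) \_ B) x = \int[lebesgue_x]_(x in B) `|U (x, t)|.
  by rewrite -Rintegral_mkcondr setIidr.
have fin := integrable_fin_num mB (integrable_norm Bi).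
rewrite -(fineK fin) lee_fin ler_pdivlMr// mulrC.
apply: le_trans (hM' t t0 Tt); rewrite -[fine _]/(Rintegral _ _ _) -RB -RintegralZl//.
apply: (@ae_le_Rintegral _ space R lebesgue_x Omega mO).
- by have := integrableZl mO k Bni; apply: eq_integrable.
- exact: (slice_integrable oO cK KQ Tt (adm_c A) (adm_0 A) (adm_M A) (CU.1 t Tt)).
apply: filterS (slice_ge0 oO CU LU U0 cB BO Tt) => x Ux Ox.
rewrite patchE; case: ifPn => [/set_mem Bx|_].
  have xr := BK _ Bx; rewrite ger0_norm ?Ux// mulrC ler_wpM2l ?Ux//.
  apply: gk => /=; last by rewrite tt ltW.
  by have := Ba _ Bx; rewrite -ball_normE /ball_/= distrC => /ltW.
rewrite mulr0; have [xr|nx] := pselect ([set x : space | `|x - a| <= r] x); first by rewrite mulr_ge0 ?Ux.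
by rewrite gK ?mulr0// => -[].
Qed.

Lemma mass_bounded K : compact K -> K `<=` Omega -> exists M : R, forall t, 0 < t <= tau ->
  (\int[lebesgue_x]_(x in K) `|U (x, t)|%:E <= M%:E)%E.
Proof.
move=> cK KO.
have /choice[r hr] (a : space) : exists r : R, 0 < r /\ (Omega a -> [set x | `|x - a| <= r] `<=` Omega).
  have [Oa|nO] := pselect (Omega a); last by exists 1; split.
  have /nbhs_ballP[e /= e0 he] : nbhs a Omega by exact: open_nbhs_nbhs.
  exists (e / 2); split; first by rewrite divr_gt0.
  move=> _ x /= xa; apply: he; rewrite -ball_normE /ball_/= distrC; apply: le_lt_trans xa _.
  by rewrite ltr_pdivrMr// ltr_pMr// ltr1n.
have r0 a : 0 < r a / 2 by rewrite divr_gt0//; case: (hr a).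
have := cK; rewrite compact_cover => /(_ _ K (fun a => ball a (r a / 2)))[].
- by move=> a _; exact: ball_open.
- by move=> x Kx; exists x => //; exact: ballxx.
move=> D' D'K KD'.
(* Induction on the finite cover, for all measurable B at once: B is split along one ball, and the
   rest is covered by the others. *)
have : forall s : seq space, (forall a, a \in s -> Omega a) -> exists M : R, forall t B, 0 < t <= tau ->
    measurable B -> B `<=` Omega -> (forall x, B x -> exists2 a, a \in s & ball a (r a / 2) x) ->
    (\int[lebesgue_x]_(x in B) `|U (x, t)|%:E <= M%:E)%E.
  elim=> [|a s IH] sO.
    exists 0 => t B _ _ _ B0; rewrite (_ : B = set0) ?integral_set0//.
    by apply/seteqP; split => // x /B0[].
  have sO' b : b \in s -> Omega b by move=> sb; apply: sO; rewrite in_cons sb orbT.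
  have [M1 h1] := IH sO'.
  have Oa : Omega a by apply: sO; rewrite mem_head.
  have [M2 h2] := ball_mass_bound (hr a).1 ((hr a).2 Oa).
  exists (M2 + M1) => t B tt mB BO Bs.
  have mba : measurable (ball a (r a / 2)) by exact: measurable_ball_rV.
  have Tt : oo_time T t by case/andP: tt => t0 tt; split => //; apply: le_lt_trans Ttau.2; rewrite lee_fin.
  have mU : measurable_fun B (fun x => `|U (x, t)|%:E).
    apply/measurable_EFinP; apply: measurableT_comp => //.
    by apply: measurable_funS (CU.1 t Tt).1.
  have BE : (B `&` ball a (r a / 2)) `|` (B `\` ball a (r a / 2)) = B.
    by rewrite setDE -setIUr setUv setIT.
  rewrite -BE ge0_integral_setU//.
  - rewrite EFinD; apply: leeD; first by apply: h2 => //; exact: measurableI.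
    apply: h1 => //; first exact: measurableD.
      by move=> x [/BO].
    move=> x [/Bs[b]]; rewrite in_cons => /orP[/eqP->//|sb bx _].
    by exists b.
  - exact: measurableI.
  - exact: measurableD.
  - by rewrite BE.
  - by apply/eqP/seteqP; split => // x [[_ bx] [_]]; apply.
have D'O a : a \in finmap.enum_fset D' -> Omega a by move=> /D'K; rewrite inE => /KO.
move=> /(_ _ D'O)[M hM]; exists M => t tt; apply: hM => //; first exact: compact_measurable_rV.
Qed.
End bounded.

Theorem lower_bound_bounded_mass F : L1upto0 Omega T F -> {ae mu, forall z, Q z -> - F z <= Phi z} ->
  bounded_mass Omega T U.
Proof. by move=> LF FPhi K tau cK KO Tt; exact: (mass_bounded LF FPhi Tt cK KO). Qed.

(** * Integrability of [Phi] up to t = 0, from a one-sided bound on [Phi] or on [- Phi] *)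

Section signed.
Variables (F : spacetime -> R) (sg : R).
Hypotheses (sg2 : sg * sg = 1) (LF : L1upto0 Omega T F).
Hypothesis FPhi : {ae mu, forall z, Q z -> 0 <= sg * Phi z + F z}.
Hypothesis bU : bounded_mass Omega T U.

(* With g a cutoff, the mass identity bounds the integral of (sg Phi + F) g on
   {t > s} independently of s. *)
Lemma signed_L1upto0 : L1upto0 Omega T Phi.
Proof.
have sgn : `|sg| = 1.
  apply/eqP; rewrite -(@eqrXn2 _ 2)// ?expr1n//.
  by rewrite expr2 -normrM sg2 normr1.
have LU0 : L1upto0 Omega T U by exact: bounded_mass_L1upto0.
split; first by case: LPhi.
move=> K cK KQ; have [tau Tt Ktau] := cylinder0_time T0 cK KQ.
have tau0 : 0 < tau by case: Tt.
have [t1 tt1 Tt1] := oo_time_gt (ltW tau0) Tt.2.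
have cKx : compact (fst @` K : set space) by exact: shadow_compact.
have KxO : fst @` K `<=` Omega by exact: shadow_sub KQ.
have [cB BQ] := compact_box cKx KxO Tt.
have BW : fst @` K `*` `[0, tau]%classic `<=` Omega `*` [set t : R | t < t1].
  move=> [x t] [/= /KxO Ox]; rewrite in_itv/= => /andP[_ tt]; split => //=.
  exact: le_lt_trans tt1.
have [g [K' [kg g0 g1 [cK' K'W] gK']]] := smooth_cutoff cB (@open_below _ _ _ oO t1) BW.
have [gt [gi [gii gC]]] := smooth_C21 kg.
have [M M0 A] := late_admissible oO gC Tt1 cK' K'W gK'.
set Kc := late K' 0 in A.
have cKc := adm_K A; have KcQ := adm_KQ A.
have cS : compact (fst @` Kc : set space) by exact: shadow_compact.
have SO : fst @` Kc `<=` Omega by exact: shadow_sub KcQ.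
have [M1 hM1] := bU cS SO Tt.
have ULi := L1upto0_mul LU0 cKc KcQ (adm_heat_continuous A) (adm_heat_supp A) (adm_heat_bound A).
have Fgi := L1upto0_mul LF cKc KcQ (adm_c A) (adm_0 A) (adm_M A).
pose f z := (sg * Phi z + F z) * g z.
(* f is nonnegative only almost everywhere; f' is its everywhere nonnegative version for the
   monotone convergence below. *)
pose f' z := Num.max (f z) 0.
pose C := M * M1 + \int[mu]_(z in Q) `|U z * (gt z + \sum_i gii i z)| + \int[mu]_(z in Q) `|F z * g z|.
have mf : measurable_fun (Q : set (space * measurableTypeR R)%type) f.
  apply: measurable_funM; first by apply: measurable_funD; [apply: measurable_funM => //; case: LPhi|case: LF].
  exact: continuous_in_measurable (adm_c A).
have mf' : measurable_fun (Q : set (space * measurableTypeR R)%type) f'.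
  apply: (@measurableT_comp _ _ _ _ _ _ (fun y : R => Num.max y 0)) => //.
  by apply: continuous_measurable_fun; exact: continuous_pos_part.
have ff' : {ae mu, forall z, Q z -> f z = f' z}.
  apply: ae_xtS FPhi => z Fz Qz; rewrite /f' max_l// /f mulr_ge0//.
  exact: Fz.
have DQ s : D s `<=` Q by move=> z [].
have bound s : 0 < s -> s <= tau -> (\int[mu]_(z in D s) (f' z)%:E <= C%:E)%E.
  move=> s0 st; have mD := late_cylinder_measurable s.
  have Ts : oo_time T s by split => //; apply: le_lt_trans Tt.2; rewrite lee_fin.
  have Hi := heat_density_integrable oO LU LPhi A s0.
  have ULD := integrableS mQ mD (DQ s) ULi.
  have FgD := integrableS mQ mD (DQ s) Fgi.
  have HLi : mu.-integrable (D s) (EFin \o (fun z => heat_density U Phi g gt gii z - U z * (gt z + \sum_i gii i z))).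
    by have := integrableB mD Hi ULD; apply: eq_integrable.
  have sHL : mu.-integrable (D s) (EFin \o (fun z => sg * (heat_density U Phi g gt gii z - U z * (gt z + \sum_i gii i z)))).
    by have := integrableZl mD sg HLi; apply: eq_integrable.
  (* The mass identity controls the whole heat density; sg Phi g is recovered by removing the part
     with U, integrable up to t = 0 since the masses are bounded. *)
  have fE z : f z = sg * (heat_density U Phi g gt gii z - U z * (gt z + \sum_i gii i z)) + F z * g z.
    by rewrite heat_densityE /f; ring.
  have fi : mu.-integrable (D s) (EFin \o f).
    by have := integrableD mD sHL FgD; apply: eq_integrable => // z _; rewrite /= fE.
  have aef : {ae mu, forall z, D s z -> 0 <= f z}.
    by apply: ae_xtS FPhi => z Fz [Qz _]; rewrite mulr_ge0// Fz.
  rewrite -(@Rintegral_ae_ge0 _ (space * measurableTypeR R)%type R mu (D s) mD f fi aef).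
  rewrite -[leLHS](fineK (integrable_fin_num mD fi)) lee_fin -[fine _]/(Rintegral _ _ _).
  have -> : \int[mu]_(z in D s) f z = sg * (\int[mu]_(z in D s) heat_density U Phi g gt gii z -
      \int[mu]_(z in D s) (U z * (gt z + \sum_i gii i z))) + \int[mu]_(z in D s) (F z * g z).
    rewrite -(RintegralB mD Hi ULD) -(RintegralZl sg mD HLi) -(RintegralD mD sHL FgD).
    by apply: eq_Rintegral => z _; exact: fE.
  have Db (h : spacetime -> R) : mu.-integrable Q (EFin \o h) -> `|\int[mu]_(z in D s) h z| <= \int[mu]_(z in Q) `|h z|.
    move=> hi; apply: le_trans (le_normr_Rintegral mD (integrableS mQ mD (DQ s) hi)) _.
    by apply: (@ge0_subset_Rintegral _ _ _ mu Q mQ) => //; exact: integrable_norm.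
  apply: le_trans (ler_norm _) _; apply: le_trans (ler_normD _ _) _; apply: lerD; last exact: Db.
  rewrite normrM sgn mul1r; apply: le_trans (ler_normB _ _) _; apply: lerD; last exact: Db.
  have /eqP := mass_identity oO LU LPhi weakU CU A Ts; rewrite addrC addr_eq0 => /eqP ->.
  by rewrite normrN; apply: (mass_le A) => //; apply: hM1; rewrite s0.
have f'Q : (\int[mu]_(z in Q) (f' z)%:E <= C%:E)%E.
  pose s (n : nat) := tau / n.+1%:R.
  have s0 n : 0 < s n by rewrite divr_gt0.
  have QE : \bigcup_n D (s n) = Q.
    apply/seteqP; split => [z [n _ []]//|z Qz].
    have z0 : 0 < z.2 by case: Qz => _ [].
    exists (Num.truncn (tau / z.2)) => //; split => //=.
    by rewrite /s ltr_pdivrMr// mulrC -ltr_pdivrMr//; exact: truncnS_gt.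
  have := @ge0_nondecreasing_set_cvg_integral _ (space * measurableTypeR R)%type R
    (fun n => D (s n)) (EFin \o f') mu.
  rewrite QE => H; have {}H : (\int[mu]_(z in D (s n)) (f' z)%:E)%E @[n --> \oo] --> (\int[mu]_(z in Q) (f' z)%:E)%E.
    apply: H.
    - move=> n m nm; apply/subsetPset => z [Qz /= sz]; split => //=; apply: le_lt_trans sz.
      by rewrite ler_pM2l// lef_pV2// ?posrE// ler_nat.
    - by move=> n; exact: late_cylinder_measurable.
    - by move=> n; apply/measurable_EFinP; exact: measurable_funS mf'.
    - by move=> n z _; rewrite lee_fin le_max lexx orbT.
  rewrite -(cvg_lim _ H)//; apply: lime_le; first exact: cvgP H.
  by apply: nearW => n; apply: bound => //; rewrite ler_pdivrMr// ler_pMr// ler1n.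
have f'i : mu.-integrable Q (EFin \o f').
  apply/integrableP; split; first exact/measurable_EFinP.
  under eq_integral do rewrite /= ger0_norm ?le_max ?lexx ?orbT//.
  by apply: le_lt_trans f'Q _; rewrite ltry.
have fi : mu.-integrable Q (EFin \o f).
  apply/integrableP; split; first exact/measurable_EFinP.
  have [_] := integrableP _ _ _ f'i; congr (_ < _)%E; apply: ae_eq_integral => //.
  - by apply/measurable_EFinP; apply: measurableT_comp => //.
  - by apply/measurable_EFinP; apply: measurableT_comp => //.
  - by apply: ae_xtS ff' => z ff' Qz /=; rewrite ff'.
have mKQ : mxt (K `&` Q) by apply: measurableI => //; exact: compact_measurable_mu.
have KQQ : K `&` Q `<=` Q by move=> z [].
(* On K the cutoff is 1, so sg (f - F g) = sg^2 Phi = Phi there. *)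
have := integrableZl mKQ sg (integrableB mKQ (integrableS mQ mKQ KQQ fi) (integrableS mQ mKQ KQQ Fgi)).
apply: eq_integrable => // z /set_mem[Kz [_ [z0 _]]] /=.
rewrite /f (g1 z); last first.
  by split; [exists z|rewrite /= in_itv/= (ltW z0) ltW// Ktau].
by congr EFin; rewrite !mulr1 addrK mulrA sg2 mul1r.
Qed.
End signed.

Section initial_trace.
Variables (K : set spacetime) (M : R) (g gt : spacetime -> R) (gi gii : 'I_N -> spacetime -> R).
Hypothesis A : admissible Omega T K M g gt gi gii.
Hypotheses (LU0 : L1upto0 Omega T U) (LPhi0 : L1upto0 Omega T Phi).

Lemma heat_density_integrable0 : mu.-integrable Q (EFin \o heat_density U Phi g gt gii).
Proof.
have cK := adm_K A; have KQ := adm_KQ A.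
have i1 := L1upto0_mul LU0 cK KQ (adm_heat_continuous A) (adm_heat_supp A) (adm_heat_bound A).
have i2 := L1upto0_mul LPhi0 cK KQ (adm_c A) (adm_0 A) (adm_M A).
have := integrableD mQ i1 i2; apply: eq_integrable => // z _.
by rewrite /= heat_densityE.
Qed.

(** The heat density is now integrable on the whole cylinder, so in the mass identity the integrals
    over {t > s} converge as s -> 0. Sequences of times are used in order to apply dominated
    convergence. *)
Lemma mass_cvg0 : mass Omega U g t @[t --> 0^'+] -->
  - \int[mu]_(z in Q) heat_density U Phi g gt gii z.
Proof.
have Hi := heat_density_integrable0.
apply/cvg_at_rightP => u [u0 u_cvg].
have [tau _ Tt] := oo_time_gt (lexx 0) T0.
have ut : \forall n \near \oo, oo_time T (u n).
  have tau0 : 0 < tau by case: Tt.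
  have /cvgrPdist_lt/(_ tau tau0) := u_cvg; apply: filterS => n.
  rewrite sub0r normrN gtr0_norm// => un; split => //.
  by apply: lt_trans Tt.2; rewrite lte_fin.
pose b n := \int[mu]_(z in D (u n)) heat_density U Phi g gt gii z.
have b_cvg : b n @[n --> \oo] --> \int[mu]_(z in Q) heat_density U Phi g gt gii z.
  pose h n := (heat_density U Phi g gt gii) \_ [set z : spacetime | u n < z.2].
  have bE n : b n = \int[mu]_(z in Q) h n z by rewrite /b Rintegral_mkcondr.
  have mE n : mxt [set z : spacetime | u n < z.2].
    apply: open_measurable_mu; apply: (@open_comp _ _ (fun z : spacetime => z.2) [set x : R | u n < x]); last exact: open_gt.
    by move=> z _; exact: cvg_snd.
  have Hm : measurable_fun (Q : set (space * measurableTypeR R)%type) (heat_density U Phi g gt gii).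
    by apply/measurable_EFinP; exact: measurable_int Hi.
  have [] := @dominated_convergence _ _ _ mu Q mQ (fun n => EFin \o h n)
     (EFin \o heat_density U Phi g gt gii) (EFin \o (fun z => `|heat_density U Phi g gt gii z|)).
  - move=> n; apply/measurable_EFinP; apply/(measurable_restrict _ (mE _) mQ); exact: measurable_funS Hm.
  - exact: measurable_int Hi.
  - apply: aeW => z Qz; apply/cvg_EFin; first by apply: nearW.
    have z0 : 0 < z.2 by case: Qz => _ [].
    apply: cvg_near_cst; have /cvgrPdist_lt/(_ _ z0) := u_cvg; apply: filterS => n.
    by rewrite sub0r normrN gtr0_norm// => un; rewrite /h /= patchE mem_set.
  - exact: integrable_norm.
  - apply: aeW => z n Qz; rewrite /= lee_fin /h patchE; case: ifPn => // _.
    by rewrite normr0.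
  move=> _ _ H; rewrite (_ : b = fun n => fine (\int[mu]_(z in Q) (h n z)%:E)%E); last first.
    by apply/funext => n; rewrite bE.
  apply: fine_cvg; rewrite /Rintegral fineK; first exact: H.
  exact: integrable_fin_num.
have : (fun n => - b n) @ \oo --> - \int[mu]_(z in Q) heat_density U Phi g gt gii z by exact: cvgN.
apply: cvg_trans; apply: near_eq_cvg; apply: filterS ut => n Tn.
have /eqP := mass_identity oO LU LPhi weakU CU A Tn; rewrite addr_eq0 => /eqP E.
by rewrite /b -E.
Qed.
End initial_trace.

End a_priori.

(** * The initial measure *)

Section initial_measure.
Context {R : realType} {N : nat}.
Local Notation space := 'rV[R]_N.
Local Notation spacetime := ('rV[R]_N * R)%type.
Local Notation mu := (@lebesgue_xt R N).
Local Notation mxt := (@measurable _ (space * measurableTypeR R)%type).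
Variables (Omega : set space) (T : \bar R).
Local Notation Q := (cylinder Omega T).
Local Notation Q0 := (cylinder0 Omega T).
Hypotheses (oO : open Omega) (T0 : (0 < T)%E).

Let mO : measurable Omega. Proof. exact: open_measurable_rV. Qed.

Lemma near_oo_time : \forall t \near (0 : R)^'+, oo_time T t.
Proof.
have [tau _ [tau0 tauT]] := oo_time_gt (lexx 0) T0.
near=> t; split; first by near: t; exact: nbhs_right_gt.
by apply: lt_trans tauT; rewrite lte_fin; near: t; exact: nbhs_right_lt.
Unshelve. all: by end_near. Qed.

(* g is a mollification of f(x) eta(t), where eta = 1 on [-1, tau]. *)
Lemma smooth_approximation (f : space -> R) : Cc Omega f -> exists S tau, [/\ compact S, S `<=` Omega,
  oo_time T tau & forall dlt : R, 0 < dlt -> exists K M g gt gi gii,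
  [/\ admissible Omega T K M g gt gi gii,
      forall t x, 0 < t <= tau -> `|g (x, t) - f x| <= dlt &
      forall t x, 0 < t <= tau -> ~ S x -> g (x, t) - f x = 0]].
Proof.
move=> [cf [Kf [cKf KfO f0]]].
have [tau _ Tt] := oo_time_gt (lexx 0) T0; have tau0 : 0 < tau by case: Tt.
have [t1 tt1 Tt1] := oo_time_gt (ltW tau0) Tt.2; have t10 : 0 < t1 by case: Tt1.
have [t2 tt2 Tt2] := oo_time_gt (ltW t10) Tt1.2.
have d0 : 0 < t1 - tau by rewrite subr_gt0.
(* The rise takes place at negative times, so the support is compact and the value is 1 on all of
   ]0, tau]. *)
pose eta t := step (-2) 1 t * (1 - step tau (t1 - tau) t).
have ceta : continuous eta.
  move=> t; apply: cvgM; first exact: continuous_step.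
  by apply: cvgB; [exact: cvg_cst|exact: continuous_step].
have eta1 t : 0 < t <= tau -> eta t = 1.
  by move=> /andP[t0 tt]; rewrite /eta step1//; [rewrite step0// subr0 mulr1|lra].
have eta0 t : ~ `[- 2, t1]%classic t -> eta t = 0.
  rewrite /= in_itv/= => /negP; rewrite negb_and -!ltNge => /orP[t2'|t1'].
    by rewrite /eta step0 ?mul0r// ltW.
  by rewrite /eta (step1 d0) ?subrr ?mulr0// addrC subrK ltW.
pose w (z : spacetime) := f z.1 * eta z.2.
have cw : continuous w.
  move=> z; apply: cvgM.
    by apply: (@continuous_comp _ _ _ fst f); [exact: cvg_fst|exact: cf].
  by apply: (@continuous_comp _ _ _ snd eta); [exact: cvg_snd|exact: ceta].
pose K0 : set spacetime := Kf `*` `[- 2, t1]%classic.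
have cK0 : compact K0 by apply: compact_setX => //; exact: segment_compact.
have w0 z : ~ K0 z -> w z = 0.
  by move=> /not_andP[nK|nt]; rewrite /w; [rewrite f0// mul0r|rewrite eta0// mulr0].
have K0W : K0 `<=` Omega `*` [set t : R | t < t2].
  move=> [x t] [/= /KfO Ox]; rewrite in_itv/= => /andP[_ tt]; split => //=.
  exact: le_lt_trans tt2.
have [d dpos [K' [cK' K'W KK']]] := compact_thicken_xt cK0 (@open_below _ _ _ oO t2) K0W.
(* S and tau are chosen before dlt, so that a mass bound on S up to tau is uniform over all
   approximations. *)
exists (fst @` K'), tau; split => //.
- by apply: continuous_compact => //; apply: continuous_subspaceT => z; exact: cvg_fst.
- by move=> _ [z /K'W[Oz _] <-].
move=> dlt dlt0.
have [dd dd0 hdd] := supp_unif_continuous dlt0 cw cK0 w0.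
have e0 : 0 < Num.min d dd by rewrite lt_min dpos.
have [rho mrho] := @mollifier_exists R N _ e0.
have wi : mu.-integrable setT (EFin \o w).
  apply: (compact_integrable _ cK0) => //; first exact: continuous_measurable_xtT.
  by have [M _ hM] := supp_bounded cw cK0 w0; exists M.
have [gt [gi [gii gC]]] := smooth_C21 (fun k => Ck_mollified k wi mrho).
have g0 z : ~ K' z -> convol w rho z = 0.
  apply: (@convol_supp R N w rho _ K0 K' z w0 _ mrho) => y v Ky ve.
  by apply: KK' => //; apply: le_trans ve _; rewrite ge_min lexx.
have [M _ A] := late_admissible oO gC Tt2 cK' K'W g0.
exists (late K' 0), M, (convol w rho), gt, gi, gii; split => //.
- move=> t x tt; have -> : f x = w (x, t) by rewrite /w eta1// mulr1.
  apply: (@convol_close R N w rho _ dlt K0 (x, t) cw cK0 w0 mrho) => v ve; apply: ltW; apply: hdd.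
  by apply: lt_le_trans ve _; rewrite ge_min lexx orbT.
- move=> t x tt nS; rewrite g0; last by move=> K'xt; apply: nS; exists (x, t).
  rewrite f0 ?subrr// => Kfx; apply: nS; exists (x, 0) => //.
  rewrite -[(x, 0)]add0r; apply: KK'; last by rewrite normr0 ltW.
  have h2 : - 2 <= 0 :> R by lra.
  by split => //; rewrite /= in_itv/= h2 ltW.
Qed.

Variables (U Phi : spacetime -> R).
Hypotheses (LU : L1loc_xt Q U) (LPhi : L1loc_xt Q Phi).
Hypothesis weakU : forall phi, test_function Q phi -> (forall z, Q z -> 0 <= phi z) ->
  heat_integral Omega T U Phi phi = 0%E.
Hypothesis CU : C_L1loc Omega T U.
Hypothesis U0 : {ae mu, forall z, Q z -> 0 <= U z}.
Hypotheses (bU : bounded_mass Omega T U) (LPhi0 : L1upto0 Omega T Phi).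

Let LU0 : L1upto0 Omega T U. Proof. exact: bounded_mass_L1upto0. Qed.

Definition slice_pairing (f : space -> R) (t : R) : R := \int[lebesgue_x]_(x in Omega) (U (x, t) * f x).

(** A perturbation of size dlt supported in S moves the pairing by at most dlt times the mass on S;
    approximating f and freezing a test at t = 0 both rely on it. *)
Lemma slice_mul_le (S : set space) (h : space -> R) (t dlt M : R) : compact S -> S `<=` Omega ->
  oo_time T t -> measurable_fun S h -> 0 <= dlt -> (forall x, S x -> `|h x| <= dlt) ->
  (forall x, Omega x -> ~ S x -> h x = 0) ->
  (\int[lebesgue_x]_(x in S) `|U (x, t)|%:E <= M%:E)%E ->
  lebesgue_x.-integrable Omega (EFin \o (fun x => U (x, t) * h x)) /\
  `|\int[lebesgue_x]_(x in Omega) (U (x, t) * h x)| <= dlt * M.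
Proof.
move=> cS SO Tt mh dlt0 hS h0 hM; have mS := compact_measurable_rV cS.
have Ui := (CU.1 t Tt).2 _ cS SO; split.
  exact: (@integrable_supported_mul _ space R lebesgue_x S Omega mS mO SO _ h dlt).
apply: le_trans (@Rintegral_supported_mul_le _ space R lebesgue_x S Omega mS SO _ h dlt Ui mh hS h0) _.
rewrite ler_wpM2l//.
by rewrite -lee_fin /Rintegral fineK//; exact: (integrable_fin_num mS (integrable_norm Ui)).
Qed.

Lemma Cc_slice_integrable f t : Cc Omega f -> oo_time T t ->
  lebesgue_x.-integrable Omega (EFin \o (fun x => U (x, t) * f x)).
Proof.
move=> [cf [K [cK KO f0]]] Tt; have [M M0 hM] := supp_bounded cf cK f0.
have [M1 hM1] := bU cK KO Tt.
have mf : measurable_fun K f by apply: measurable_funTS; apply: continuous_measurable_rV => //; exact: continuous_subspaceT.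
have t0 : 0 < t by case: Tt.
by have [] := slice_mul_le cK KO Tt mf (ltW M0) (fun x _ => hM x) (fun x _ => f0 x) (hM1 t _); rewrite ?t0 ?lexx.
Qed.

(** A Cauchy argument: for an approximation g of f the masses converge by [mass_cvg0], and the
    pairings with f stay within dlt (|M| + 1) = e / 2 of them. *)
Lemma slice_pairing_cvg f : Cc Omega f -> cvg (slice_pairing f t @[t --> 0^'+]).
Proof.
move=> Cf; have [S [tau [cS SO Ttau approx]]] := smooth_approximation Cf.
have [M hM] := bU cS SO Ttau.
apply/cauchy_cvgP/cauchy_exP => e /= e0.
pose dlt := e / 2 / (`|M| + 1).
have dlt0 : 0 < dlt by rewrite divr_gt0 ?divr_gt0// ltr_wpDl.
have [K [M' [g [gt [gi [gii [A gf gS]]]]]]] := approx _ dlt0.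
have := mass_cvg0 oO T0 LU LPhi weakU CU A LU0 LPhi0.
set L := (- _) => gL; exists L.
have e20 : 0 < e / 2 by rewrite divr_gt0.
have /cvgrPdist_lt/(_ _ e20) near1 := gL.
have tau0 : 0 < tau by case: Ttau.
have cf : continuous f by case: Cf.
near=> t.
have Tt : oo_time T t by near: t; exact: near_oo_time.
have tt : 0 < t <= tau.
  apply/andP; split; first by case: Tt.
  by apply: ltW; near: t; exact: nbhs_right_lt.
have Lg : `|L - mass Omega U g t| < e / 2 by near: t.
rewrite /ball/=.
have mh : measurable_fun S (fun x => g (x, t) - f x).
  apply: measurable_funB.
    by apply: (slice_measurable oO Tt _ SO (adm_c A)); exact: compact_measurable_rV.
  by apply: measurable_funTS; apply: continuous_measurable_rV => //; exact: continuous_subspaceT.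
have [hi hle] := slice_mul_le cS SO Tt mh (ltW dlt0) (fun x _ => gf t x tt) (fun x _ => gS t x tt) (hM t tt).
have fi := Cc_slice_integrable Cf Tt.
have gi' := slice_integrable oO (adm_K A) (adm_KQ A) Tt (adm_c A) (adm_0 A) (adm_M A) (CU.1 t Tt).
have diff : mass Omega U g t - slice_pairing f t = \int[lebesgue_x]_(x in Omega) (U (x, t) * (g (x, t) - f x)).
  by rewrite -(RintegralB mO gi' fi); apply: eq_Rintegral => x _; rewrite mulrBr.
have -> : L - slice_pairing f t = (L - mass Omega U g t) + (mass Omega U g t - slice_pairing f t).
  by rewrite addrA subrK.
rewrite (splitr e); apply: le_lt_trans (ler_normD _ _) _; apply: ltr_leD => //.
rewrite diff; apply: le_trans hle _.
apply: (@le_trans _ _ (dlt * (`|M| + 1))).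
  apply: ler_wpM2l; first exact: ltW.
  by apply: le_trans (ler_norm _) _; rewrite lerDl.
by rewrite /dlt mulfVK// gt_eqF// ltr_wpDl.
Unshelve. all: by end_near. Qed.

Definition initial_functional (f : space -> R) : R := lim (slice_pairing f t @[t --> 0^'+]).

Lemma initial_functionalP f : Cc Omega f -> slice_pairing f t @[t --> 0^'+] --> initial_functional f.
Proof. exact: slice_pairing_cvg. Qed.

Lemma initial_functional_eq f (l : R) : slice_pairing f t @[t --> 0^'+] --> l -> initial_functional f = l.
Proof. by move=> /cvg_lim; exact. Qed.

Lemma initial_functionalD f g : Cc Omega f -> Cc Omega g ->
  initial_functional (fun x => f x + g x) = initial_functional f + initial_functional g.
Proof.
move=> Cf Cg; apply: initial_functional_eq.
apply: cvg_trans (cvgD (initial_functionalP Cf) (initial_functionalP Cg)).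
apply: near_eq_cvg; apply: filterS near_oo_time => t Tt.
have E : slice_pairing (fun x => f x + g x) t = slice_pairing f t + slice_pairing g t.
  rewrite /slice_pairing -(RintegralD mO (Cc_slice_integrable Cf Tt) (Cc_slice_integrable Cg Tt)).
  by apply: eq_Rintegral => x _; rewrite mulrDr.
exact: esym E.
Qed.

Lemma initial_functionalZ c f : Cc Omega f ->
  initial_functional (fun x => c * f x) = c * initial_functional f.
Proof.
move=> Cf; apply: initial_functional_eq.
apply: cvg_trans (cvgM (cvg_cst c) (initial_functionalP Cf)).
apply: near_eq_cvg; apply: filterS near_oo_time => t Tt.
have E : slice_pairing (fun x => c * f x) t = c * slice_pairing f t.
  rewrite /slice_pairing -(RintegralZl c mO (Cc_slice_integrable Cf Tt)).
  by apply: eq_Rintegral => x _; rewrite mulrCA.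
exact: esym E.
Qed.

(** Each slice of U is nonnegative almost everywhere on the support of f by [slice_ge0]. *)
Lemma initial_functional_ge0 f : Cc Omega f -> (forall x, 0 <= f x) -> 0 <= initial_functional f.
Proof.
move=> Cf f0; have [cf [K [cK KO fK]]] := Cf.
apply: limr_ge; first exact: slice_pairing_cvg.
apply: filterS near_oo_time => t Tt.
have fi := Cc_slice_integrable Cf Tt.
rewrite /slice_pairing /Rintegral (Rintegral_ae_ge0 mO fi).
  by apply: fine_ge0; apply: integral_ge0 => x _; rewrite lee_fin le_max lexx orbT.
apply: filterS (slice_ge0 oO CU LU U0 cK KO Tt) => x Ux Ox.
have [Kx|nK] := pselect (K x); first by rewrite mulr_ge0 ?Ux.
by rewrite fK// mulr0.
Qed.

(** Around each (x, 0), continuity within Omega x [0, T) compares both phi(y, t) and phi(y, 0) with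
    phi(x, 0); compactness of the shadow of K makes this uniform. *)
Lemma uniform_initial_trace (phi : spacetime -> R) (K : set spacetime) (e : R) : 0 < e ->
  {within Q0, continuous phi} -> compact K -> K `<=` Q0 -> (forall z, Q0 z -> ~ K z -> phi z = 0) ->
  \forall t \near (0 : R)^'+, forall x, Omega x -> `|phi (x, t) - phi (x, 0)| <= e.
Proof.
move=> e0 cphi cK KQ phi0.
have cS : compact (fst @` K : set space) by exact: shadow_compact.
have SO : fst @` K `<=` Omega by exact: shadow_sub KQ.
pose P (t : R) (x : space) := Omega x -> `|phi (x, t) - phi (x, 0)| <= e.
have H : \forall t \near (0 : R)^'+, fst @` K `<=` P t.
  apply: (proj1 (compact_near_coveringP (fst @` K)) cS R (0 : R)^'+ P) => x /SO Ox.
  have Qx : Q0 (x, 0) by [].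
  have e20 : 0 < e / 2 by rewrite divr_gt0.
  have /subspace_continuousP/(_ _ Qx)/cvgrPdist_lt/(_ _ e20) [[A B] /= [nA nB] AB] := cphi.
  have nB0 : nbhs (0 : R)^'+ B by exact: cvg_within nB.
  exists (A, B `&` oo_time T) => /=.
    by split => //; apply: filterI => //; exact: near_oo_time.
  move=> [y t] [/= Ay [Bt [t0 tT]]] Oy.
  have h1 : `|phi (x, 0) - phi (y, t)| < e / 2.
    by apply: (AB (y, t)) => //; split => //; split => //; exact: ltW.
  have h2 : `|phi (x, 0) - phi (y, 0)| < e / 2.
    by apply: (AB (y, 0)) => //; split => //=; exact: nbhs_singleton.
  rewrite -(subrKA (phi (x, 0))) (splitr e); apply: le_trans (ler_normD _ _) _.
  by rewrite distrC; apply: lerD; exact: ltW.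
near=> t => x Ox; have [Sx|nS] := pselect ((fst @` K) x).
  by have : fst @` K `<=` P t by [near: t]; exact.
have Tt : oo_time T t by near: t; exact: near_oo_time.
rewrite !phi0 ?subrr ?normr0 ?ltW//.
- by move=> Kx; apply: nS; exists (x, 0).
- by case: Tt => t0 tT; split => //; split => //; exact: ltW.
- by move=> Kx; apply: nS; exists (x, t).
Unshelve. all: by end_near. Qed.

(* The trace at t = 0 of phi is only continuous, but phi(t) - phi(0) tends to 0
   uniformly while the masses stay bounded. *)
Lemma initial_functional_trace (phi : spacetime -> R) (K : set spacetime) (M : R) gt gi gii :
  {within Q0, continuous phi} -> (forall z, Q0 z -> ~ K z -> phi z = 0) ->
  admissible Omega T K M phi gt gi gii ->
  Cc Omega ((fun x => phi (x, 0)) \_ Omega) ->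
  initial_functional ((fun x => phi (x, 0)) \_ Omega) = - \int[mu]_(z in Q) heat_density U Phi phi gt gii z.
Proof.
move=> cphi phi0 A Cf; set f := (_ \_ Omega) in Cf *.
have cK := adm_K A; have KQ := adm_KQ A.
have cS : compact (fst @` K : set space) by exact: shadow_compact.
have SO : fst @` K `<=` Omega by exact: shadow_sub KQ.
have [tau _ Ttau] := oo_time_gt (lexx 0) T0.
have tau0 : 0 < tau by case: Ttau.
have [M1 hM] := bU cS SO Ttau.
have gL := mass_cvg0 oO T0 LU LPhi weakU CU A LU0 LPhi0.
apply: initial_functional_eq.
have cf : continuous f by case: Cf.
have D : (fun t => mass Omega U phi t - slice_pairing f t) t @[t --> 0^'+] --> (0 : R).
  apply/cvgrPdist_le => e e0.
  pose dlt := e / (`|M1| + 1).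
  have dlt0 : 0 < dlt by rewrite divr_gt0// ltr_wpDl.
  have near1 := uniform_initial_trace dlt0 cphi cK KQ phi0.
  near=> t.
  have Tt : oo_time T t by near: t; exact: near_oo_time.
  have tt : 0 < t <= tau.
    by apply/andP; split; [case: Tt|apply: ltW; near: t; exact: nbhs_right_lt].
  have ht : forall x, Omega x -> `|phi (x, t) - phi (x, 0)| <= dlt by near: t.
  have hf x : Omega x -> f x = phi (x, 0) by move=> Ox; rewrite /f patchE mem_set.
  have mh : measurable_fun (fst @` K) (fun x => phi (x, t) - f x).
    apply: measurable_funB.
      by apply: (slice_measurable oO Tt _ SO (adm_c A)); exact: compact_measurable_rV.
    by apply: measurable_funTS; apply: continuous_measurable_rV => //; exact: continuous_subspaceT.
  have h1 x : (fst @` K) x -> `|phi (x, t) - f x| <= dlt by move=> /SO Ox; rewrite hf// ht.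
  have h2 x : Omega x -> ~ (fst @` K) x -> phi (x, t) - f x = 0.
    move=> Ox nS; rewrite hf// !phi0 ?subrr//.
    - by move=> Kx; apply: nS; exists (x, 0).
    - by case: Tt => t0 tT; split => //; split => //; exact: ltW.
    - by move=> Kx; apply: nS; exists (x, t).
  have [hi hle] := slice_mul_le cS SO Tt mh (ltW dlt0) h1 h2 (hM t tt).
  have fi := Cc_slice_integrable Cf Tt.
  have gi' := slice_integrable oO cK KQ Tt (adm_c A) (adm_0 A) (adm_M A) (CU.1 t Tt).
  rewrite sub0r normrN.
  have -> : mass Omega U phi t - slice_pairing f t = \int[lebesgue_x]_(x in Omega) (U (x, t) * (phi (x, t) - f x)).
    by rewrite -(RintegralB mO gi' fi); apply: eq_Rintegral => x _; rewrite mulrBr.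
  apply: le_trans hle _; apply: (@le_trans _ _ (dlt * (`|M1| + 1))).
    apply: ler_wpM2l; first exact: ltW.
    by apply: le_trans (ler_norm _) _; rewrite lerDl.
  by rewrite /dlt mulfVK// gt_eqF// ltr_wpDl.
have H : (fun t => mass Omega U phi t - (mass Omega U phi t - slice_pairing f t)) t @[t --> 0^'+] -->
    (- \int[mu]_(z in Q) heat_density U Phi phi gt gii z) - 0 by exact: (cvgB gL D).
move: H; rewrite subr0 (_ : (fun t => _) = slice_pairing f)//.
by apply/funext => t; rewrite opprB addrC subrK.
Unshelve. all: by end_near. Qed.

Lemma initial_measure : exists m : {measure set space -> \bar R}, radon_measure Omega m /\
  forall f, Cc Omega f -> (\int[m]_(x in Omega) (f x)%:E = (initial_functional f)%:E)%E.
Proof.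
exact: (riesz_representation oO initial_functionalD initial_functionalZ initial_functional_ge0).
Qed.

(** Only the values of [phi] on Omega are meaningful; its extension by zero lies in [Cc Omega] and
    has the same integrals over Omega. *)
Lemma weak_convergence (phi : space -> R) : Ck_c Omega 0 phi ->
  Cc Omega (phi \_ Omega) /\
  (\int[lebesgue_x]_(x in Omega) (U (x, t) * phi x)%:E)%E @[t --> (0 : R)^'+] -->
    (initial_functional (phi \_ Omega))%:E.
Proof.
move=> [[cphi _] [K [cK KO phi0]]].
have Cp : Cc Omega (phi \_ Omega).
  split; last first.
    exists K; split => // x nK; rewrite patchE; case: ifPn => // /set_mem Ox.
    exact: phi0.
  apply: (@patch_continuous _ _ Omega K oO (supp_closed cK) KO) => // x Ox.
  by move: cphi; rewrite continuous_open_subspace// => /(_ x); rewrite inE; exact.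
split => //.
have H : (slice_pairing (phi \_ Omega) t)%:E @[t --> (0 : R)^'+] --> (initial_functional (phi \_ Omega))%:E.
  by apply/cvg_EFin; [exact: nearW|exact: initial_functionalP].
apply: cvg_trans H; apply: near_eq_cvg; apply: filterS near_oo_time => t Tt.
have fi := Cc_slice_integrable Cp Tt.
rewrite /slice_pairing /Rintegral fineK; last exact: integrable_fin_num.
by apply: eq_integral => x Ox; rewrite patchE Ox.
Qed.

(** The extensions of the derivatives that [Ck] provides are continuous on Omega x [0, T), hence
    bounded on the compact K: this is the control near t = 0 that [admissible] asks for. *)
Lemma Ck_admissible (phi : spacetime -> R) : Ck_c Q0 2 phi -> exists K M gt gi gii,
  [/\ admissible Omega T K M phi gt gi gii, forall z, Q0 z -> ~ K z -> phi z = 0 &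
      heat_integral Omega T U Phi phi = (\int[mu]_(z in Q) heat_density U Phi phi gt gii z)%:E].
Proof.
move=> [[cphi dphi] [K [cK KQ phi0]]].
have oQ : open Q by exact: open_cylinder.
have QI z : Q z -> Q0° z.
  move=> Qz; have : nbhs z Q by exact: open_nbhs_nbhs.
  by apply: filterS; exact: cylinder_sub0.
have [dt_ [gt gtE [cgt _]]] := dphi ((0, 1) : spacetime).
have /choice[gi hgi] i : exists gi : spacetime -> R, [/\ {within Q0, continuous gi},
   forall z, Q z -> is_derive z ((delta_mx 0 i, 0) : spacetime) phi (gi z) &
   exists2 gii : spacetime -> R, {within Q0, continuous gii} &
     forall z, Q z -> is_derive z ((delta_mx 0 i, 0) : spacetime) gi (gii z)].
  have [d1 [gi giE [cgi d2]]] := dphi ((delta_mx 0 i, 0) : spacetime).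
  have [d3 [gii giiE [cgii _]]] := d2 ((delta_mx 0 i, 0) : spacetime).
  exists gi; split => //.
    by move=> z /QI Qz; apply: DeriveDef; [exact: d1|rewrite giE].
  by exists gii => // z /QI Qz; apply: DeriveDef; [exact: d3|rewrite giiE].
have /choice[gii hgii] i : exists gii : spacetime -> R, {within Q0, continuous gii} /\
     forall z, Q z -> is_derive z ((delta_mx 0 i, 0) : spacetime) (gi i) (gii z).
  by have [_ _ [gii h1 h2]] := hgi i; exists gii.
have cQ (h : spacetime -> R) : {within Q0, continuous h} -> forall z, Q z -> {for z, continuous h}.
  move=> ch z Qz; have := continuous_subspaceW (@cylinder_sub0 R N Omega T) ch.
  by rewrite continuous_open_subspace// => /(_ z); rewrite inE; exact.
have bK (h : spacetime -> R) : {within Q0, continuous h} -> exists M, forall z, Q z -> K z -> `|h z| <= M.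
  move=> ch; have [M _ hM] := within_bounded (continuous_subspaceW KQ ch) cK.
  by exists M => z _; exact: hM.
have dgt z : Q z -> is_derive z ((0, 1) : spacetime) phi (gt z).
  by move=> /QI Qz; apply: DeriveDef; [exact: dt_|rewrite gtE].
have [M _ A] : exists2 M : R, 0 <= M & admissible Omega T K M phi gt gi gii.
  apply: admissible_intro => //.
  - exact: cQ.
  - exact: cQ.
  - by move=> i; apply: cQ; case: (hgi i).
  - by move=> i; apply: cQ; case: (hgii i).
  - by move=> i; case: (hgi i).
  - by move=> i; case: (hgii i).
  - by move=> z /cylinder_sub0; exact: phi0.
  - exact: bK.
  - exact: bK.
  - by move=> i; apply: bK; case: (hgii i).
exists K, M, gt, gi, gii; split => //.
have Hi := heat_density_integrable0 oO A LU0 LPhi0.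
have mQ : mxt Q by exact: open_measurable_mu.
rewrite /Rintegral fineK; last exact: integrable_fin_num.
apply: eq_integral => z /set_mem Qz; congr EFin.
rewrite /heat_density; congr (_ * _ + _ * _ + _).
  by have [_ <-] := dgt z Qz.
apply: eq_bigr => i _; rewrite /dx.
have [_ d1 _] := hgi i; have [_ d2] := hgii i; have [_ <-] := d2 z Qz.
(* The inner derivative [dx i phi] is identified with [gi i] on Q only; Q is open, so they agree
   near z and can be differentiated once more. *)
apply: near_eq_derive; have : nbhs z Q by exact: open_nbhs_nbhs.
by apply: filterS => y Qy; have [_ <-] := d1 y Qy.
Qed.

Lemma initial_trace_identity (phi : spacetime -> R) : Ck_c Q0 2 phi ->
  Cc Omega ((fun x => phi (x, 0)) \_ Omega) /\
  (- heat_integral Omega T U Phi phi = (initial_functional ((fun x => phi (x, 0)) \_ Omega))%:E)%E.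
Proof.
move=> Ckphi; have [K [M [gt [gi [gii [A phi0 ->]]]]]] := Ck_admissible Ckphi.
have [[cphi _] _] := Ckphi.
have cK := adm_K A; have KQ := adm_KQ A.
have cS : compact (fst @` K : set space) by exact: shadow_compact.
have SO : fst @` K `<=` Omega by exact: shadow_sub KQ.
have f0 x : Omega x -> ~ (fst @` K) x -> phi (x, 0) = 0.
  by move=> Ox nS; apply: phi0 => // Kx; apply: nS; exists (x, 0).
have Cf : Cc Omega ((fun x => phi (x, 0)) \_ Omega).
  split; last first.
    exists (fst @` K); split => // x nK; rewrite patchE; case: ifPn => // /set_mem Ox.
    exact: f0.
  apply: (@patch_continuous _ _ Omega _ oO (supp_closed cS) SO) => // x Ox.
  have Qx : Q0 (x, 0) by [].
  move=> P /((subspace_continuousP _ _).1 cphi _ Qx) [[A' B] /= [nA nB] AB].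
  have : nbhs x (A' `&` Omega) by apply: filterI => //; exact: open_nbhs_nbhs.
  apply: filterS => y [Ay Oy] /=; apply: (AB (y, 0)); last by split.
  by split => //=; exact: nbhs_singleton.
split => //.
by rewrite (initial_functional_trace cphi phi0 A Cf).
Qed.
End initial_measure.

Theorem lemma2p17 (R : realType) (N : nat) (T : \bar R) (Omega : set 'rV[R]_N)
    (U Phi : 'rV[R]_N * R -> R) :
  (1 <= N)%N -> (0 < T)%E -> domain Omega ->
  L1loc_xt (cylinder Omega T) Phi ->
  C_L1loc Omega T U ->
  weak_solution Omega T U Phi ->
  {ae lebesgue_xt, forall z, cylinder Omega T z -> 0 <= U z} ->
  (forall F : 'rV[R]_N * R -> R,
    L1loc_xt (cylinder0 Omega T) F ->
    {ae lebesgue_xt, forall z, cylinder Omega T z -> - F z <= Phi z} ->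
    exists U0 : {measure set 'rV[R]_N -> \bar R},
      [/\ radon_measure Omega U0,
          forall phi : 'rV[R]_N -> R, Ck_c Omega 0 phi ->
            (\int[lebesgue_x]_(x in Omega) (U (x, t) * phi x)%:E)%E
              @[t --> (0 : R)^'+] --> (\int[U0]_(x in Omega) (phi x)%:E)%E,
          Lploc_L1loc 1%:E Omega T Phi
        & forall phi : 'rV[R]_N * R -> R, Ck_c (cylinder0 Omega T) 2 phi ->
            (- heat_integral Omega T U Phi phi =
             \int[U0]_(x in Omega) (phi (x, 0))%:E)%E]) /\
  ({ae lebesgue_xt, forall z, cylinder Omega T z -> 0 <= Phi z} \/
   {ae lebesgue_xt, forall z, cylinder Omega T z -> Phi z <= 0} ->
   (Lploc_L1loc 1%:E Omega T Phi <-> Lploc_L1loc +oo Omega T U)).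
Proof.
move=> _ T0 [oO _ _] LPhi CU [LU weakU] U0.
have upper F : L1upto0 Omega T F -> {ae lebesgue_xt, forall z, cylinder Omega T z -> - F z <= Phi z} ->
    bounded_mass Omega T U.
  by move=> LF FPhi; exact: (lower_bound_bounded_mass oO LU LPhi weakU CU U0 LF FPhi).
have signed F sg : sg * sg = 1 -> L1upto0 Omega T F ->
    {ae lebesgue_xt, forall z, cylinder Omega T z -> 0 <= sg * Phi z + F z} ->
    bounded_mass Omega T U -> L1upto0 Omega T Phi.
  by move=> sg2 LF FPhi bU; exact: (signed_L1upto0 oO T0 LU LPhi weakU CU sg2 LF FPhi bU).
split=> [F LF FPhi|signPhi].
  have LF0 := L1loc_xt_L1upto0 oO T0 LF.
  have bU := upper F LF0 FPhi.
  have LPhi0 : L1upto0 Omega T Phi.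
    apply: (signed F 1) => //; first by rewrite mulr1.
    by apply: ae_xtS FPhi => z Fz Qz; rewrite mul1r addrC -lerBlDl sub0r Fz.
  have [m [radm mE]] := initial_measure oO T0 LU LPhi weakU CU U0 bU LPhi0.
  exists m; split => //.
  - move=> phi Cphi.
    have [Cp] := weak_convergence oO T0 LU LPhi weakU CU bU LPhi0 Cphi.
    (* [mE] concerns the extension by zero, which coincides with phi on the domain of
       integration. *)
    rewrite -mE//; set L := (X in _ --> X); rewrite (_ : L = (\int[m]_(x in Omega) (phi x)%:E)%E)//.
    by apply: eq_integral => x Ox; rewrite patchE Ox.
  - exact: L1upto0_Lploc.
  - move=> phi Cphi.
    have [Cf ->] := initial_trace_identity oO T0 LU LPhi weakU CU bU LPhi0 Cphi.
    by rewrite -mE//; apply: eq_integral => x Ox; rewrite patchE Ox.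
split=> [L1Phi|LooU].
  apply: bounded_mass_Lploc => //.
  have LF := L1loc_xt_L1upto0 oO T0 (Lploc_L1loc_xt oO T0 L1Phi).
  apply: (upper _ LF); apply: aeW => z Qz; rewrite patchE mem_set//.
  by rewrite lerNl -normrN ler_norm.
have bU := Lploc_bounded_mass oO CU LooU.
have L00 : L1upto0 Omega T (fun _ : 'rV[R]_N * R => 0 : R).
  by split => // K cK KQ; exact: integrable0.
(* For a Phi of constant sign F is 0, and [sg] is that sign. *)
apply: L1upto0_Lploc => //; case: signPhi => Phi0.
  apply: (signed (fun=> 0) 1) => //; first by rewrite mulr1.
  by apply: ae_xtS Phi0 => z Fz Qz; rewrite mul1r addr0 Fz.
apply: (signed (fun=> 0) (-1)) => //; first by rewrite mulrNN mulr1.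
by apply: ae_xtS Phi0 => z Fz Qz; rewrite mulN1r addr0 oppr_ge0 Fz.
Qed.
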